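(* The decision problem FireFightingInTime — given a graph $G$, $m\in\mathbb{N}_{>0}$ and $T\in\mathbb{N}_{>0}$, decide whether there exists a winning $m$-strategy for $G$ of length $T$ — is NP-hard even when restricted to trees. In particular, it is NP-hard even on trees of diameter at most $4$, and on spiders (trees in which at most one node has degree greater than $2$).
   Context: All graphs are finite, simple and undirected. For a graph $G=(V,E)$ and $W\subseteq V$, $N(W)$ is the set of nodes in $V\setminus W$ adjacent to at least one node of $W$. For $m\in\mathbb{N}_{>0}$, an $m$-strategy of length $T$ is a sequence $(F_1,\dots,F_T)$ of subsets of $V$ with $|F_i|\le m$. Its burning sets are $B_0=V$ and $B_t=(B_{t-1}\setminus F_t)\cup N(B_{t-1}\setminus F_t)$ for $t\ge1$, where $F_t=\emptyset$ for $t>T$. The strategy is winning (in time $T$) if $B_T=\emptyset$. *)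

(* Defs.v *)
From mathcomp Require Import all_boot all_order all_algebra.

Set Implicit Arguments.
Unset Strict Implicit.
Unset Printing Implicit Defensive.

(** * Polynomial time and NP-hardness *)

Definition word := seq bool.

(* A tape, infinite in both directions, is a pair (l, r): the head scans the
   first symbol of r, and l lists the cells to its left, nearest first.  [None]
   is the blank; cells beyond the two lists are blank. *)
Section Tape.
Variable symbol : Type.

Definition tape := (seq (option symbol) * seq (option symbol))%type.

Inductive move := MoveL | Stay | MoveR.

Definition read (t : tape) : option symbol := head None t.2.

Definition write (a : option symbol) (t : tape) : tape := (t.1, a :: behead t.2).

Definition move_head (d : move) (t : tape) : tape :=
  match d with
  | MoveL => (behead t.1, head None t.1 :: t.2)
  | Stay  => t
  | MoveR => (read t :: t.1, behead t.2)
  end.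
End Tape.

(* Deterministic Turing machines with [extra_tapes.+1] tapes.  Tape 0 holds the
   input and, at the end, the output.  A nonblank symbol is either a bit
   or an element of the machine's own finite work alphabet. *)
Record TM := MkTM {
  extra_tapes : nat;
  state : finType;
  work_symbol : finType;
  start : state;
  halting : pred state;
  trans : state -> {ffun 'I_extra_tapes.+1 -> option (bool + work_symbol)} ->
          state * {ffun 'I_extra_tapes.+1 ->
                     option (bool + work_symbol) * move}
}.

Section Run.
Variable M : TM.

Definition symbol : Type := (bool + work_symbol M)%type.

Definition config : Type :=
  (state M * {ffun 'I_(extra_tapes M).+1 -> tape symbol})%type.

Definition step (c : config) : config :=
  if halting c.1 then c else
  let: (q, act) := trans c.1 [ffun i => read (c.2 i)] in
  (q, [ffun i => move_head (act i).2 (write (act i).1 (c.2 i))]).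

Definition init (w : word) : config :=
  (start M,
   [ffun i => ([::], if i == ord0 then [seq Some (inl b) | b <- w] else [::])]).

(* The bits from the scanned cell up to the first cell that holds no bit. *)
Fixpoint leading_bits (s : seq (option symbol)) : word :=
  if s is Some (inl b) :: s' then b :: leading_bits s' else [::].

Definition outputs_within (t : nat) (w v : word) : Prop :=
  let c := iter t step (init w) in
  halting c.1 /\ leading_bits (c.2 ord0).2 = v.
End Run.

Definition polytime_computable (f : word -> word) : Prop :=
  exists (M : TM) (p : {poly nat}),
    forall w, outputs_within M p.[size w]%R w (f w).

Definition polytime_decidable (A : pred word) : Prop :=
  polytime_computable (fun w => [:: A w]).

(* Self-delimiting pairing: each bit of [u] is preceded by 1, and the end of [u]
   is marked by 0. *)
Fixpoint pair_word (u v : word) : word :=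
  if u is b :: u' then [:: true, b & pair_word u' v] else false :: v.

Definition in_NP (L : word -> Prop) : Prop :=
  exists (q : {poly nat}) (V : pred word),
    polytime_decidable V /\
    forall x, L x <-> exists y : word, size y <= q.[size x]%R /\ V (pair_word x y).

(* A decision problem restricted to the instances satisfying [admissible]. *)
Record problem := Problem {
  instance : Type;
  encode : instance -> word;
  admissible : instance -> Prop;
  yes : instance -> Prop
}.

(* Hardness under polynomial-time many-one reductions; a reduction must produce
   admissible instances only. *)
Definition NP_hard (P : problem) : Prop :=
  forall L : word -> Prop, in_NP L ->
    exists f : word -> instance P,
      polytime_computable (fun x => encode (f x)) /\
      forall x, admissible (f x) /\ (L x <-> yes (f x)).

(** * Graphs and the fire fighting game *)

Record sgraph := SGraph {
  nb_nodes : nat;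
  adj : rel 'I_nb_nodes;
  adj_sym : symmetric adj;
  adj_irrefl : irreflexive adj
}.

Definition node (G : sgraph) : finType := 'I_(nb_nodes G).

Section Graph.
Variable G : sgraph.
Local Notation V := (node G).
Local Notation e := (@adj G).

Definition neighbours (W : {set V}) : {set V} :=
  [set v | (v \notin W) && [exists u in W, e u v]].

(* The list F is 0-indexed: F_t is [nth set0 F t.-1], empty for t > size F. *)
Fixpoint burning (F : seq {set V}) (t : nat) : {set V} :=
  if t is t'.+1 then
    let R := burning F t' :\: nth set0 F t' in R :|: neighbours R
  else [set: V].

Definition strategy (m T : nat) (F : seq {set V}) : Prop :=
  size F = T /\ all (fun A : {set V} => #|A| <= m) F.

Definition winning (F : seq {set V}) : Prop := burning F (size F) = set0.

Definition connected : Prop := 0 < #|V| /\ forall x y : V, connect e x y.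

(* Cycles are closed walks of length at least 3 without repeated nodes; [ucycle]
   also accepts the empty sequence and single edges. *)
Definition acyclic : Prop := forall c : seq V, ucycle e c -> size c < 3.

Definition tree : Prop := connected /\ acyclic.

Definition walk (k : nat) (x y : V) : bool :=
  [exists p : k.-tuple V, path e x p && (last x p == y)].

(* The least length of a walk from x to y; #|V| if there is none. *)
Definition dist (x y : V) : nat := find (fun k => walk k x y) (iota 0 #|V|).

Definition diameter : nat := \max_(x : V) \max_(y : V) dist x y.

Definition degree (x : V) : nat := #|[set y | e x y]|.

Definition spider : Prop := tree /\ #|[set x : V | 2 < degree x]| <= 1.
End Graph.

(** * The problem FireFightingInTime *)

Record ff_instance := FFInstance {
  ff_graph : sgraph;
  ff_m : nat;
  ff_T : nat;
  ff_m_gt0 : 0 < ff_m;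
  ff_T_gt0 : 0 < ff_T
}.

(* Binary digits, least significant first. *)
Definition binary (n : nat) : word :=
  mkseq (fun i => odd (n %/ 2 ^ i)) (trunc_log 2 n).+1.

(* Row by row; the number of nodes is the square root of the length. *)
Definition adjacency_matrix (G : sgraph) : word :=
  [seq adj x y | x <- enum (node G), y <- enum (node G)].

Definition ff_encode (I : ff_instance) : word :=
  pair_word (binary (ff_m I))
    (pair_word (binary (ff_T I)) (adjacency_matrix (ff_graph I))).

Definition ff_yes (I : ff_instance) : Prop :=
  exists F : seq {set node (ff_graph I)},
    strategy (ff_m I) (ff_T I) F /\ winning F.

Definition FireFightingInTime (C : sgraph -> Prop) : problem :=
  Problem ff_encode (fun I => C (ff_graph I)) ff_yes.

(* Main.v *)
Require Import Defs.
From mathcomp Require Import all_boot all_order all_algebra.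
From mathcomp Require Import zify.

(* Fix a verifier for a language in NP. On input [x], its computation is described by a
   tableau whose entries are the state and the tape cells, numbered relative to the head,
   so that every entry is determined by boundedly many entries of the previous row; the
   witness is a row segment that is left free. Whether the tableau can be filled in
   consistently is an exact cover problem: choosing a label for an entry [c] covers [c]
   and, for every use of an entry by another one, either the triples (use, expected
   value) or the triples (use, other value). Exact cover reduces to packing items of
   polynomial size into [T] bins so that each bin is exactly full (capacity [B]).

   A packing instance becomes a tree in which a root carries one leg (a path or a star)
   per item, of as many nodes as the size of the item, and [m = B + 1]. On a connected
   graph a strategy gains at most [m - 1] nodes per step, so that on [T * B + 1] nodes no
   step may waste anything: the protected region always has a single boundary node. As
   no leg is longer than [B], this node is the root, whence each step extinguishes a union
   of whole legs of total size [B].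

   The reduction is computed by a Turing machine because its output is given by
   expressions built from sums over bounded ranges, which compile to loops over unary
   counters. *)

Set Implicit Arguments.
Unset Strict Implicit.
Unset Printing Implicit Defensive.

(** * Machine fragments *)

(** The nodes of the tree are written out one by one, so item sizes count in unary, and packing has
    to be hard for polynomially large numbers. This excludes the usual encoding of a set by one
    digit per element, whose numbers are exponential: a size has a constant number of digits. A bin
    must nevertheless recognize which set or element its items belong to. For elements, the weights
    [n + e] lie between [n] and [2 * n], so a total below [2 * n] comes from a single item. For
    sets, whose bins hold many items, the zeroth, first and second moment of the set indices are
    prescribed, which makes their variance zero. A digit that should not matter in a bin is filled
    up with unit items. As every bin has to be exactly full, the supply of these must be right in
    advance, so the construction keeps the total load of either kind of bin independent of the
    cover; the item [Q_i], which stands in for the items [L_{i,e}] that leave [A_i], serves this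
    purpose. *)

Lemma nth_right_act (S : Type) (d : move) (a : option S) (t : tape S) (j : nat) :
  nth None (move_head d (write a t)).2 j =
  match d with
  | MoveL => if j is j'.+1 then if j' is 0 then a else nth None t.2 j'
             else nth None t.1 0
  | Stay => if j is 0 then a else nth None t.2 j
  | MoveR => nth None t.2 j.+1
  end.
Proof. by case: d; case: t => l [|b r]; case: j => [|[|j]]; case: l => [|c l] //=; rewrite ?nth_nil. Qed.

Lemma nth_left_act (S : Type) (d : move) (a : option S) (t : tape S) (j : nat) :
  nth None (move_head d (write a t)).1 j =
  match d with
  | MoveL => nth None t.1 j.+1
  | Stay => nth None t.1 j
  | MoveR => if j is j'.+1 then nth None t.1 j' else a
  end.
Proof. by case: d; case: t => [[|c l] r]; case: j => [|j] //=; rewrite ?nth_nil. Qed.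

Lemma readE (S : Type) (t : tape S) : read t = nth None t.2 0.
Proof. by rewrite /read nth0. Qed.

Section Fragments.
Variable K : nat.

Local Notation cell := (option (bool + void)).
Local Notation reads := {ffun 'I_K.+1 -> cell}.
Local Notation acts := {ffun 'I_K.+1 -> cell * move}.
Local Notation tapes := {ffun 'I_K.+1 -> tape (bool + void)}.

(* [None] as next state means that the fragment exits. *)
Record frag := Frag {
  fstate : finType;
  fstart : fstate;
  frag_trans : fstate -> reads -> option fstate * acts
}.

Definition scan (tau : tapes) : reads := [ffun i => read (tau i)].

Definition act_on (a : acts) (tau : tapes) : tapes :=
  [ffun i => move_head (a i).2 (write (a i).1 (tau i))].

Inductive reach (F : frag) : fstate F -> tapes -> nat -> tapes -> Prop :=
| reach_exit q tau a of frag_trans q (scan tau) = (None, a) :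
    reach q tau 1 (act_on a tau)
| reach_next q tau q' a k tau' of frag_trans q (scan tau) = (Some q', a)
    & reach q' (act_on a tau) k tau' : reach q tau k.+1 tau'.

Definition idle (r : reads) : acts := [ffun i => (r i, Stay)].

Definition fbasic (g : reads -> acts) : frag :=
  @Frag unit tt (fun _ r => (None, g r)).

Definition fseq (F1 F2 : frag) : frag :=
  @Frag (fstate F1 + fstate F2)%type (inl (fstart F1))
    (fun q r => match q with
     | inl q1 => let: (q', a) := frag_trans q1 r in
                 (Some (if q' is Some q1' then inl q1' else inr (fstart F2)), a)
     | inr q2 => let: (q', a) := frag_trans q2 r in (omap inr q', a)
     end).

Definition fite (b : reads -> bool) (F1 F2 : frag) : frag :=
  @Frag (option (fstate F1 + fstate F2)) None
    (fun q r => match q with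
     | None => (Some (Some (if b r then inl (fstart F1) else inr (fstart F2))), idle r)
     | Some (inl q1) => let: (q', a) := frag_trans q1 r in (omap (Some \o inl) q', a)
     | Some (inr q2) => let: (q', a) := frag_trans q2 r in (omap (Some \o inr) q', a)
     end).

Definition fwhile (b : reads -> bool) (F : frag) : frag :=
  @Frag (option (fstate F)) None
    (fun q r => match q with
     | None => (if b r then Some (Some (fstart F)) else None, idle r)
     | Some q1 => let: (q', a) := frag_trans q1 r in (Some q', a)
     end).

Lemma reach_seq_l F1 F2 q tau k tau1 k2 tau2 :
  @reach F1 q tau k tau1 -> @reach F2 (fstart F2) tau1 k2 tau2 ->
  @reach (fseq F1 F2) (inl q) tau (k + k2) tau2.
Proof.
move=> H H2; elim: H H2 => {q tau k tau1} [q tau a E|q tau q' a k tau' E _ IH] H2.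
  apply: (@reach_next (fseq F1 F2) _ _ (inr (fstart F2)) a); first by rewrite /= E.
  by elim: H2 => {q tau a E k2 tau2} [q tau a E|q tau q' a k tau' E _ IH];
    [apply: reach_exit; rewrite /= E | apply: reach_next IH; rewrite /= E].
by apply: (@reach_next (fseq F1 F2) _ _ (inl q') a _ _ _ (IH H2)); rewrite /= E.
Qed.

Lemma reach_ite b F1 F2 tau k tau' :
  (if b (scan tau) then @reach F1 (fstart F1) (act_on (idle (scan tau)) tau) k tau'
   else @reach F2 (fstart F2) (act_on (idle (scan tau)) tau) k tau') ->
  @reach (fite b F1 F2) None tau k.+1 tau'.
Proof.
case E: (b _) => H;
  [apply: (@reach_next (fite b F1 F2) _ _ (Some (inl (fstart F1))) (idle (scan tau)))
  |apply: (@reach_next (fite b F1 F2) _ _ (Some (inr (fstart F2))) (idle (scan tau)))];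
  rewrite /= ?E //.
  by elim: H => {E tau k tau'} [q tau a E|q tau q' a k tau' E _ IH];
    [apply: reach_exit; rewrite /= E | apply: reach_next IH; rewrite /= E].
by elim: H => {E tau k tau'} [q tau a E|q tau q' a k tau' E _ IH];
  [apply: reach_exit; rewrite /= E | apply: reach_next IH; rewrite /= E].
Qed.

Lemma reach_while_body b F q tau k tau1 k2 tau2 :
  @reach F q tau k tau1 -> @reach (fwhile b F) None tau1 k2 tau2 ->
  @reach (fwhile b F) (Some q) tau (k + k2) tau2.
Proof.
move=> H H2; elim: H H2 => {q tau k tau1} [q tau a E|q tau q' a k tau' E _ IH] H2.
  by apply: reach_next H2; rewrite /= E.
by apply: (reach_next _ (IH H2)); rewrite /= E.
Qed.

(** * Contents of a tape *)

Variable w : word.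

Definition input_cell (j : nat) : cell := nth None [seq Some (inl b) | b <- w] j.

Inductive content :=
| Counter of nat
| Output of word
| Input of nat        (* a copy of the input, the head at the given position *)
| Copied of nat.      (* a copy of a prefix of the input, the head at its end *)

(** Tapes are described by [nth], because lists that differ in trailing blanks represent the same
    tape. Only cells that matter later are constrained: those to the left of a counter are
    arbitrary, and the head stands one cell before the output, on the cell that receives its next
    symbol. *)
Definition holds (A : content) (t : tape (bool + void)) : Prop :=
  match A with
  | Counter n => forall j, nth None t.2 j = if j < n then Some (inl true) else None
  | Output o => forall j, nth None t.2 j.+1 = nth None [seq Some (inl b) | b <- o] j
  | Input p => (forall j, nth None t.2 j = input_cell (p + j)) /\
               (forall j, j < p -> nth None t.1 j = input_cell (p - j.+1))
  | Copied p => (forall j, nth None t.2 j = None) /\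
                (forall j, j < p -> nth None t.1 j = input_cell (p - j.+1))
  end.

(** Writing back the symbol read turns an empty right list into a list with one blank, so the pair
    of lists may change although the tape does not. *)
Lemma holds_idle A t : holds A t -> holds A (move_head Stay (write (read t) t)).
Proof.
have E j : nth None (move_head Stay (write (read t) t)).2 j = nth None t.2 j.
  by rewrite nth_right_act readE; case: j.
have E' j : nth None (move_head Stay (write (read t) t)).1 j = nth None t.1 j.
  by rewrite nth_left_act.
case: A => [n|o|p|p]; rewrite /holds.
- by move=> H j; rewrite E.
- by move=> H j; rewrite E.
- by case=> H1 H2; split=> j; [rewrite E|move=> Hj; rewrite E' H2].
- by case=> H1 H2; split=> j; [rewrite E|move=> Hj; rewrite E' H2].
Qed.

Definition all_hold (st : nat -> content) (tau : tapes) : Prop :=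
  forall i : 'I_K.+1, holds (st i) (tau i).

Definition exec (F : frag) (st : nat -> content) (k : nat) (st' : nat -> content) : Prop :=
  forall tau, all_hold st tau ->
    exists k' tau', [/\ k' <= k, @reach F (fstart F) tau k' tau' & all_hold st' tau'].

Definition upd (T : Type) (st : nat -> T) (i : nat) (A : T) : nat -> T :=
  fun j => if j == i then A else st j.

Lemma exec_weaken F st1 st2 k k' st1' st2' :
  exec F st1 k st1' -> st2 =1 st1 -> k <= k' ->
  (forall i, i <= K -> st1' i = st2' i) -> exec F st2 k' st2'.
Proof.
move=> H E Hk E' tau Ht.
have [|k1 [tau1 [H1 H2 H3]]] := H tau; first by move=> i; rewrite -E.
exists k1, tau1; split=> //; first exact: leq_trans Hk.
by move=> i; rewrite -E' // -ltnS.
Qed.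

Lemma exec_seq F1 F2 st1 k1 st2 k2 st3 :
  exec F1 st1 k1 st2 -> exec F2 st2 k2 st3 -> exec (fseq F1 F2) st1 (k1 + k2) st3.
Proof.
move=> H1 H2 tau /H1 [k1' [tau1 [L1 R1 /H2 [k2' [tau2 [L2 R2 T2]]]]]].
by exists (k1' + k2'), tau2; split=> //; [lia|exact: reach_seq_l R1 R2].
Qed.

Lemma all_hold_idle st tau : all_hold st tau -> all_hold st (act_on (idle (scan tau)) tau).
Proof. by move=> H i; rewrite !ffunE /=; apply: holds_idle. Qed.

Lemma exec_ite b (c : bool) F1 F2 st k st' :
  (forall tau, all_hold st tau -> b (scan tau) = c) ->
  (if c then exec F1 st k st' else exec F2 st k st') ->
  exec (fite b F1 F2) st k.+1 st'.
Proof.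
move=> Hb H tau Ht; have := Hb _ Ht; have Hi := all_hold_idle Ht.
case: c {Hb} H => /(_ _ Hi) [k' [tau' [L R T]]] E;
  by exists k'.+1, tau'; split=> //; apply: reach_ite; rewrite E.
Qed.

(** [st n] is the situation in which [n] rounds remain; every round costs one more step for the
    test, and so does the exit. *)
Lemma exec_while b F (st : nat -> nat -> content) N k :
  (forall n tau, n <= N -> all_hold (st n) tau -> b (scan tau) = (0 < n)) ->
  (forall n, n < N -> exec F (st n.+1) k (st n)) ->
  exec (fwhile b F) (st N) (N * k.+1 + 1) (st 0).
Proof.
elim: N => [|N IH] Hb HF tau Ht.
  exists 1, (act_on (idle (scan tau)) tau); split=> //; last exact: all_hold_idle.
  by apply: reach_exit; rewrite /= (Hb 0).
have Hi := all_hold_idle Ht.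
have [k1 [tau1 [L1 R1 T1]]] := HF N (leqnn _) _ Hi.
have [|n Hn|k2 [tau2 [L2 R2 T2]]] := IH _ _ _ T1.
- by move=> n tau' Hn; apply: Hb; lia.
- by apply: HF; lia.
exists (k1 + k2).+1, tau2; split=> //; first by rewrite mulSn; lia.
apply: (@reach_next (fwhile b F) _ _ (Some (fstart F)) (idle (scan tau))).
  by rewrite /= (Hb N.+1).
exact: reach_while_body R1 R2.
Qed.

Lemma exec_basic g st st' :
  (forall tau, all_hold st tau -> all_hold st' (act_on (g (scan tau)) tau)) ->
  exec (fbasic g) st 1 st'.
Proof.
move=> H tau /H H'; exists 1, (act_on (g (scan tau)) tau); split=> //.
exact: reach_exit.
Qed.

Definition act1 (i : nat) (g : cell -> cell * move) (r : reads) : acts :=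
  [ffun k : 'I_K.+1 => if k == i :> nat then g (r k) else (r k, Stay)].

Lemma exec_act1 i g st A :
  (forall t, holds (st i) t -> holds A (move_head (g (read t)).2 (write (g (read t)).1 t))) ->
  exec (fbasic (act1 i g)) st 1 (upd st i A).
Proof.
move=> H; apply: exec_basic => tau Ht j; rewrite !ffunE /upd.
by case: eqP => [E|_]; [apply: H; rewrite -E | apply: holds_idle].
Qed.

Definition fskip : frag := fbasic idle.

Lemma exec_skip st : exec fskip st 1 st.
Proof. by apply: exec_basic => tau; apply: all_hold_idle. Qed.

Definition finc (i : nat) : frag :=
  fseq (fbasic (act1 i (fun c => (c, MoveL))))
       (fbasic (act1 i (fun c => (Some (inl true), Stay)))).
Definition fdec (i : nat) : frag := fbasic (act1 i (fun c => (None, MoveR))).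
Definition fright (i : nat) : frag := fbasic (act1 i (fun c => (c, MoveR))).
Definition fleft (i : nat) : frag := fbasic (act1 i (fun c => (c, MoveL))).
Definition fout (b : bool) : frag := fbasic (act1 0 (fun c => (Some (inl b), MoveL))).

Lemma exec_inc st i n : st i = Counter n -> exec (finc i) st 2 (upd st i (Counter n.+1)).
Proof.
move=> E tau Ht.
(* Between the two actions the scanned cell is arbitrary and the tape is not a counter, so both are
   followed on the tapes themselves. *)
pose tau1 := act_on (act1 i (fun c => (c, MoveL)) (scan tau)) tau.
pose tau2 := act_on (act1 i (fun c => (Some (inl true), Stay)) (scan tau1)) tau1.
exists 2, tau2; split=> //.
  have R1 : @reach (fbasic (act1 i (fun c => (c, MoveL)))) tt tau 1 tau1 by exact: reach_exit.
  by apply: (reach_seq_l R1); exact: reach_exit.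
move=> j; rewrite /tau2 /tau1 /act_on /act1 /scan !ffunE /upd; case: eqP => [Ej|_]; last first.
  exact: holds_idle (holds_idle (Ht j)).
have := Ht j; rewrite Ej E /holds => H k.
rewrite (nth_right_act Stay); case: k => [//|k].
by rewrite (nth_right_act MoveL); case: k => [|k]; rewrite /= ?readE H.
Qed.

Lemma exec_dec st i n : st i = Counter n -> exec (fdec i) st 1 (upd st i (Counter n.-1)).
Proof.
move=> E; apply: exec_act1 => t; rewrite E /holds => H j.
rewrite nth_right_act /= H; have -> : (j.+1 < n) = (j < n.-1) by lia.
by [].
Qed.

Lemma exec_right st i p : st i = Input p -> exec (fright i) st 1 (upd st i (Input p.+1)).
Proof.
move=> E; apply: exec_act1 => t; rewrite E /holds => -[H1 H2]; split=> j.
  by rewrite nth_right_act /= H1 addSnnS.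
rewrite nth_left_act /= readE; case: j => [|j] Hj; first by rewrite H1 addn0 subn1.
by rewrite H2 // subSS.
Qed.

Lemma exec_left st i p : st i = Input p.+1 -> exec (fleft i) st 1 (upd st i (Input p)).
Proof.
move=> E; apply: exec_act1 => t; rewrite E /holds => -[H1 H2]; split=> j.
  rewrite nth_right_act /= readE; case: j => [|[|j]].
  - by rewrite H2 // subn1 addn0.
  - by rewrite H1; congr input_cell; lia.
  - by rewrite H1; congr input_cell; lia.
by move=> Hj; rewrite nth_left_act /= H2 //; congr input_cell; lia.
Qed.

Lemma exec_out st b o : st 0 = Output o -> exec (fout b) st 1 (upd st 0 (Output (b :: o))).
Proof.
move=> E; apply: exec_act1 => t; rewrite E /holds => H j.
by rewrite nth_right_act /=; case: j.
Qed.

Definition nonblank (i : nat) (r : reads) : bool := r (inord i) != None.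
Definition is_true_bit (i : nat) (r : reads) : bool := r (inord i) == Some (inl true).

Lemma nonblank_counter i n st tau : i <= K -> st i = Counter n -> all_hold st tau ->
  nonblank i (scan tau) = (0 < n).
Proof.
move=> Hi E /(_ (inord i)); rewrite inordK // E /= => H.
by rewrite /nonblank ffunE readE H; case: n {E H}.
Qed.

Lemma nonblank_input i p st tau : i <= K -> st i = Input p -> all_hold st tau ->
  nonblank i (scan tau) = (p < size w).
Proof.
move=> Hi E /(_ (inord i)); rewrite inordK // E /= => -[H _].
rewrite /nonblank ffunE readE H addn0 /input_cell; case: ltnP => Hp.
  by rewrite (nth_map false).
by rewrite nth_default ?size_map.
Qed.

Lemma is_true_bit_input i p st tau : i <= K -> st i = Input p -> all_hold st tau ->
  is_true_bit i (scan tau) = nth false w p.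
Proof.
move=> Hi E /(_ (inord i)); rewrite inordK // E /= => -[H _].
rewrite /is_true_bit ffunE readE H addn0 /input_cell; case: (ltnP p (size w)) => Hp.
  by rewrite (nth_map false) //; case: (nth _ _ _).
by rewrite !nth_default ?size_map.
Qed.

(** * Register programs *)

Definition regs (p : nat) (o : word) (s : nat -> nat) : nat -> content :=
  fun i => match i with 0 => Output o | 1 => Input p | _ => Counter (s i) end.

Definition runs F p o s k p' o' s' := exec F (regs p o s) k (regs p' o' s').

Lemma runs_weaken F p o s1 k p' o' s1' k' s2' :
  runs F p o s1 k p' o' s1' -> k <= k' -> s1' =1 s2' -> runs F p o s1 k' p' o' s2'.
Proof. by move=> H Hk E; apply: exec_weaken H _ Hk _ => // -[|[|i]] _ //=; rewrite E. Qed.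

Lemma runs_seq F1 F2 p o s k1 p1 o1 s1 k2 p2 o2 s2 :
  runs F1 p o s k1 p1 o1 s1 -> runs F2 p1 o1 s1 k2 p2 o2 s2 ->
  runs (fseq F1 F2) p o s (k1 + k2) p2 o2 s2.
Proof. exact: exec_seq. Qed.

Lemma regsE i p o s : 1 < i -> regs p o s i = Counter (s i).
Proof. by case: i => [|[|i]]. Qed.

Lemma upd_regs i p o s v : 1 < i -> upd (regs p o s) i (Counter v) =1 regs p o (upd s i v).
Proof. by case: i => [|[|i]] // _ [|[|j]] //=; rewrite /upd /=; case: (j.+2 == i.+2). Qed.

Lemma runs_inc i p o s : 1 < i -> runs (finc i) p o s 2 p o (upd s i (s i).+1).
Proof.
move=> Hi; apply: (exec_weaken (exec_inc (regsE p o s Hi))) => // j _.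
exact: upd_regs.
Qed.

Lemma runs_dec i p o s : 1 < i -> runs (fdec i) p o s 1 p o (upd s i (s i).-1).
Proof.
move=> Hi; apply: (exec_weaken (exec_dec (regsE p o s Hi))) => // j _.
exact: upd_regs.
Qed.

Lemma runs_right p o s : runs (fright 1) p o s 1 p.+1 o s.
Proof. by apply: (exec_weaken (@exec_right _ 1 p erefl)) => // -[|[|j]]. Qed.

Lemma runs_left p o s : runs (fleft 1) p.+1 o s 1 p o s.
Proof. by apply: (exec_weaken (@exec_left _ 1 p erefl)) => // -[|[|j]]. Qed.

Lemma runs_out b p o s : runs (fout b) p o s 1 p (b :: o) s.
Proof. by apply: (exec_weaken (@exec_out _ b o erefl)) => // -[|[|j]]. Qed.

Lemma runs_skip p o s : runs fskip p o s 1 p o s.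
Proof. exact: exec_skip. Qed.

Definition floop (i : nat) (F : frag) := fwhile (nonblank i) F.

Lemma runs_loop i F (p : nat -> nat) (o : nat -> word) (s : nat -> nat -> nat) N k :
  1 < i <= K -> (forall n, n <= N -> s n i = n) ->
  (forall n, n < N -> runs F (p n.+1) (o n.+1) (s n.+1) k (p n) (o n) (s n)) ->
  runs (floop i F) (p N) (o N) (s N) (N * k.+1 + 1) (p 0) (o 0) (s 0).
Proof.
case/andP=> Hi HiK Hs HF.
apply: (@exec_while _ _ (fun n => regs (p n) (o n) (s n))) => // n tau Hn.
by apply: nonblank_counter => //; rewrite regsE // Hs.
Qed.

Lemma runs_if_counter i F1 F2 p o s k p' o' s' : 1 < i <= K ->
  (if 0 < s i then runs F1 p o s k p' o' s' else runs F2 p o s k p' o' s') ->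
  runs (fite (nonblank i) F1 F2) p o s k.+1 p' o' s'.
Proof.
case/andP=> Hi HiK; apply: exec_ite => tau.
by apply: nonblank_counter => //; rewrite regsE.
Qed.

Lemma runs_if_input F1 F2 p o s k p' o' s' : 0 < K ->
  (if nth false w p then runs F1 p o s k p' o' s' else runs F2 p o s k p' o' s') ->
  runs (fite (is_true_bit 1) F1 F2) p o s k.+1 p' o' s'.
Proof. by move=> HK; apply: exec_ite => tau; apply: is_true_bit_input. Qed.

End Fragments.

(** * Polynomial bounds *)

(** With a base of at least 2, constants, sums and compositions are absorbed into the exponent,
    without a leading coefficient. *)
Definition pbound (g : nat -> nat) : Prop := exists c, forall B, g B <= (B + 2) ^ c.

Lemma pbound_const n : pbound (fun _ => n).
Proof.
exists n => B; apply: leq_trans (ltnW (ltn_expl n (isT : 1 < 2))) _.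
by case: n => // n; rewrite leq_exp2r // addn2.
Qed.

Lemma pbound_id : pbound id.
Proof. by exists 1 => B; rewrite expn1; lia. Qed.

Lemma pbound_add g h : pbound g -> pbound h -> pbound (fun B => g B + h B).
Proof.
move=> [c Hc] [d Hd]; exists (c + d).+1 => B; rewrite expnS expnD.
have := Hc B; have := Hd B.
have : 0 < (B + 2) ^ c by rewrite expn_gt0; lia.
have : 0 < (B + 2) ^ d by rewrite expn_gt0; lia.
move: (_ ^ c) (_ ^ d) => x y; nia.
Qed.

Lemma pbound_succ g : pbound g -> pbound (fun B => (g B).+1).
Proof. by move=> H; have [c Hc] := pbound_add H (pbound_const 1); exists c => B; rewrite -addn1. Qed.

Lemma pbound_mul g h : pbound g -> pbound h -> pbound (fun B => g B * h B).
Proof.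
by move=> [c Hc] [d Hd]; exists (c + d) => B; rewrite expnD leq_mul.
Qed.

Lemma pbound_comp g h : pbound g -> pbound h -> pbound (fun B => g (h B)).
Proof.
move=> [c Hc] [d Hd]; exists (d.+2 * c) => B; apply: leq_trans (Hc _) _.
rewrite expnM; case: c {Hc} => // c; rewrite leq_exp2r // !expnS.
have := Hd B; have : 0 < (B + 2) ^ d by rewrite expn_gt0; lia.
move: (_ ^ d) => x; nia.
Qed.

(** * A language of polynomially bounded expressions *)

(** Products, quotients and comparisons are left out, since bounded sums and truncated subtraction
    define them; only these few constructs have to be compiled. The sole iteration is a sum over a
    range computed beforehand, so values stay polynomial. *)
Inductive expr :=
| EVar of nat
| EOne
| EAdd of expr & expr
| ESub of expr & expr
| ESum of expr & expr
| ELet of expr & expr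
| EBit of expr.

(* Variables are de Bruijn indices into the environment [s]; [ESum] and [ELet] bind. *)
Fixpoint eval (w : word) (s : seq nat) (e : expr) : nat :=
  match e with
  | EVar i => nth 0 s i
  | EOne => 1
  | EAdd a b => eval w s a + eval w s b
  | ESub a b => eval w s a - eval w s b
  | ESum a b => \sum_(i < eval w s a) eval w (val i :: s) b
  | ELet a b => eval w (eval w s a :: s) b
  | EBit a => nth false w (eval w s a)
  end.

Lemma eval_bound e :
  exists2 g, pbound g & forall w s B, all (fun x => x <= B) s -> eval w s e <= g B.
Proof.
elim: e => [i||a [ga Ga Ha] b [gb Gb Hb]|a [ga Ga Ha] b _|a [ga Ga Ha] b [gb Gb Hb]
  |a [ga Ga Ha] b [gb Gb Hb]|a _] /=.
- exists id => [|w s B]; first exact: pbound_id.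
  move/allP=> H; case: (ltnP i (size s)) => Hi; first exact: H (mem_nth _ _).
  by rewrite nth_default.
- by exists (fun=> 1) => //; exact: pbound_const.
- exists (fun B => ga B + gb B) => [|w s B H]; first exact: pbound_add.
  by rewrite leq_add ?Ha ?Hb.
- by exists ga => // w s B H; apply: leq_trans (leq_subr _ _) (Ha _ _ _ H).
(* [B + ga B] bounds the environment extended by the summation index. *)
- exists (fun B => ga B * gb (B + ga B)) => [|w s B H].
    exact: pbound_mul Ga (pbound_comp Gb (pbound_add pbound_id Ga)).
  apply: (@leq_trans (\sum_(i < eval w s a) gb (B + ga B))).
    apply: leq_sum => i _; apply: Hb => /=; apply/andP; split.
      by have := ltn_ord i; have := Ha w s B H; lia.
    by apply/allP => x /(allP H); lia.
  by rewrite sum_nat_const card_ord leq_mul2r Ha ?orbT.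
- exists (fun B => gb (B + ga B)) => [|w s B H].
    exact: pbound_comp Gb (pbound_add pbound_id Ga).
  apply: Hb => /=; apply/andP; split; first by have := Ha w s B H; lia.
  by apply/allP => x /(allP H); lia.
- by exists (fun=> 1) => [|w s B _]; [exact: pbound_const|case: nth].
Qed.

Ltac upd_tac := move=> ?; rewrite /upd; repeat (case: eqP => ?); subst => //=; try lia.

Ltac step_tac := repeat first
  [ eapply runs_dec; lia | eapply runs_inc; lia
  | eapply runs_right | eapply runs_left | eapply runs_seq ].

Ltac pbound_tac := repeat first [ assumption | exact: pbound_id |
  lazymatch goal with
  | |- pbound (fun _ => ?n) => exact: (pbound_const n)
  | |- pbound (fun B => B) => exact: pbound_id
  | |- pbound (fun B => S (@?f B)) => apply: (@pbound_succ f)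
  | |- pbound (fun B => @?f B + @?g B) => apply: (@pbound_add f g)
  | |- pbound (fun B => @?f B * @?g B) => apply: (@pbound_mul f g)
  | |- pbound (fun B => ?g (@?h B)) => apply: (@pbound_comp g h)
  end ].

Section Code.
Variable K : nat.

(* Adds the value of the expression to register [t]; [r] lists the registers of the
   variables, and the registers from [f] on are free. *)
Fixpoint code (e : expr) (r : seq nat) (t f : nat) : frag K :=
  match e with
  | EVar i =>
      if i < size r then let x := nth 0 r i in
        fseq (floop x (fseq (fdec K x) (finc K f)))
             (floop f (fseq (fdec K f) (fseq (finc K x) (finc K t))))
      else fskip K
  | EOne => finc K t
  | EAdd a b => fseq (code a r t f) (code b r t f)
  | ESub a b =>
      fseq (code a r f f.+1) (fseq (code b r f.+1 f.+2)
        (fseq (floop f.+1 (fseq (fdec K f.+1) (fdec K f)))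
              (floop f (fseq (fdec K f) (finc K t)))))
  | ESum a b =>
      fseq (code a r f f.+1)
           (floop f (fseq (fdec K f) (code b (f :: r) t f.+1)))
  | ELet a b =>
      fseq (code a r f f.+1) (fseq (code b (f :: r) t f.+1) (floop f (fdec K f)))
  | EBit a =>
      fseq (code a r f f.+1)
        (fseq (floop f (fseq (fdec K f) (fseq (fright K 1) (finc K f.+1))))
          (fseq (fite (is_true_bit 1) (finc K t) (fskip K))
                (floop f.+1 (fseq (fdec K f.+1) (fleft K 1)))))
  end.

Fixpoint tapes_used (e : expr) (f : nat) : nat :=
  match e with
  | EVar _ => f.+1
  | EOne => f
  | EAdd a b => maxn (tapes_used a f) (tapes_used b f)
  | ESub a b => maxn (tapes_used a f.+1) (tapes_used b f.+2)
  | ESum a b | ELet a b => maxn (tapes_used a f.+1) (tapes_used b f.+1)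
  | EBit a => maxn f.+2 (tapes_used a f.+1)
  end.

Lemma leq_tapes_used e f : f <= tapes_used e f.
Proof.
elim: e f => //= [a Ha b Hb|a Ha b Hb|a Ha b Hb|a Ha b Hb|a Ha] f.
- by have := Ha f; lia.
- by have := Ha f.+1; lia.
- by have := Ha f.+1; lia.
- by have := Ha f.+1; lia.
- by lia.
Qed.

(** The target is no variable, since [code] adds to it while variables are still to be read.
    Registers from [f] on are zero, so that adding a value to one of them stores it. *)
Definition layout (r : seq nat) (t f : nat) (s : nat -> nat) : Prop :=
  [/\ 1 < t < f, all (fun x => 1 < x < f) r, t \notin r & forall x, f <= x -> s x = 0].

(** A counter is read by emptying it: its value first moves to [f], and from there back to [x] and
    into [t] at the same time. *)
Lemma runs_copy w x t f o s : 1 < x < f -> 1 < t < f -> x != t -> f <= K -> s f = 0 ->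
  runs w (fseq (floop x (fseq (fdec K x) (finc K f)))
             (floop f (fseq (fdec K f) (fseq (finc K x) (finc K t)))))
    0 o s (s x * 4 + 1 + (s x * 6 + 1)) 0 o (upd s t (s t + s x)).
Proof.
move=> Hx Ht Hxt Hf E0.
apply: (@runs_seq _ _ _ _ _ _ _ _ 0 o (upd (upd s x 0) f (s x))).
  pose st n := upd (upd s x n) f (s x - n).
  have := @runs_loop K w x (fseq (fdec K x) (finc K f)) (fun=> 0) (fun=> o) st (s x) 3.
  move=> H; apply: exec_weaken (H _ _ _) _ _ _ => //.
  - by lia.
  - by move=> n Hn; rewrite /st /upd; case: eqP; [lia|rewrite eqxx].
  - move=> n Hn; eapply runs_weaken; first by step_tac.
      by [].
    rewrite /st; upd_tac.
  - case=> [|[|i]] //=; congr Counter; rewrite /st subnn; move: (i.+2); upd_tac.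
  - case=> [|[|i]] //= _; congr Counter; rewrite /st subn0 //.
pose st n := upd (upd (upd s x (s x - n)) f n) t (s t + (s x - n)).
have := @runs_loop K w f (fseq (fdec K f) (fseq (finc K x) (finc K t))) (fun=> 0) (fun=> o) st (s x) 5.
move=> H; apply: exec_weaken (H _ _ _) _ _ _ => //.
- by lia.
- by move=> n Hn; rewrite /st /upd; case: eqP; [lia|rewrite eqxx].
- move=> n Hn; eapply runs_weaken; first by step_tac.
    by [].
  rewrite /st; upd_tac.
- case=> [|[|i]] //=; congr Counter; rewrite /st subnn; move: (i.+2); upd_tac.
- case=> [|[|i]] //= _; congr Counter; rewrite /st subn0; move: (i.+2); upd_tac.
Qed.

Lemma runs_countdown w i F (p : nat -> nat) (o : nat -> word) (s : nat -> nat -> nat) N k s0 sN :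
  1 < i <= K -> (forall n, n <= N -> s n i = n) ->
  (forall n, n < N -> runs w F (p n.+1) (o n.+1) (s n.+1) k (p n) (o n) (s n)) ->
  s N =1 sN -> s 0 =1 s0 ->
  @runs K w (floop i F) (p N) (o N) sN (N * k.+1 + 1) (p 0) (o 0) s0.
Proof.
move=> Hi Hs HF EN E0; apply: exec_weaken (runs_loop Hi Hs HF) _ _ _ => //.
  by case=> [|[|j]] //=; rewrite EN.
by case=> [|[|j]] //= _; rewrite E0.
Qed.

Lemma map_upd (s : nat -> nat) x v r : x \notin r -> map (upd s x v) r = map s r.
Proof.
move=> Hx; apply/eq_in_map => y Hy; rewrite /upd.
by case: eqP => // E; rewrite -E Hy in Hx.
Qed.

Lemma layout_target r t f s v : layout r t f s -> layout r t f (upd s t v).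
Proof. by case=> H1 H2 H3 H4; split=> // x Hx; rewrite /upd; case: eqP => [|_]; [lia|exact: H4]. Qed.

Lemma layout_free r t f s : layout r t f s -> layout r f f.+1 s.
Proof.
case=> H1 H2 H3 H4; split; first by lia.
- by apply/allP => x /(allP H2); lia.
- by apply/negP => /(allP H2); lia.
- by move=> x Hx; apply: H4; lia.
Qed.

Lemma layout_free2 r t f s v : layout r t f s -> layout r f.+1 f.+2 (upd s f v).
Proof.
case=> H1 H2 H3 H4; split; first by lia.
- by apply/allP => x /(allP H2); lia.
- by apply/negP => /(allP H2); lia.
- by move=> x Hx; rewrite /upd; case: eqP => [|_]; [lia|apply: H4; lia].
Qed.

Lemma layout_bind r t f s v : layout r t f s -> layout (f :: r) t f.+1 (upd s f v).
Proof.
case=> H1 H2 H3 H4; split; first by lia.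
- by rewrite /=; apply/andP; split; [lia|apply/allP => x /(allP H2); lia].
- by rewrite in_cons negb_or H3 andbT; lia.
- by move=> x Hx; rewrite /upd; case: eqP => [|_]; [lia|apply: H4; lia].
Qed.

Lemma layout_notin r t f s : layout r t f s -> f \notin r.
Proof. by case=> _ H _ _; apply/negP => /(allP H); lia. Qed.

Lemma code_runs e : exists2 g, pbound g & forall w r t f o s B,
  layout r t f s -> tapes_used e f <= K.+1 -> all (fun x => x <= B) (map s r) ->
  runs w (code e r t f) 0 o s (g B) 0 o (upd s t (s t + eval w (map s r) e)).
Proof.
elim: e => [i||a [ga Ga Ha] b [gb Gb Hb]|a [ga Ga Ha] b [gb Gb Hb]|a [ga Ga Ha] b [gb Gb Hb]
  |a [ga Ga Ha] b [gb Gb Hb]|a [ga Ga Ha]] /=.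
- exists (fun B => B * 10 + 2) => [|w r t f o s B [H1 H2 H3 H4] Hf HB]; first by pbound_tac.
  case: ltnP => Hi; last first.
    rewrite nth_default ?size_map //.
    by apply: runs_weaken (@runs_skip K w 0 o s) _ _; [lia|upd_tac].
  rewrite (nth_map 0) //; set x := nth 0 r i.
  have Hx : x \in r by exact: mem_nth.
  have HxB : s x <= B by move/allP: HB; apply; exact: map_f.
  apply: runs_weaken (@runs_copy w x t f o s _ _ _ _ _) _ _ => //; try lia.
  + exact: allP H2 _ Hx.
  + by apply: contraNneq H3 => <-.
  + exact: H4.
- exists (fun=> 2) => [|w r t f o s B [H1 H2 H3 H4] Hf HB]; first by pbound_tac.
  by apply: runs_weaken (@runs_inc K w t 0 o s _) _ _; [lia|lia|rewrite addn1].
- exists (fun B => ga B + gb B) => [|w r t f o s B HL Hf HB]; first by pbound_tac.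
  have [H1 H2 H3 H4] := HL.
  apply: (@runs_seq _ _ _ _ _ _ _ _ 0 o (upd s t (s t + eval w (map s r) a))).
    by apply: Ha => //; lia.
  apply: runs_weaken (Hb w r t f o _ B (layout_target _ HL) _ _) _ _; rewrite ?map_upd //; try lia.
  upd_tac.
- have [va Va Ea] := eval_bound a; have [vb Vb Eb] := eval_bound b.
  exists (fun B => ga B + (gb B + (vb B * 3 + 1 + (va B * 4 + 1)))) => [|w r t f o s B HL Hf HB];
    first by pbound_tac.
  have [H1 H2 H3 H4] := HL; have LaK := leq_tapes_used a f.+1; have LbK := leq_tapes_used b f.+2.
  set A := eval w _ a; set A' := eval w _ b; have HA : A <= va B by exact: Ea.
  have HA' : A' <= vb B by exact: Eb.
  have s0 : s f = 0 by exact: H4.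
  have s1 : s f.+1 = 0 by apply: H4; lia.
  apply: (@runs_seq _ _ _ _ _ _ _ _ 0 o (upd s f A)).
    by apply: runs_weaken (Ha w r f f.+1 o s B (layout_free HL) _ _) _ _ => //; [lia|rewrite s0].
  apply: (@runs_seq _ _ _ _ _ _ _ _ 0 o (upd (upd s f A) f.+1 A')).
    apply: runs_weaken (Hb w r f.+1 f.+2 o _ B (layout_free2 A HL) _ _) _ _ => //;
      rewrite ?map_upd ?(layout_notin HL) //; try lia.
    upd_tac.
  apply: (@runs_seq _ _ _ _ _ _ _ _ 0 o (upd s f (A - A'))).
    apply: runs_weaken (@runs_countdown w f.+1 _ (fun=> 0) (fun=> o)
      (fun n => upd (upd s f.+1 n) f (A - (A' - n))) A' 2 (upd s f (A - A')) _ _ _ _ _ _) _ _ => //.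
    + by lia.
    + by move=> n Hn; rewrite /upd; case: eqP; [lia|rewrite eqxx].
    + move=> n Hn; eapply runs_weaken; first by step_tac.
        by [].
      upd_tac.
    + rewrite subnn subn0; upd_tac.
    + rewrite subn0; upd_tac.
    + by rewrite leq_add2r leq_mul2r HA'.
  apply: runs_weaken (@runs_countdown w f _ (fun=> 0) (fun=> o)
      (fun n => upd (upd s f n) t (s t + (A - A' - n))) (A - A') 3 (upd s t (s t + (A - A'))) _ _ _ _ _ _) _ _ => //.
  + by lia.
  + by move=> n Hn; rewrite /upd; case: eqP; [lia|rewrite eqxx].
  + move=> n Hn; eapply runs_weaken; first by step_tac.
      by [].
    upd_tac.
  + rewrite subnn addn0; upd_tac.
  + rewrite subn0; upd_tac.
  + by rewrite leq_add2r leq_mul2r; lia.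
- have [va Va Ea] := eval_bound a.
  exists (fun B => ga B + (va B * (1 + gb (B + va B)).+1 + 1)) => [|w r t f o s B HL Hf HB];
    first by pbound_tac.
  have [H1 H2 H3 H4] := HL; have LaK := leq_tapes_used a f.+1.
  set A := eval w _ a; have HA : A <= va B by exact: Ea.
  have s0 : s f = 0 by exact: H4.
  apply: (@runs_seq _ _ _ _ _ _ _ _ 0 o (upd s f A)).
    by apply: runs_weaken (Ha w r f f.+1 o s B (layout_free HL) _ _) _ _ => //; [lia|rewrite s0].
  (* The countdown register doubles as the summation index: when [n] rounds remain, the terms from
     [n] to [A - 1] have been added. *)
  pose st n := upd (upd s f n) t (s t + \sum_(n <= i < A) eval w (i :: map s r) b).
  apply: runs_weaken (@runs_countdown w f _ (fun=> 0) (fun=> o) st A (1 + gb (B + va B))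
    (upd s t (s t + \sum_(i < A) eval w (val i :: map s r) b)) _ _ _ _ _ _) _ _ => //.
  + by lia.
  + by move=> n Hn; rewrite /st /upd; case: eqP; [lia|rewrite eqxx].
  + move=> n Hn; apply: (@runs_seq _ _ _ _ _ _ _ _ 0 o
      (upd (upd s t (s t + \sum_(n.+1 <= i < A) eval w (i :: map s r) b)) f n)).
      eapply runs_weaken; first by step_tac.
        by [].
      rewrite /st; upd_tac.
    have HL' := layout_bind n (layout_target (s t + \sum_(n.+1 <= i < A) eval w (i :: map s r) b) HL).
    have Er v : map (upd (upd s t v) f n) (f :: r) = n :: map s r.
      by rewrite /= !map_upd ?(layout_notin HL) // /upd eqxx.
    apply: runs_weaken (Hb w (f :: r) t f.+1 o _ (B + va B) HL' _ _) _ _ => //; rewrite ?Er; try lia.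
      by rewrite /=; apply/andP; split; [lia|apply/allP => x /(allP HB); lia].
    by rewrite /st (big_ltn Hn); upd_tac.
  + rewrite /st big_geq // addn0; upd_tac.
  + rewrite /st big_mkord; upd_tac.
  + by rewrite leq_add2r leq_mul2r HA orbT.
- have [va Va Ea] := eval_bound a.
  exists (fun B => ga B + (gb (B + va B) + (va B * 2 + 1))) => [|w r t f o s B HL Hf HB];
    first by pbound_tac.
  have [H1 H2 H3 H4] := HL; have LaK := leq_tapes_used a f.+1.
  set A := eval w _ a; have HA : A <= va B by exact: Ea.
  have s0 : s f = 0 by exact: H4.
  apply: (@runs_seq _ _ _ _ _ _ _ _ 0 o (upd s f A)).
    by apply: runs_weaken (Ha w r f f.+1 o s B (layout_free HL) _ _) _ _ => //; [lia|rewrite s0].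
  set A' := eval w (A :: _) b.
  apply: (@runs_seq _ _ _ _ _ _ _ _ 0 o (upd (upd s f A) t (s t + A'))).
    have Er : map (upd s f A) (f :: r) = A :: map s r.
      by rewrite /= !map_upd ?(layout_notin HL) // /upd eqxx.
    apply: runs_weaken (Hb w (f :: r) t f.+1 o _ (B + va B) (layout_bind A HL) _ _) _ _ => //;
      rewrite ?Er -/A'; try lia.
      by rewrite /=; apply/andP; split; [lia|apply/allP => x /(allP HB); lia].
    upd_tac.
  apply: runs_weaken (@runs_countdown w f _ (fun=> 0) (fun=> o)
      (fun n => upd (upd s f n) t (s t + A')) A 1 (upd s t (s t + A')) _ _ _ _ _ _) _ _ => //.
  + by lia.
  + by move=> n Hn; rewrite /upd; case: eqP; [lia|rewrite eqxx].
  + move=> n Hn; eapply runs_weaken; first by step_tac.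
      by [].
    upd_tac.
  + upd_tac.
  + by rewrite leq_add2r leq_mul2r HA.
- have [va Va Ea] := eval_bound a.
  exists (fun B => ga B + (va B * 5 + 1 + (3 + (va B * 3 + 1)))) => [|w r t f o s B HL Hf HB];
    first by pbound_tac.
  have [H1 H2 H3 H4] := HL; have LaK := leq_tapes_used a f.+1.
  set A := eval w _ a; have HA : A <= va B by exact: Ea.
  have s0 : s f = 0 by exact: H4.
  have s1 : s f.+1 = 0 by apply: H4; lia.
  apply: (@runs_seq _ _ _ _ _ _ _ _ 0 o (upd s f A)).
    by apply: runs_weaken (Ha w r f f.+1 o s B (layout_free HL) _ _) _ _ => //; [lia|rewrite s0].
  apply: (@runs_seq _ _ _ _ _ _ _ _ A o (upd s f.+1 A)).
    (* Register [f.+1] counts the moves of the input head to the right, so that the last loop can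
       bring it back. *)
    pose st n := upd (upd s f n) f.+1 (A - n).
    have := @runs_countdown w f (fseq (fdec K f) (fseq (fright K 1) (finc K f.+1)))
      (fun n => A - n) (fun=> o) st A 4 (upd s f.+1 A) (upd s f A).
    rewrite subnn subn0 => H5; apply: runs_weaken (H5 _ _ _ _ _) _ _ => // {H5}.
    + by lia.
    + by move=> n Hn; rewrite /st /upd; case: eqP; [lia|rewrite eqxx].
    + move=> n Hn; have -> : A - n = (A - n.+1).+1 by lia.
      eapply runs_weaken; first by step_tac.
        by [].
      rewrite /st; upd_tac.
    + rewrite /st subnn; upd_tac.
    + rewrite /st subn0; upd_tac.
    + by rewrite leq_add2r leq_mul2r HA.
  apply: (@runs_seq _ _ _ _ _ _ _ _ A o (upd (upd s t (s t + nth false w A)) f.+1 A)).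
    apply: runs_if_input; first by lia.
    case: (nth false w A).
      by apply: runs_weaken (@runs_inc K w t A o _ _) _ _; [lia|lia|upd_tac].
    by apply: runs_weaken (@runs_skip K w A o _) _ _; [lia|upd_tac].
  apply: runs_weaken (@runs_countdown w f.+1 _ id (fun=> o)
      (fun n => upd (upd s t (s t + nth false w A)) f.+1 n) A 2 (upd s t (s t + nth false w A)) _ _ _ _ _ _) _ _ => //.
  + by lia.
  + by move=> n Hn; rewrite /upd; case: eqP; [|lia].
  + move=> n Hn; eapply runs_weaken; first by step_tac.
      by [].
    upd_tac.
  + upd_tac.
  + by rewrite leq_add2r leq_mul2r HA.
Qed.

End Code.

(** * Expressions for words *)

Inductive wexpr :=
| WBit of expr
| WCat of wexpr & wexpr
| WFor of expr & wexpr.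

Fixpoint weval (w : word) (s : seq nat) (W : wexpr) : word :=
  match W with
  | WBit e => [:: 0 < eval w s e]
  | WCat a b => weval w s a ++ weval w s b
  | WFor e a => flatten [seq weval w (i :: s) a | i <- iota 0 (eval w s e)]
  end.

Section WCode.
Variable K : nat.

(* The output is produced from its last symbol to its first. *)
Fixpoint wcode (W : wexpr) (r : seq nat) (f : nat) : frag K :=
  match W with
  | WBit e => fseq (code K e r f f.+1)
      (fseq (fite (nonblank f) (fout K true) (fout K false)) (floop f (fdec K f)))
  | WCat a b => fseq (wcode b r f) (wcode a r f)
  | WFor e a => fseq (code K e r f f.+1) (floop f (fseq (fdec K f) (wcode a (f :: r) f.+1)))
  end.

Fixpoint wtapes_used (W : wexpr) (f : nat) : nat :=
  match W with
  | WBit e => tapes_used e f.+1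
  | WCat a b => maxn (wtapes_used a f) (wtapes_used b f)
  | WFor e a => maxn (tapes_used e f.+1) (wtapes_used a f.+1)
  end.

Definition wlayout (r : seq nat) (f : nat) (s : nat -> nat) : Prop :=
  [/\ 1 < f, all (fun x => 1 < x < f) r & forall x, f <= x -> s x = 0].

Lemma wlayout_layout r f s : wlayout r f s -> layout r f f.+1 s.
Proof.
case=> H1 H2 H4; split; first by lia.
- by apply/allP => x /(allP H2); lia.
- by apply/negP => /(allP H2); lia.
- by move=> x Hx; apply: H4; lia.
Qed.

Lemma wlayout_bind r f s v : wlayout r f s -> wlayout (f :: r) f.+1 (upd s f v).
Proof.
case=> H1 H2 H4; split; first by lia.
- by rewrite /=; apply/andP; split; [lia|apply/allP => x /(allP H2); lia].
- by move=> x Hx; rewrite /upd; case: eqP => [|_]; [lia|apply: H4; lia].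
Qed.

Lemma wlayout_notin r f s : wlayout r f s -> f \notin r.
Proof. by case=> _ H _; apply/negP => /(allP H); lia. Qed.

Lemma wcode_runs W : exists2 g, pbound g & forall w r f o s B,
  wlayout r f s -> wtapes_used W f <= K.+1 -> all (fun x => x <= B) (map s r) ->
  runs w (wcode W r f) 0 o s (g B) 0 (weval w (map s r) W ++ o) s.
Proof.
elim: W => [e|a [ga Ga Ha] b [gb Gb Hb]|e a [ga Ga Ha]] /=.
- have [g G Hg] := code_runs K e; have [va Va Ea] := eval_bound e.
  exists (fun B => g B + (2 + (va B * 2 + 1))) => [|w r f o s B HL Hf HB]; first by pbound_tac.
  have [H1 H2 H3] := HL; have LK := leq_tapes_used e f.+1.
  set A := eval w _ e; have HA : A <= va B by exact: Ea.
  have s0 : s f = 0 by exact: H3.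
  apply: (@runs_seq _ _ _ _ _ _ _ _ 0 o (upd s f A)).
    by apply: runs_weaken (Hg w r f f.+1 o s B (wlayout_layout HL) _ _) _ _ => //; rewrite s0.
  apply: (@runs_seq _ _ _ _ _ _ _ _ 0 ((0 < A) :: o) (upd s f A)).
    apply: runs_if_counter; first by lia.
    have -> : upd s f A f = A by rewrite /upd eqxx.
    by case: (0 < A); apply: runs_out.
  apply: runs_weaken (@runs_countdown K w f _ (fun=> 0) (fun=> (0 < A) :: o)
      (fun n => upd s f n) A 1 s _ _ _ _ _ _) _ _ => //.
  + by lia.
  + by move=> n Hn; rewrite /upd eqxx.
  + move=> n Hn; eapply runs_weaken; first by step_tac.
      by [].
    upd_tac.
  + upd_tac.
  + by rewrite leq_add2r leq_mul2r HA.
- exists (fun B => gb B + ga B) => [|w r f o s B HL Hf HB]; first by pbound_tac.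
  rewrite -catA.
  apply: (@runs_seq _ _ _ _ _ _ _ _ 0 (weval w (map s r) b ++ o) s).
    by apply: Hb => //; lia.
  by apply: Ha => //; lia.
- have [g G Hg] := code_runs K e; have [va Va Ea] := eval_bound e.
  exists (fun B => g B + (va B * (1 + ga (B + va B)).+1 + 1)) => [|w r f o s B HL Hf HB];
    first by pbound_tac.
  have [H1 H2 H3] := HL; have LK := leq_tapes_used e f.+1.
  set A := eval w _ e; have HA : A <= va B by exact: Ea.
  have s0 : s f = 0 by exact: H3.
  apply: (@runs_seq _ _ _ _ _ _ _ _ 0 o (upd s f A)).
    by apply: runs_weaken (Hg w r f f.+1 o s B (wlayout_layout HL) _ _) _ _ => //; [lia|rewrite s0].
  (* Counting down produces the pieces from last to first, which suits an output that grows to the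
     left. *)
  pose out n := flatten [seq weval w (i :: map s r) a | i <- iota n (A - n)] ++ o.
  have := @runs_countdown K w f (fseq (fdec K f) (wcode a (f :: r) f.+1)) (fun=> 0) out
    (upd s f) A (1 + ga (B + va B)) s (upd s f A).
  have -> : out A = o by rewrite /out subnn.
  have -> : out 0 = flatten [seq weval w (i :: map s r) a | i <- iota 0 A] ++ o by rewrite /out subn0.
  move=> H5; apply: runs_weaken (H5 _ _ _ _ _) _ _ => // {H5}.
  + by lia.
  + by move=> n Hn; rewrite /upd eqxx.
  + move=> n Hn; apply: (@runs_seq _ _ _ _ _ _ _ _ 0 (out n.+1) (upd s f n)).
      eapply runs_weaken; first by step_tac.
        by [].
      upd_tac.
    have -> : out n = weval w (n :: map s r) a ++ out n.+1.
      by rewrite /out (_ : A - n = (A - n.+1).+1) /= ?catA //; lia.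
    have Er : map (upd s f n) (f :: r) = n :: map s r.
      by rewrite /= !map_upd ?(wlayout_notin HL) // /upd eqxx.
    rewrite -Er; apply: Ha => //; [exact: wlayout_bind|lia|].
    rewrite Er /=; apply/andP; split; [lia|apply/allP => x /(allP HB); lia].
  + upd_tac.
  + by rewrite leq_add2r leq_mul2r HA orbT.
Qed.

(** * The complete machine *)

Definition copy_act (r : {ffun 'I_K.+1 -> option (bool + void)}) :
    {ffun 'I_K.+1 -> option (bool + void) * move} :=
  [ffun k : 'I_K.+1 => if k == 0 :> nat then (r k, MoveR)
                       else if k == 1 :> nat then (r ord0, MoveR) else (r k, Stay)].

(** Tape 0 serves for input and output, so the input is first saved on tape 1; the output later
    grows leftwards from the blank behind the old input, over it. Register 2 receives the length of
    the input; rewinding tape 1 uses this value up, and it is restored from register 3. *)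
Definition fload : frag K :=
  fseq (fwhile (nonblank 0) (fseq (fbasic copy_act) (finc K 2)))
    (fseq (floop 2 (fseq (fdec K 2) (fseq (fleft K 1) (finc K 3))))
          (floop 3 (fseq (fdec K 3) (finc K 2)))).

Definition loading (m : nat) : nat -> content :=
  fun i => match i with
  | 0 => Input m | 1 => Copied m | 2 => Counter m | _ => Counter 0
  end.

Lemma exec_post F w st k st' st'' : @exec K w F st k st' ->
  (forall tau, @all_hold K w st' tau -> all_hold w st'' tau) -> exec w F st k st''.
Proof.
by move=> H1 H2 tau /H1 [k' [tau' [A B /H2 C]]]; exists k', tau'.
Qed.

Lemma exec_load w : 2 < K ->
  exec w fload (loading 0) (size w * 4 + 1 + (size w * 5 + 1 + (size w * 4 + 1)))
    (regs 0 [::] (upd (fun=> 0) 2 (size w))).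
Proof.
move=> HK; set N := size w.
apply: (@exec_seq _ _ _ _ _ _ (regs N [::] (upd (fun=> 0) 2 N))).
  (* A change of description only: once everything is copied, tape 1 is an input whose head has
     reached the end, and tape 0 is ready for an empty output. *)
  apply: (@exec_post _ _ _ _ (loading N)); last first.
    move=> tau H i; have := H i; rewrite /upd.
    have E j : input_cell w (N + j) = None by rewrite /input_cell nth_default // size_map leq_addr.
    case: (nat_of_ord i) => [|[|[|k]]] //=.
    - by case=> H1 _ j; rewrite H1 E nth_nil.
    - by case=> H1 H2; split=> j; [rewrite H1 E|exact: H2].
  have := @exec_while K w (nonblank 0) (fseq (fbasic copy_act) (finc K 2))
    (fun n => loading (N - n)) N 3.
  rewrite subnn subn0; apply.
    move=> n tau Hn H; rewrite (nonblank_input (p := N - n) _ _ H) //; lia.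
  move=> n Hn; have -> : N - n = (N - n.+1).+1 by lia.
  move: (N - n.+1) (ltn_subrL n.+1 N) => m Hm.
  apply: (@exec_seq _ _ _ _ _ 1 (upd (loading m.+1) 2 (Counter m)) 2).
    apply: exec_basic => tau H k; rewrite !ffunE /upd.
    have H0 := H ord0; have Hk := H k; move: Hk.
    case E: (nat_of_ord k) => [|[|[|i]]].
    - have -> : k = ord0 by apply: val_inj.
      case: H0 => H1 H2 _; split=> j.
        by rewrite (nth_right_act MoveR) H1 addSnnS.
      rewrite (nth_left_act MoveR) /= readE; case: j => [|j] Hj; first by rewrite H1 addn0 subn1.
      by rewrite H2 // subSS.
    - case: H0 => H1 _ [H2 H3]; split=> j.
        by rewrite (nth_right_act MoveR) H2.
      rewrite (nth_left_act MoveR) /= ?ffunE readE; case: j => [|j] Hj; first by rewrite H1 addn0 subn1.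
      by rewrite H3 // subSS.
    - by move=> H2; have := @holds_idle w (Counter m) _ H2.
    - by move=> H2; have := @holds_idle w (Counter 0) _ H2.
  apply: exec_weaken (@exec_inc K w (upd (loading m.+1) 2 (Counter m)) 2 m _) _ _ _ => //.
  by case=> [|[|[|i]]].
apply: (@runs_seq _ _ _ _ _ _ _ _ 0 [::] (upd (fun=> 0) 3 N)).
  apply: (@runs_countdown K w 2 _ id (fun=> [::])
    (fun n => upd (upd (fun=> 0) 2 n) 3 (N - n)) N 4).
  - by lia.
  - by move=> n Hn; rewrite /upd.
  - move=> n Hn; eapply runs_weaken; first by step_tac.
      by [].
    upd_tac.
  - rewrite subnn; upd_tac.
  - rewrite subn0; upd_tac.
apply: (@runs_countdown K w 3 _ (fun=> 0) (fun=> [::])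
  (fun n => upd (upd (fun=> 0) 3 n) 2 (N - n)) N 3).
- by lia.
- by move=> n Hn; rewrite /upd.
- move=> n Hn; eapply runs_weaken; first by step_tac.
    by [].
  upd_tac.
- rewrite subnn; upd_tac.
- rewrite subn0; upd_tac.
Qed.

Definition frag_TM (F : frag K) : TM :=
  @MkTM K (option (fstate F)) void (Some (fstart F)) (fun q => q == None)
    (fun q r => if q is Some q' then frag_trans q' r else (None, idle r)).

Lemma iter_step_reach (F : frag K) q tau k tau' : @reach K F q tau k tau' ->
  iter k (@step (frag_TM F)) (Some q, tau) = (None, tau').
Proof.
elim=> {q tau k tau'} [q tau a E|q tau q' a k tau' E _ IH].
  by rewrite /= /step /= E.
rewrite iterSr -IH; congr iter; rewrite /step /= E //.
Qed.

End WCode.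

Lemma iter_fix (T : Type) (f : T -> T) x k : f x = x -> iter k f x = x.
Proof. by move=> H; elim: k => //= k ->. Qed.

Lemma leading_bits_nth M (r : seq (option (symbol M))) (o : word) :
  (forall j, nth None r j = nth None [seq Some (inl b) | b <- o] j) -> leading_bits r = o.
Proof.
elim: o r => [|b o IH] [|c r] H //=.
- by have := H 0; rewrite /= => ->.
- by have := H 0.
have := H 0; rewrite /= => ->; congr cons; apply: IH => j; exact: H j.+1.
Qed.

Lemma polytime_weval W : polytime_computable (fun w => weval w [:: size w] W).
Proof.
pose K := maxn 3 (wtapes_used W 3); have HK : 2 < K by rewrite leq_maxl.
have [g [c Hc] Hg] := wcode_runs K W.
pose fend : frag K := fbasic (act1 0 (fun c => (c, MoveR))).
pose F := fseq (fload K) (fseq (wcode K W [:: 2] 3) fend).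
have [d Hd] : pbound (fun B => B * 4 + 1 + (B * 5 + 1 + (B * 4 + 1)) + ((B + 2) ^ c + 1)).
  have P : pbound (fun B => (B + 2) ^ c) by exists c.
  by pbound_tac.
exists (frag_TM F), (('X + (2%N)%:P) ^+ d)%R => w.
have -> : (('X + (2%N)%:P) ^+ d).[size w]%R = (size w + 2) ^ d.
  by rewrite horner_exp hornerD hornerX hornerC.
have H0 : all_hold w (loading 0) (init (frag_TM F) w).2.
  move=> i; rewrite ffunE; have -> : (i == ord0) = (i == 0 :> nat) by [].
  case: (nat_of_ord i) => [|[|[|k]]] /=.
  - by split.
  - by split=> // j; rewrite nth_nil.
  - by move=> j; rewrite nth_nil.
  - by move=> j; rewrite nth_nil.
have [k1 [tau1 [L1 R1 T1]]] := exec_load HK H0.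
have [|||k2 [tau2 [L2 R2 T2]]] := Hg w [:: 2] 3 [::] (upd (fun=> 0) 2 (size w)) (size w) _ _ _ tau1 T1.
- by split=> // x Hx; rewrite /upd; case: eqP => // ?; lia.
- by lia.
- by rewrite /= /upd eqxx leqnn.
pose tau3 := act_on (act1 0 (fun c => (c, MoveR)) (scan tau2)) tau2.
have R3 : @reach K fend tt tau2 1 tau3 by exact: reach_exit.
have R := reach_seq_l R1 (reach_seq_l R2 R3).
(* The polynomial may prescribe more steps than needed; the halted machine idles for the remaining
   [j]. *)
have Ek : exists j, (size w + 2) ^ d = j + (k1 + (k2 + 1)).
  exists ((size w + 2) ^ d - (k1 + (k2 + 1))); rewrite subnK //.
  by apply: leq_trans (Hd _); have := Hc (size w); lia.
case: Ek => j ->; rewrite /outputs_within iterD.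
have -> : iter (k1 + (k2 + 1)) (@step (frag_TM F)) (init (frag_TM F) w) = (None, tau3).
  exact: iter_step_reach R.
rewrite iter_fix; last by rewrite /step /=.
split=> //; apply: leading_bits_nth => i.
have := T2 ord0; rewrite /= /upd eqxx cats0 /= => H.
rewrite /tau3 !ffunE (nth_right_act MoveR) H //.
Qed.

(** * Expressible functions *)

(* Variable 0 holds the length of the input. *)
Definition pexp (F : word -> seq nat -> nat) : Prop :=
  exists e, forall w s, eval w (size w :: s) e = F w s.

(** The loops of a [wexpr] push their indices in front, so the length of the input sits behind [k]
    of them. For use by a [pexp] it is copied to the front with [ELet (EVar k)]. *)
Definition wpexp (k : nat) (F : word -> seq nat -> word) : Prop :=
  exists W, forall w s, size s = k ->
    weval w (s ++ [:: size w]) W = F w (s ++ [:: size w]).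

(** [bsum] and [ite] are named functions so that [pexp_tac] can recognize sums and case distinctions
    by their head symbols. *)
Definition bsum (n : nat) (f : nat -> nat) : nat := \sum_(i < n) f i.

Definition ite (b : bool) (x y : nat) : nat := if b then x else y.

Fixpoint shift (c : nat) (e : expr) : expr :=
  match e with
  | EVar i => EVar (if i < c then i else i.+1)
  | EOne => EOne
  | EAdd a b => EAdd (shift c a) (shift c b)
  | ESub a b => ESub (shift c a) (shift c b)
  | ESum a b => ESum (shift c a) (shift c.+1 b)
  | ELet a b => ELet (shift c a) (shift c.+1 b)
  | EBit a => EBit (shift c a)
  end.

(** Weakening. Stated with [behead], it also holds if the skipped entry is missing, since
    environments are read with default 0. *)
Lemma eval_shift w e s0 s :
  eval w (s0 ++ s) (shift (size s0) e) = eval w (s0 ++ behead s) e.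
Proof.
elim: e s0 => [i||a Ha b Hb|a Ha b Hb|a Ha b Hb|a Ha b Hb|a Ha] s0 //=; rewrite ?Ha ?Hb //.
- case: (ltnP i (size s0)) => Hi; rewrite !nth_cat; first by rewrite Hi.
  by rewrite ltnNge ltnW // ltnNge Hi /= nth_behead subSn.
- by apply: eq_bigr => i _; rewrite (Hb (val i :: s0)).
- by rewrite (Hb (eval w (s0 ++ behead s) a :: s0)).
Qed.

Lemma pexp_behead F : pexp F -> pexp (fun w s => F w (behead s)).
Proof. by case=> e He; exists (shift 1 e) => w s; rewrite -He (eval_shift w e [:: size w]). Qed.

Lemma pexp_ext F G : pexp F -> (forall w s, F w s = G w s) -> pexp G.
Proof. by case=> e He E; exists e => w s; rewrite He. Qed.

Lemma pexp_var k : pexp (fun _ s => nth 0 s k).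
Proof. by exists (EVar k.+1). Qed.

Lemma pexp_size : pexp (fun w _ => size w).
Proof. by exists (EVar 0). Qed.

Lemma pexp_add F G : pexp F -> pexp G -> pexp (fun w s => F w s + G w s).
Proof. by case=> a Ha [b Hb]; exists (EAdd a b) => w s /=; rewrite Ha Hb. Qed.

Lemma pexp_sub F G : pexp F -> pexp G -> pexp (fun w s => F w s - G w s).
Proof. by case=> a Ha [b Hb]; exists (ESub a b) => w s /=; rewrite Ha Hb. Qed.

Lemma pexp_const n : pexp (fun _ _ => n).
Proof.
elim: n => [|n [e He]]; first by exists (ESub EOne EOne).
by exists (EAdd e EOne) => w s; rewrite /= He addn1.
Qed.

Lemma pexp_bsum n f : pexp n -> pexp (fun w s => f w (behead s) (nth 0 s 0)) ->
  pexp (fun w s => bsum (n w s) (f w s)).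
Proof.
(* [ESum] puts the index in front of the length. The [ELet] puts a copy of the length in front
   again, and [shift 2] skips the old one. *)
case=> a Ha [b Hb]; exists (ESum a (ELet (EVar 1) (shift 2 b))) => w s /=; rewrite Ha.
by apply: eq_bigr => i _; rewrite (eval_shift w b [:: size w; val i]) Hb.
Qed.

Lemma pexp_mul F G : pexp F -> pexp G -> pexp (fun w s => F w s * G w s).
Proof.
move=> HF /pexp_behead HG.
apply: pexp_ext (@pexp_bsum _ (fun w s _ => G w s) HF HG) _ => w s.
by rewrite /bsum sum_nat_const card_ord.
Qed.

Lemma pexp_app1 F G : pexp (fun w s => F w (nth 0 s 0)) -> pexp G ->
  pexp (fun w s => F w (G w s)).
Proof.
case=> b Hb [a Ha]; exists (ELet a (ELet (EVar 1) (shift 2 b))) => w s.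
by rewrite /= Ha (eval_shift w b [:: size w; G w s]) Hb.
Qed.

Lemma pexp_app2 F G H : pexp (fun w s => F w (nth 0 s 0) (nth 0 s 1)) -> pexp G -> pexp H ->
  pexp (fun w s => F w (G w s) (H w s)).
Proof.
case=> b Hb [g Hg] [h Hh].
exists (ELet h (ELet (shift 0 g) (ELet (EVar 2) (shift 3 b)))) => w s.
by rewrite /= (eval_shift w g [::]) /= Hg Hh (eval_shift w b [:: size w; G w s; H w s]) Hb.
Qed.

Lemma pexp_succ F : pexp F -> pexp (fun w s => (F w s).+1).
Proof.
by move=> H; apply: pexp_ext (pexp_add H (pexp_const 1)) _ => w s; rewrite addn1.
Qed.

Lemma pexp_input F : pexp F -> pexp (fun w s => nth false w (F w s)).
Proof. by case=> e He; exists (EBit e) => w s /=; rewrite He. Qed.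

Lemma pexp_leq F G : pexp F -> pexp G -> pexp (fun w s => F w s <= G w s).
Proof.
move=> HF HG; apply: pexp_ext (pexp_sub (pexp_const 1) (pexp_sub HF HG)) _ => w s.
by case: leqP; lia.
Qed.

Lemma pexp_eq F G : pexp F -> pexp G -> pexp (fun w s => F w s == G w s).
Proof.
move=> HF HG; apply: pexp_ext (pexp_sub (pexp_const 1)
  (pexp_add (pexp_sub HF HG) (pexp_sub HG HF))) _ => w s.
by case: eqP; lia.
Qed.

Lemma pexp_neg (F : word -> seq nat -> bool) : pexp F -> pexp (fun w s => ~~ F w s).
Proof. by move=> HF; apply: pexp_ext (pexp_sub (pexp_const 1) HF) _ => w s; case: (F w s). Qed.

Lemma pexp_and (F G : word -> seq nat -> bool) :
  pexp F -> pexp G -> pexp (fun w s => F w s && G w s).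
Proof. by move=> HF HG; apply: pexp_ext (pexp_mul HF HG) _ => w s; case: (F w s); case: (G w s). Qed.

Lemma pexp_or (F G : word -> seq nat -> bool) :
  pexp F -> pexp G -> pexp (fun w s => F w s || G w s).
Proof.
move=> HF HG; apply: pexp_ext (pexp_leq (pexp_const 1) (pexp_add HF HG)) _ => w s.
by case: (F w s); case: (G w s).
Qed.

Lemma pexp_if (b : word -> seq nat -> bool) F G : pexp b -> pexp F -> pexp G ->
  pexp (fun w s => ite (b w s) (F w s) (G w s)).
Proof.
move=> Hb HF HG; apply: pexp_ext (pexp_add (pexp_mul Hb HF)
  (pexp_mul (pexp_sub (pexp_const 1) Hb) HG)) _ => w s.
by rewrite /ite; case: (b w s); rewrite !(mul0n, mul1n, addn0).
Qed.

Lemma sum_ltn a q : q <= a -> \sum_(i < a) ((i < q) : nat) = q.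
Proof.
elim: a q => [|a IH] q Hq; first by rewrite big_ord0; lia.
rewrite big_ord_recr /=; case: (leqP q a) => H; first by rewrite IH // addn0.
have -> : q = a.+1 by lia.
rewrite (eq_bigr (fun i : 'I_a => 1)); last by move=> i _; rewrite ltnS ltnW.
by rewrite sum1_card card_ord ?ltnSn addn1.
Qed.

(** The quotient counts the positive multiples of [b] that do not exceed [a]; for [b > 0] their
    factors are at most [a]. *)
Lemma divn_bsum a b : a %/ b = (0 < b) * bsum a (fun i => i.+1 * b <= a).
Proof.
case: b => [|b]; first by rewrite divn0.
rewrite mul1n /bsum -[LHS](@sum_ltn a) ?leq_div //.
by apply: eq_bigr => i _; rewrite leq_divRL.
Qed.

Lemma pexp_div F G : pexp F -> pexp G -> pexp (fun w s => F w s %/ G w s).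
Proof.
move=> HF HG.
apply: (@pexp_ext (fun w s => (0 < G w s) * bsum (F w s) (fun i => i.+1 * G w s <= F w s)));
  last by move=> w s; rewrite divn_bsum.
apply: pexp_mul; first exact: pexp_leq (pexp_const 1) HG.
apply: (@pexp_bsum F (fun w s i => i.+1 * G w s <= F w s)) => //.
by apply: pexp_leq; [apply: pexp_mul; [exact: pexp_succ (pexp_var 0)|]|]; apply: pexp_behead.
Qed.

Lemma pexp_mod F G : pexp F -> pexp G -> pexp (fun w s => F w s %% G w s).
Proof.
move=> HF HG; apply: pexp_ext (pexp_sub HF (pexp_mul (pexp_div HF HG) HG)) _ => w s.
by rewrite {1}(divn_eq (F w s) (G w s)) addKn.
Qed.

Lemma pexp_odd F : pexp F -> pexp (fun w s => odd (F w s)).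
Proof. by move=> H; apply: pexp_ext (pexp_mod H (pexp_const 2)) _ => w s; rewrite modn2. Qed.

Lemma pexp_dvd F G : pexp F -> pexp G -> pexp (fun w s => F w s %| G w s).
Proof. by move=> HF HG; apply: (pexp_eq (pexp_mod HG HF) (pexp_const 0)). Qed.

Lemma pexp_table (t : seq nat) F : pexp F -> pexp (fun w s => nth 0 t (F w s)).
Proof.
move=> HF; elim: t F HF => [|x t IH] F HF.
  by apply: pexp_ext (pexp_const 0) _ => w s; rewrite nth_nil.
apply: pexp_ext (pexp_if (pexp_eq HF (pexp_const 0)) (pexp_const x)
  (IH _ (pexp_sub HF (pexp_const 1)))) _ => w s.
by case: (F w s) => //= k; rewrite subn1.
Qed.

Lemma pexp_horner (p : {poly nat}) F : pexp F -> pexp (fun w s => p.[F w s]%R).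
Proof.
move=> HF; elim/poly_ind: p => [|p c IH].
  by apply: pexp_ext (pexp_const 0) _ => w s; rewrite horner0.
apply: pexp_ext (pexp_add (pexp_mul IH HF) (pexp_const c)) _ => w s.
by rewrite hornerMXaddC.
Qed.

Lemma wpexp_bit k (F : word -> seq nat -> bool) : pexp F -> wpexp k (fun w s => [:: F w s]).
Proof.
case=> e He; exists (WBit (ELet (EVar k) e)) => w s Hs /=.
by rewrite nth_cat -Hs ltnn subnn /= He; case: (F w _).
Qed.

Lemma wpexp_cat k F G : wpexp k F -> wpexp k G -> wpexp k (fun w s => F w s ++ G w s).
Proof. by case=> a Ha [b Hb]; exists (WCat a b) => w s Hs /=; rewrite Ha // Hb. Qed.

Lemma wpexp_for k n f : pexp n -> wpexp k.+1 (fun w s => f w (behead s) (nth 0 s 0)) ->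
  wpexp k (fun w s => flatten [seq f w s i | i <- iota 0 (n w s)]).
Proof.
case=> e He [a Ha]; exists (WFor (ELet (EVar k) e) a) => w s Hs /=.
rewrite nth_cat -Hs ltnn subnn /= He.
by congr flatten; apply: eq_map => i; rewrite -cat_cons Ha //= Hs.
Qed.

Lemma polytime_wpexp f g : wpexp 0 g -> (forall w s, g w s = f w) -> polytime_computable f.
Proof.
case=> W HW E; have [M [p H]] := polytime_weval W; exists M, p => w.
by rewrite -(E w [:: size w]) -(HW w [::]).
Qed.

(* [pexp_hook] is redefined to deal with further functions. *)
Ltac pexp_hook := fail.

Ltac pexp_tac := first [ assumption | pexp_hook | lazymatch goal with
  | |- pexp (fun _ _ => ?n) => exact: (pexp_const n)
  | |- pexp (fun w _ => size w) => exact: pexp_size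
  | |- pexp (fun w s => nth 0 (@?a w s) ?k) =>
      first [ exact: (pexp_var k) | exact: (pexp_behead (pexp_var k))
            | exact: (pexp_behead (pexp_behead (pexp_var k)))
            | exact: (pexp_behead (pexp_behead (pexp_behead (pexp_var k))))
            | exact: (pexp_behead (pexp_behead (pexp_behead (pexp_behead (pexp_var k)))))
            | idtac ]
  | |- pexp (fun w s => ?F w (behead s)) => apply: (@pexp_behead F); pexp_tac
  | |- pexp (fun w s => nat_of_bool (nth false w (@?a w s))) => apply: (@pexp_input a); pexp_tac
  | |- pexp (fun w s => S (@?a w s)) => apply: (@pexp_succ a); pexp_tac
  | |- pexp (fun w s => @?a w s + @?b w s) => apply: (@pexp_add a b); pexp_tac
  | |- pexp (fun w s => @?a w s - @?b w s) => apply: (@pexp_sub a b); pexp_tac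
  | |- pexp (fun w s => @?a w s * @?b w s) => apply: (@pexp_mul a b); pexp_tac
  | |- pexp (fun w s => @?a w s %/ @?b w s) => apply: (@pexp_div a b); pexp_tac
  | |- pexp (fun w s => @?a w s %% @?b w s) => apply: (@pexp_mod a b); pexp_tac
  | |- pexp (fun w s => nat_of_bool (@?a w s <= @?b w s)) => apply: (@pexp_leq a b); pexp_tac
  | |- pexp (fun w s => nat_of_bool (@?a w s %| @?b w s)) => apply: (@pexp_dvd a b); pexp_tac
  | |- pexp (fun w s => nat_of_bool (odd (@?a w s))) => apply: (@pexp_odd a); pexp_tac
  | |- pexp (fun w s => nat_of_bool (@eq_op _ (@?a w s) (@?b w s))) => apply: (@pexp_eq a b); pexp_tac
  | |- pexp (fun w s => nat_of_bool (~~ (@?a w s))) => apply: (@pexp_neg a); pexp_tac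
  | |- pexp (fun w s => nat_of_bool (@?a w s && @?b w s)) => apply: (@pexp_and a b); pexp_tac
  | |- pexp (fun w s => nat_of_bool (@?a w s || @?b w s)) => apply: (@pexp_or a b); pexp_tac
  | |- pexp (fun w s => bsum (@?a w s) (@?b w s)) => apply: (@pexp_bsum a b); pexp_tac
  | |- pexp (fun w s => ite (@?c w s) (@?a w s) (@?b w s)) =>
      apply: (@pexp_if c a b); pexp_tac
  | |- _ => idtac
  end ].

(** * Trees given by a parent function *)

Section ParentTree.
Variables (n : nat) (par : nat -> nat).

Definition par_adj (x y : 'I_n) : bool :=
  (x != y :> nat) && ((0 < x) && (par x == y) || (0 < y) && (par y == x)).

Lemma par_adj_sym : symmetric par_adj.
Proof. by move=> x y; rewrite /par_adj eq_sym orbC. Qed.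

Lemma par_adj_irrefl : irreflexive par_adj.
Proof. by move=> x; rewrite /par_adj eqxx. Qed.

Definition ptree : sgraph := SGraph par_adj_sym par_adj_irrefl.

Hypothesis n_gt0 : 0 < n.
Hypothesis par_lt : forall x, 0 < x < n -> par x < x.

Local Notation root := (Ordinal n_gt0).

Lemma par_ord (x : 'I_n) : 0 < x -> exists2 y : 'I_n, y = par x :> nat & par_adj x y.
Proof.
move=> Hx; have Hp : par x < x by rewrite par_lt // Hx ltn_ord.
exists (Ordinal (ltn_trans Hp (ltn_ord x))) => //.
by rewrite /par_adj /= Hx eqxx andbT; lia.
Qed.

Lemma par_adj_lt (x y : 'I_n) : par_adj x y -> y < x -> y = par x :> nat.
Proof.
rewrite /par_adj; case/andP=> _ /orP[/andP[_ /eqP->]//|/andP[Hy /eqP E] Hlt].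
by have := par_lt; move=> /(_ y); rewrite Hy ltn_ord E => /(_ isT); lia.
Qed.

Lemma ptree_ind (Q : 'I_n -> Prop) : Q root ->
  (forall x y : 'I_n, 0 < x -> y = par x :> nat -> par_adj x y -> Q y -> Q x) ->
  forall x, Q x.
Proof.
move=> Q0 Qs x; have [k Hk] := ubnP (val x); elim: k x Hk => // k IH x Hk.
case: (posnP x) => [E|Hx]; first by have -> : x = root by apply: val_inj.
have [y Ey A] := par_ord Hx; apply: (Qs x y) => //; apply: IH.
by rewrite /= Ey; apply: leq_trans (par_lt _) _; rewrite ?Hx ?ltn_ord.
Qed.

Lemma ptree_connect_root (x : 'I_n) : connect par_adj x root.
Proof.
by elim/ptree_ind: x => // x y _ _ A; apply: connect_trans (connect1 A).
Qed.

(** The largest node of a cycle has two distinct neighbours on it. Both are smaller, hence both are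
    its parent. *)
Lemma ptree_tree : tree ptree.
Proof.
split; first split.
- by rewrite card_ord.
- move=> x y; apply: connect_trans (ptree_connect_root x) _.
  by rewrite (sym_connect_sym par_adj_sym); apply: ptree_connect_root.
move=> c /andP[Hc Uc]; rewrite ltnNge; apply/negP => Sc.
case: c Hc Uc Sc => [|x0 c0] // Hc Uc Sc; set c := x0 :: c0 in Hc Uc Sc.
pose M := \max_(x <- c) nat_of_ord x.
have [x xc Ex] : exists2 x, x \in c & nat_of_ord x = M.
  have : M \in map (@nat_of_ord n) c.
    rewrite /M /c; elim: c0 x0 {c Hc Uc Sc M} => [|y s IH] x0.
      by rewrite big_seq1 mem_seq1.
    rewrite big_cons; case: (leqP x0 (\max_(j <- y :: s) j)) => H.
      by rewrite in_cons IH orbT.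
    by rewrite in_cons eqxx.
  by case/mapP=> x H1 H2; exists x.
have Mx y : y \in c -> nat_of_ord y <= x by move=> yc; rewrite Ex /M (big_rem y) //= leq_maxl.
have [i p Ep] := rot_to xc.
have Up : uniq (x :: p) by rewrite -Ep rot_uniq.
have Cp : cycle (@adj ptree) (x :: p) by rewrite -Ep rot_cycle.
have Sp : size (x :: p) = size c by rewrite -Ep size_rot.
have Mp y : y \in p -> nat_of_ord y < x.
  move=> yp; have : nat_of_ord y <= x by apply: Mx; rewrite -(mem_rot i) Ep in_cons yp orbT.
  rewrite leq_eqVlt; case/orP=> // /eqP /val_inj E; move: Up; rewrite /= -E yp //.
case: p {Ep} Up Cp Sp Mp => [|y p] Up Cp Sp Mp; first by rewrite -Sp in Sc.
case/lastP: p Up Cp Sp Mp => [|p z] Up Cp Sp Mp; first by rewrite -Sp in Sc.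
have Ay : par_adj x y by move: Cp; rewrite /= => /andP[].
have Az : par_adj x z.
  move: Cp; rewrite /= rcons_path => /and3P[_ _]; rewrite last_rcons => A.
  by rewrite par_adj_sym.
have Ey := par_adj_lt Ay (Mp _ (mem_head _ _)).
have Hz : z \in y :: rcons p z by rewrite in_cons mem_rcons mem_head orbT.
have Ez := par_adj_lt Az (Mp _ Hz).
have E : y = z by apply: val_inj; rewrite /= Ey Ez.
by move: Up; rewrite /= E mem_rcons in_cons eqxx /= andbF.
Qed.

(** A node other than the root can only be adjacent to its parent and to its successor. *)
Lemma ptree_spider :
  (forall x y, 0 < x < n -> 0 < y < n -> par y = x -> y = x.+1) -> spider ptree.
Proof.
move=> H; split; first exact: ptree_tree.
apply: leq_trans (_ : #|[set root]| <= _); last by rewrite cards1.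
apply/subset_leq_card/subsetP => x; rewrite !inE => Hd; apply/eqP; apply: val_inj => /=.
apply/eqP; rewrite -leqn0 leqNgt; apply/negP => Hx.
have [y Ey _] := par_ord Hx.
suff : degree (G := ptree) x <= 2 by rewrite leqNgt Hd.
rewrite /degree -(size_enum_ord 2).
have Hs : {subset map (@nat_of_ord n) (enum [set y | @adj ptree x y]) <= [:: par x; x.+1]}.
  move=> k /mapP[z]; rewrite mem_enum inE => A ->; rewrite !inE.
  case: (ltnP z x) => Hz; first by rewrite (par_adj_lt A Hz) eqxx.
  move: A; rewrite /= /par_adj => /andP[Hne /orP[/andP[_ /eqP<-]|/andP[Hz0 /eqP E]]].
    by rewrite eqxx.
  by rewrite (H x z) ?eqxx ?orbT // ?Hx ?Hz0 ltn_ord.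
rewrite cardE -(size_map (@nat_of_ord n)) size_enum_ord.
by apply: uniq_leq_size Hs; rewrite map_inj_uniq ?enum_uniq //; apply: val_inj.
Qed.

Lemma ptree_diameter :
  (forall x, 0 < x < n -> 0 < par x -> par (par x) = 0) -> diameter ptree <= 4.
Proof.
move=> H.
have up (x : 'I_n) : exists p : seq 'I_n, [/\ size p <= 2, path par_adj x p & last x p = root].
  case: (posnP x) => [E|Hx]; first by exists [::]; split=> //; apply: val_inj.
  have [y Ey A] := par_ord Hx; case: (posnP y) => [E|Hy].
    by exists [:: y]; split=> //=; [rewrite A|apply: val_inj].
  have [z Ez A'] := par_ord Hy; exists [:: y; z]; split=> //=; first by rewrite A A'.
  by apply: val_inj; rewrite /= Ez Ey H // ?Hx ?ltn_ord // -Ey.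
have down (x : 'I_n) : exists p : seq 'I_n, [/\ size p <= 2, path par_adj root p & last root p = x].
  have [p [Sp Pp Lp]] := up x; exists (rev (belast x p)); split.
  - by rewrite size_rev size_belast.
  - by rewrite -Lp rev_path; apply: sub_path Pp => u v; rewrite par_adj_sym.
  - by case: p {Sp Pp} Lp => [|y p] /=; [move=> -> | rewrite rev_cons last_rcons].
apply/bigmax_leqP => x _; apply/bigmax_leqP => y _; rewrite /dist.
have [p [Sp Pp Lp]] := up x; have [q [Sq Pq Lq]] := down y.
(* [dist] searches the lengths below the number of nodes. With at most four nodes the bound is
   immediate; otherwise the walk through the root has a length within the range of the search. *)
case: (leqP #|node ptree| 4) => Hn.
  by apply: leq_trans Hn; rewrite -[X in _ <= X](size_iota 0); apply: find_size.
have Hk : size (p ++ q) <= 4 by rewrite size_cat; lia.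
have Hw : walk (G := ptree) (size (p ++ q)) x y.
  apply/existsP; exists (in_tuple (p ++ q)).
  by rewrite cat_path last_cat Pp Lp Pq Lq /=.
rewrite leqNgt; apply/negP => Hf.
have := before_find 0 (leq_ltn_trans Hk Hf).
by rewrite nth_iota ?add0n ?Hw //; apply: leq_ltn_trans Hn.
Qed.

End ParentTree.

(** * Legs *)

(* Node 0 is the root; the nodes of leg [i] are the interval ](pre i), (pre i.+1)],
   of length [a i]. *)
Section Legs.
Variables (a : nat -> nat) (nI : nat).

Definition pre (i : nat) : nat := bsum i a.

(** Counting the legs that end before [x] finds its leg by a bounded sum, which is expressible. *)
Definition leg (x : nat) : nat := bsum nI (fun i => pre i.+1 < x).

Definition leg_start (x : nat) : nat := (pre (leg x)).+1.

Lemma preS i : pre i.+1 = pre i + a i.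
Proof. by rewrite /pre /bsum big_ord_recr. Qed.

Lemma pre_mono i j : i <= j -> pre i <= pre j.
Proof. by move/subnKC <-; elim: (j - i) => [|k IH]; rewrite ?addn0 // addnS preS; lia. Qed.

Lemma legE i x : i < nI -> pre i < x <= pre i.+1 -> leg x = i.
Proof.
move=> Hi Hx; rewrite /leg /bsum -[RHS](@sum_ltn nI) ?(ltnW Hi) //; apply: eq_bigr => j _.
congr nat_of_bool; case: (ltnP j i) => Hj.
  by have := pre_mono Hj; lia.
by have := @pre_mono i.+1 j.+1 Hj; lia.
Qed.

Lemma leg_bounds x : 0 < x <= pre nI -> leg x < nI /\ pre (leg x) < x <= pre (leg x).+1.
Proof.
move=> Hx.
suff [i Hi Hb] : exists2 i, i < nI & pre i < x <= pre i.+1 by rewrite (legE Hi Hb).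
have : exists k, (k <= nI) && (x <= pre k) by exists nI; lia.
case/ex_minnP=> -[|k]; first by rewrite /pre /bsum big_ord0; lia.
case/andP=> Hk Hxk Hmin; exists k => //; rewrite Hxk andbT ltnNge; apply/negP => H.
by have := Hmin k; rewrite H (ltnW Hk) => /(_ isT); lia.
Qed.

Lemma sum_legs (p : nat -> bool) :
  \sum_(x < (pre nI).+1) ((0 < x) && p (leg x) : nat) = bsum nI (fun i => p i * a i).
Proof.
suff H k : k <= nI -> \sum_(x < (pre k).+1) ((0 < x) && p (leg x) : nat) = bsum k (fun i => p i * a i).
  exact: H.
elim: k => [|k IH] Hk; first by rewrite /pre /bsum !big_ord0 big_ord1.
rewrite preS -addSn big_split_ord /= IH ?(ltnW Hk) // /bsum big_ord_recr /=; congr addn.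
rewrite (eq_bigr (fun=> p k : nat)); first by rewrite sum_nat_const card_ord mulnC.
by move=> x _; rewrite (@legE k) // preS; have := ltn_ord x; lia.
Qed.

Lemma leg_start_bounds x : 0 < x <= pre nI ->
  [/\ 0 < leg_start x <= x, leg (leg_start x) = leg x & leg_start (leg_start x) = leg_start x].
Proof.
move=> Hx; have [H1 H2] := leg_bounds Hx.
have E : leg (leg_start x) = leg x by apply: legE; rewrite /leg_start; lia.
by split=> //; rewrite /leg_start ?E //; lia.
Qed.

Definition par_path (x : nat) : nat := ite (x == leg_start x) 0 (x - 1).

Definition par_star (x : nat) : nat := ite (x == leg_start x) 0 (leg_start x).

(** All that the game depends on: a leg is attached to the root by its first node and is connected.
    Paths and stars are treated alike from here on. *)
Definition leg_parent (par : nat -> nat) : Prop :=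
  forall x, 0 < x <= pre nI ->
    if x == leg_start x then par x = 0 else 0 < par x < x /\ leg (par x) = leg x.

Lemma leg_parent_path : leg_parent par_path.
Proof.
move=> x Hx; rewrite /par_path /ite; have [H1 _ _] := leg_start_bounds Hx.
have [H2 H3] := leg_bounds Hx.
case: eqP => // E; rewrite /leg_start in E H1; split; first by lia.
by apply: legE; lia.
Qed.

Lemma leg_parent_star : leg_parent par_star.
Proof.
move=> x Hx; rewrite /par_star /ite; have [H1 H2 _] := leg_start_bounds Hx.
by case: eqP => // E; split=> //; lia.
Qed.

Lemma leg_parent_lt par x : leg_parent par -> 0 < x < (pre nI).+1 -> par x < x.
Proof. by move=> H Hx; have := H x Hx; case: eqP => [_ ->|_ []]; lia. Qed.
End Legs.

(** * Winning strategies and exact packings *)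

Definition packing (nI T B : nat) (a f : nat -> nat) : Prop :=
  (forall i, i < nI -> f i < T) /\
  (forall j, j < T -> bsum nI (fun i => (f i == j) * a i) = B).

Section Game.
Variables (a : nat -> nat) (nI T B : nat) (par : nat -> nat).
Hypothesis B_gt0 : 0 < B.
Hypothesis T_gt0 : 0 < T.
Hypothesis a_le : forall i, i < nI -> a i <= B.
Hypothesis total : T * B <= pre a nI.
Hypothesis par_leg : leg_parent a nI par.

Local Notation n := (pre a nI).+1.
Local Notation G := (ptree n par).
Local Notation lg := (leg a nI).

Let ltpar x : 0 < x < n -> par x < x := leg_parent_lt par_leg (x := x).

Lemma adj_legs (x y : 'I_n) : @adj G x y -> 0 < x -> 0 < y -> lg x = lg y.
Proof.
have H (u v : 'I_n) : 0 < u -> 0 < v -> par u == v -> lg u = lg v.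
  move=> Hu Hv /eqP E; have Hun : 0 < u <= pre a nI by rewrite Hu -ltnS ltn_ord.
  by have := par_leg Hun; case: eqP => _; rewrite E => H; [lia|case: H].
rewrite /= /par_adj => /andP[_ /orP[/andP[_ E]|/andP[_ E]]] Hx Hy; first exact: H.
by symmetry; apply: H.
Qed.

Lemma card_legs (p : nat -> bool) :
  #|[set x : 'I_n | (0 < x) && p (lg x)]| = bsum nI (fun i => p i * a i).
Proof.
rewrite -sum_legs -sum1_card big_mkcond /=; apply: eq_bigr => x _.
by rewrite inE; case: (_ && _).
Qed.

(** Step [t] extinguishes the root together with the legs of bin [t]. A leg that is out can only be
    reignited through the root, which is out whenever the fire spreads; so only the root catches
    fire again. *)
Lemma packing_winning f : packing nI T B a f ->
  exists F : seq {set node G}, strategy B.+1 T F /\ winning F.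
Proof.
case=> f_lt Hf.
pose A t : {set node G} := [set x : 'I_n | (x == 0 :> nat) || (f (lg x) == t)].
exists (mkseq A T); split; first split.
- by rewrite size_mkseq.
- apply/allP => S /mapP[t]; rewrite mem_iota add0n => Ht ->.
  have -> : A t = ord0 |: [set x : 'I_n | (0 < x) && (f (lg x) == t)].
    by apply/setP => x; rewrite !inE -val_eqE /=; case: (nat_of_ord x).
  by rewrite cardsU1 (@card_legs (fun i => f i == t)) Hf // inE.
have HB t : t <= T -> forall x : 'I_n, x \in burning (mkseq A T) t -> 0 < x -> t <= f (lg x).
  elim: t => [//|t IH] Ht x; rewrite /= nth_mkseq //.
  have HR (y : 'I_n) : y \in burning (mkseq A T) t :\: A t -> 0 < y /\ t < f (lg y).
    rewrite !inE negb_or => /andP[/andP[H1 H2] /IH H3].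
    have Hy : 0 < y by lia.
    by split=> //; rewrite ltn_neqAle eq_sym H2 H3 // ltnW.
  rewrite in_setU; case/orP=> [/HR[]//|]; rewrite inE => /andP[_ /existsP[y /andP[/HR[H1 H2] Hyx]]] Hx.
  by rewrite -(adj_legs Hyx).
rewrite /winning size_mkseq; case: T T_gt0 f_lt HB => // T' _ f_lt HB /=.
have -> : burning (mkseq A T'.+1) T' :\: nth set0 (mkseq A T'.+1) T' = set0.
  apply/setP => x; rewrite nth_mkseq // !inE negb_or; apply/negP => /andP[/andP[H1 H2] H3].
  have Hx : 0 < x <= pre a nI by rewrite lt0n H1 -ltnS ltn_ord.
  have [H4 _] := leg_bounds Hx; have := f_lt _ H4.
  rewrite ltnS leq_eqVlt (negPf H2) ltnNge (HB _ (leqnSn _) x H3) //.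
  by case/andP: Hx.
rewrite set0U; apply/setP => x; rewrite in_set0 inE; apply/negbTE.
by rewrite negb_and; apply/orP; right; apply/existsPn => y; rewrite in_set0.
Qed.

Lemma winning_packing (F : seq {set node G}) :
  strategy B.+1 T F -> winning F -> exists f, packing nI T B a f.
Proof.
case=> SF /allP mF; rewrite /winning SF => HT.
(* [U t] is what does not burn after [t] steps, [S t] the same after the next extinguishing and
   before the fire spreads. *)
pose U t : {set 'I_n} := ~: burning F t.
pose S t : {set 'I_n} := U t :|: nth set0 F t.
have US t (v : 'I_n) : (v \in U t.+1) = (v \in S t) && [forall u, @adj G u v ==> (u \in S t)].
  have ER (u : 'I_n) : (u \in burning F t :\: nth set0 F t) = (u \notin S t).
    by rewrite /S /U !inE negb_or negbK andbC.
  rewrite /U in_setC /= in_setU negb_or ER negbK.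
  rewrite /neighbours [X in _ && ~~ X]in_set ER negbK; case: (v \in S t) => //=.
  rewrite negb_exists; apply: eq_forallb => u.
  by rewrite ER negb_and negbK orbC implybE.
have U0 : U 0 = set0 by apply/setP => x; rewrite !inE.
have UT : U T = setT by rewrite /U HT setC0.
have sub t : U t.+1 \subset S t by apply/subsetP => x; rewrite US => /andP[].
have F_le t : #|nth set0 F t| <= B.+1.
  case: (ltnP t (size F)) => Ht; first exact: mF (mem_nth _ _).
  by rewrite nth_default // cards0.
have S_le t : #|S t| <= #|U t| + B.+1.
  by apply: leq_trans (leq_card_setU _ _) _; rewrite leq_add2l.
have cardV : #|[set: 'I_n]| = n by rewrite cardsT card_ord.
have prop t (x y : 'I_n) : par_adj par x y -> x \in U t.+1 -> y \in S t.
  by move=> A; rewrite US => /andP[_ /forallP /(_ y)]; rewrite /= par_adj_sym A.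
(* A nonempty proper subset of a connected graph has a boundary. *)
have U_lt t : #|S t| < n -> #|U t.+1| <= #|S t|.-1.
  move=> Hs; case: (posnP #|S t|) => [E|Hpos].
    by have := subset_leq_card (sub t); rewrite E leqn0 => /eqP ->.
  rewrite -ltnS prednK //; apply: proper_card; rewrite properEneq sub andbT.
  apply/negP => /eqP E.
  have H0 (x : 'I_n) : (x \in S t) = (ord0 \in S t).
    elim/(ptree_ind (n := n) (n_gt0 := ltn0Sn _) ltpar): x => [|x y _ _ A IH].
      by congr (_ \in _); apply: val_inj.
    rewrite -IH; apply/idP/idP; first by rewrite -{1}E; apply: prop.
    by rewrite -{1}E; apply: prop; rewrite par_adj_sym.
  have [x Hx] : exists x, x \in S t by apply/set0Pn; rewrite -card_gt0.
  suff ES : S t = setT by move: Hs; rewrite ES cardV ltnn.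
  by apply/setP => y; rewrite in_setT H0 -(H0 x).
have U_ub t : t < T -> #|U t| <= t * B.
  elim: t => [|t IH] Ht; first by rewrite U0 cards0.
  have H1 := S_le t; have H2 := IH (ltnW Ht).
  have H3 : t.+1 * B < T * B by rewrite ltn_pmul2r.
  have := @U_lt t; rewrite mulSn in H3 *; lia.
have ET : T.-1.+1 = T by rewrite prednK.
have Hn : n <= #|S T.-1|.
  by have := subset_leq_card (sub T.-1); rewrite ET UT cardV.
have ETB : T * B = T.-1 * B + B by rewrite -{1}ET mulSn addnC.
(* The last step has to reach all of the at least [T * B + 1] nodes, and the bounds allow no more
   than that, so they are tight. *)
have [En ES1 EU1] : [/\ pre a nI = T * B, #|S T.-1| = n & #|U T.-1| = T.-1 * B].
  have H1 := S_le T.-1; have H2 := U_ub T.-1; have := total; split; lia.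
have U_eq t : t < T -> #|U t| = t * B.
  move=> Ht; apply/eqP; rewrite eqn_leq U_ub //=.
  (* Tightness at the end propagates backwards, one step at a time. *)
  suff H k : k <= T.-1 -> (T.-1 - k) * B <= #|U (T.-1 - k)|.
    by have := H (T.-1 - t); rewrite subKn; [apply; lia|lia].
  elim: k => [|k IH] Hk; first by rewrite subn0 EU1.
  have := IH (ltnW Hk); have -> : T.-1 - k = (T.-1 - k.+1).+1 by lia.
  have H1 := S_le (T.-1 - k.+1); have H2 := @U_lt (T.-1 - k.+1).
  have H3 := @U_ub (T.-1 - k.+1).
  have : (T.-1 - k.+1).+1 * B < T * B by rewrite ltn_pmul2r //; lia.
  by rewrite mulSn; lia.
have S_eq t : t.+1 < T -> #|S t| = (t.+1 * B).+1.
  move=> Ht; have H1 := S_le t; have := U_eq t (ltnW Ht); have := U_eq _ Ht.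
  have H3 : t.+1 * B < T * B by rewrite ltn_pmul2r.
  by have := @U_lt t; move: H3; rewrite mulSn; lia.
have root_b t : t.+1 < T -> U t.+1 = S t :\ ord0 /\ ord0 \in S t.
  move=> Ht.
  have [b Eb] : exists b, S t :\: U t.+1 = [set b].
    apply/cards1P; rewrite cardsD (setIidPr (sub t)) S_eq // U_eq //; apply/eqP; lia.
  have bS : b \in S t by have := set11 b; rewrite -Eb inE => /andP[].
  have EU : U t.+1 = S t :\ b.
    by rewrite -Eb setDDr setDv set0U; apply/esym/setIidPr.
  suff -> : ord0 = b by [].
  apply/eqP/negPn/negP => Hb.
  have Hb0 : 0 < b by rewrite lt0n; apply: contra Hb => /eqP E; apply/eqP/val_inj.
  have Hbn : 0 < b <= pre a nI by rewrite Hb0 -ltnS ltn_ord.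
  have [Hi _] := leg_bounds Hbn.
  have prop' (x y : 'I_n) : par_adj par x y -> x != b -> x \in S t -> y \in S t.
    by move=> A xb xS; apply: (prop _ _ _ A); rewrite EU in_setD1 xb.
  (* Without [b], the root is still connected with all legs other than that of [b], and along edges
     that avoid [b] membership in [S t] does not change. *)
  have out (x : 'I_n) : (x == 0 :> nat) || (lg x != lg b) -> (x \in S t) = (ord0 \in S t).
    elim/(ptree_ind (n := n) (n_gt0 := ltn0Sn _) ltpar): x => [|x y Hx Ey A IH] H.
      by congr (_ \in _); apply: val_inj.
    rewrite eqn0Ngt Hx /= in H.
    have Hy : (y == 0 :> nat) || (lg y != lg b).
      by case: posnP => //= Hy; rewrite -(adj_legs A).
    rewrite -IH //.
    have xb : x != b by apply: contraNneq H => ->.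
    have yb : y != b.
      apply/eqP => E; move: Hy; rewrite E eqxx orbF; lia.
    by apply/idP/idP; apply: prop' => //; rewrite par_adj_sym.
  have cl : #|[set x : 'I_n | (0 < x) && (lg x == lg b)]| = a (lg b).
    rewrite (@card_legs (fun i => i == lg b)) /bsum (bigD1 (Ordinal Hi)) //= eqxx mul1n.
    by rewrite big1 ?addn0 // => j Hj; rewrite -val_eqE /= in Hj; rewrite (negPf Hj).
  have ai := a_le Hi.
  (* If the root is in [S t], the leg of [b] contains [b] and the complement of [S t], which has at
     least [B] nodes. Otherwise it contains [S t], which has more than [B] nodes. Either way it is
     too long. *)
  case E0: (ord0 \in S t).
    have : b |: ~: S t \subset [set x : 'I_n | (0 < x) && (lg x == lg b)].
      apply/subsetP => x; rewrite in_setU1 in_setC => /orP[/eqP->|Hx]; rewrite in_set; first by rewrite Hb0 eqxx.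
      have := out x; rewrite (negPf Hx) E0 lt0n; case: (_ == 0 :> nat) => //=.
        by move/(_ isT).
      by case: (_ == _) => //= /(_ isT).
    move/subset_leq_card; rewrite cl cardsU1 in_setC bS /= => H.
    have := cardsC (S t); rewrite card_ord S_eq //.
    have : t.+2 * B <= T * B by rewrite leq_mul2r Ht orbT.
    rewrite mulSn => H1 H2; have H3 : #|~: S t| < B by exact: leq_trans ai.
    have H4 : (t.+1 * B).+1 + #|~: S t| = (T * B).+1 by rewrite H2 En.
    by move: #|~: S t| H3 H4 => c; lia.
  have : S t \subset [set x : 'I_n | (0 < x) && (lg x == lg b)].
    apply/subsetP => x Hx; rewrite in_set.
    have := out x; rewrite Hx E0 lt0n; case: (_ == 0 :> nat) => //=.
      by move/(_ isT).
    by case: (_ == _) => //= /(_ isT).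
  move/subset_leq_card; rewrite cl S_eq //.
  by rewrite mulSn; lia.
(* The root is the only node of [S t] outside [U t.+1], so membership cannot change along an edge
   within a leg. *)
have full t (x : 'I_n) : t.+1 < T -> 0 < x -> (x \in U t.+1) = (inord (leg_start a nI x) \in U t.+1).
  move=> Ht; have [EU _] := root_b t Ht.
  elim/(ptree_ind (n := n) (n_gt0 := ltn0Sn _) ltpar): x => [//|x y Hx Ey A IH] _.
  have Hxn : 0 < x <= pre a nI by rewrite Hx -ltnS ltn_ord.
  have := par_leg Hxn; case: eqP => [E _|_ [Hp El]]; first by rewrite -E inord_val.
  rewrite -Ey in Hp El; rewrite /leg_start -El -/(leg_start a nI y) -IH; last by case/andP: Hp.
  have x0 : x != ord0 by rewrite -val_eqE /= -lt0n.
  have y0 : y != ord0 by rewrite -val_eqE /= -lt0n; case/andP: Hp.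
  rewrite EU !in_setD1 x0 y0 /=.
  apply/idP/idP => H; [apply: (prop _ x) => //|apply: (prop _ y); first by rewrite par_adj_sym].
    by rewrite EU in_setD1 x0.
  by rewrite EU in_setD1 y0.
(* The first node of leg [i]. If [a i = 0] it does not belong to the leg, whence the assumption
   [0 < a i] below; such legs contribute nothing to the sums. *)
pose v i : 'I_n := inord (pre a i).+1.
pose inl t i := v i \in U t.
have sum_in t : t <= T -> bsum nI (fun i => inl t i * a i) = t * B.
  move=> Ht; rewrite -(@card_legs (inl t)).
  have E : [set x : 'I_n | (0 < x) && inl t (lg x)] = U t :\ ord0.
    apply/setP => x; rewrite in_set in_setD1 -val_eqE /= -lt0n; case: posnP => //= Hx.
    rewrite /inl /v; case: t Ht => [|t] Ht; first by rewrite U0 !in_set0.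
    case: (ltnP t.+1 T) => Ht'; first by rewrite (full t x).
    by have -> : t.+1 = T by [lia]; rewrite UT !in_setT.
  rewrite E; case: (ltnP t T) => Ht'.
    suff H0 : ord0 \notin U t by rewrite -(U_eq t) // (cardsD1 ord0 (U t)) (negPf H0).
    case: t Ht Ht' {E} => [|t] _ Ht'; first by rewrite U0 inE.
    by have [-> _] := root_b t Ht'; rewrite !inE eqxx.
  have -> : t = T by lia.
  by apply: succn_inj; rewrite UT -En -[RHS]cardV [RHS](cardsD1 ord0) in_setT.
have inl_mono t i : t < T -> i < nI -> 0 < a i -> inl t i -> inl t.+1 i.
  move=> Ht Hi Hai; rewrite /inl => H.
  case: (ltnP t.+1 T) => Ht'; last first.
    by have -> : t.+1 = T by [lia]; rewrite UT inE.
  have [-> _] := root_b t Ht'; rewrite in_setD1 /S in_setU H andbT.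
  have Hv : (pre a i).+1 < n by have := pre_mono a Hi; rewrite preS; lia.
  by rewrite -val_eqE /= inordK.
have inl_mono' t t' i : t <= t' <= T -> i < nI -> 0 < a i -> inl t i -> inl t' i.
  case/andP=> /subnKC <-; elim: (t' - t) => [|k IH]; rewrite ?addn0 // addnS => Hk Hi Hai H.
  by apply: inl_mono => //; apply: IH => //; apply: ltnW.
(* Leg [i] goes into the bin of the step in which it becomes safe. The legs safe after [j] steps
   have total size [j * B], so bin [j] receives the difference [B]. *)
pose f i := find (fun t => inl t.+1 i) (iota 0 T).
have f_lt i : f i < T.
  rewrite -[X in _ < X](size_iota 0) -has_find; apply/hasP; exists T.-1.
    by rewrite mem_iota; lia.
  by rewrite ET /inl UT inE.
exists f; split=> // j Hj.
have := sum_in _ Hj; rewrite mulSn -(sum_in j (ltnW Hj)) => /esym.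
rewrite /bsum => E; apply/eqP; rewrite -(eqn_add2r (\sum_(i < nI) inl j i * a i)) E.
rewrite -big_split /=; apply/eqP; apply: eq_bigr => i _.
rewrite -mulnDl; case: (posnP (a i)) => [->|Hai]; first by rewrite !muln0.
congr muln; have Hi := ltn_ord i.
have Hin t : t < T -> inl t.+1 i = (f i <= t).
  move=> Ht; apply/idP/idP => H.
    rewrite leqNgt; apply/negP => Hf; have := before_find 0 Hf.
    by rewrite nth_iota // add0n H.
  have Hh : has (fun t => inl t.+1 i) (iota 0 T) by rewrite has_find size_iota f_lt.
  have := nth_find 0 Hh; rewrite -/(f i) nth_iota ?f_lt // add0n => H1.
  by apply: (inl_mono' (f i).+1) => //; lia.
rewrite Hin //; case: j Hj {E} => [|j] Hj; first by rewrite /inl U0 inE; lia.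
by rewrite Hin ?(ltnW Hj) //; lia.
Qed.
End Game.

Lemma path_spider a nI : spider (ptree (pre a nI).+1 (par_path a nI)).
Proof.
apply: ptree_spider => // [x|x y Hx Hy].
  exact: leg_parent_lt (@leg_parent_path a nI).
by rewrite /par_path /ite; case: eqP; lia.
Qed.

Lemma star_tree a nI : tree (ptree (pre a nI).+1 (par_star a nI)).
Proof. by apply: ptree_tree => // x; exact: leg_parent_lt (@leg_parent_star a nI). Qed.

Lemma star_diameter a nI : diameter (ptree (pre a nI).+1 (par_star a nI)) <= 4.
Proof.
apply: ptree_diameter => // [x|x Hx]; first exact: leg_parent_lt (@leg_parent_star a nI).
rewrite {1 3}/par_star /ite; case: eqP => // _ _.
by have [_ _ E] := leg_start_bounds Hx; rewrite /par_star /ite E eqxx.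
Qed.

(** * Finite sums and digits *)

Lemma bsum_pick n (i0 : nat) (F : nat -> nat) :
  i0 < n -> \sum_(i < n) (val i == i0) * F i = F i0.
Proof.
move=> H; rewrite (bigD1 (Ordinal H)) //= eqxx mul1n big1 ?addn0 // => i Hi.
by rewrite -val_eqE /= in Hi; rewrite (negPf Hi).
Qed.

Lemma sum1_single (I : finType) (t X : I -> nat) (i0 : I) :
  \sum_i t i = 1 -> t i0 = 1 -> \sum_i t i * X i = X i0.
Proof.
rewrite (bigD1 i0) //= => H E; rewrite E in H.
rewrite (bigD1 i0) //= E mul1n big1 ?addn0 // => i Hi.
have : \sum_(i | i != i0) t i == 0 by apply/eqP; lia.
by rewrite sum_nat_eq0 => /forall_inP /(_ i Hi) /eqP ->.
Qed.

Lemma leq_sum_ind (I : finType) (p : I -> bool) (X : I -> nat) : \sum_i p i * X i <= \sum_i X i.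
Proof. by apply: leq_sum => i _; case: (p i); rewrite ?mul1n ?mul0n. Qed.

Lemma sum_weights_eq (I : finType) (u v : I -> nat) :
  (forall i, u i <= v i) -> \sum_i u i = \sum_i v i -> forall i, u i = v i.
Proof.
move=> Hle E i; apply/eqP; rewrite eqn_leq Hle /=.
have := E; rewrite (bigD1 i) //= [in RHS](bigD1 i) //=.
have : \sum_(j | j != i) u j <= \sum_(j | j != i) v j by apply: leq_sum => j _; apply: Hle.
lia.
Qed.

(* The weighted second moment about [i0] vanishes. *)
Lemma moments_concentrated (n D i0 : nat) (om : nat -> nat) :
  \sum_(i < n) om i = D -> \sum_(i < n) om i * i = D * i0 ->
  \sum_(i < n) om i * (i * i) = D * (i0 * i0) -> forall i, i < n -> 0 < om i -> i = i0.
Proof.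
move=> H0 H1 H2 i Hi Hom.
have E : \sum_(k < n) om k * (2 * (k * i0)) = \sum_(k < n) om k * (k * k + i0 * i0).
  transitivity (2 * i0 * \sum_(k < n) om k * k).
    by rewrite big_distrr; apply: eq_bigr => k _ /=; lia.
  rewrite H1; transitivity (\sum_(k < n) (om k * (k * k) + om k * (i0 * i0))).
    by rewrite big_split /= -big_distrl /= H0 H2; lia.
  by apply: eq_bigr => k _; lia.
have Hle (k : 'I_n) : om k * (2 * (k * i0)) <= om k * (k * k + i0 * i0).
  by rewrite leq_mul2l; apply/orP; right; rewrite (nat_Cauchy k i0).
have := sum_weights_eq Hle E (Ordinal Hi) => /= /eqP.
by rewrite eqn_pmul2l // (nat_Cauchy i i0) => /eqP.
Qed.

Lemma digit_inj K a x b y : a < K -> b < K -> a + K * x = b + K * y -> a = b /\ x = y.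
Proof.
move=> Ha Hb E; have K0 : 0 < K by lia.
have E1 := congr1 (fun z => z %% K) E; have E2 := congr1 (fun z => z %/ K) E.
rewrite /= ![_ + K * _]addnC ![K * _]mulnC !modnMDl !modn_small // in E1.
by rewrite /= ![_ + K * _]addnC ![K * _]mulnC !divnMDl // !divn_small // !addn0 in E2.
Qed.

Definition e5 (K v u sv su f : nat) : nat := v + K * (u + K * (sv + K * (su + K * f))).

Lemma e5_inj K v u sv su f v' u' sv' su' f' :
  [&& v < K, u < K, sv < K & su < K] -> [&& v' < K, u' < K, sv' < K & su' < K] ->
  e5 K v u sv su f = e5 K v' u' sv' su' f' ->
  [/\ v = v', u = u', sv = sv', su = su' & K * f = K * f'].
Proof.
case/and4P=> h1 h2 h3 h4 /and4P[k1 k2 k3 k4].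
move=> /(digit_inj h1 k1)[-> /(digit_inj h2 k2)[-> /(digit_inj h3 k3)[->]]].
by move/(digit_inj h4 k4) => [-> ->].
Qed.

Lemma e5_add K v u sv su f v' u' sv' su' f' :
  e5 K v u sv su f + e5 K v' u' sv' su' f' = e5 K (v + v') (u + u') (sv + sv') (su + su') (f + f').
Proof. by rewrite /e5 !mulnDr; lia. Qed.

Lemma e5_mul p K v u sv su f :
  p * e5 K v u sv su f = e5 K (p * v) (p * u) (p * sv) (p * su) (p * f).
Proof. by rewrite /e5 !mulnDr; rewrite ![p * (K * _)]mulnCA; lia. Qed.

Lemma e5_sum (I : finType) K (v u sv su f : I -> nat) :
  \sum_i e5 K (v i) (u i) (sv i) (su i) (f i) =
  e5 K (\sum_i v i) (\sum_i u i) (\sum_i sv i) (\sum_i su i) (\sum_i f i).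
Proof.
by rewrite /e5; do 4![rewrite big_split /= -big_distrr /=].
Qed.

Lemma e5_le K v u sv su f v' u' sv' su' f' :
  v <= v' -> u <= u' -> sv <= sv' -> su <= su' -> f <= f' ->
  e5 K v u sv su f <= e5 K v' u' sv' su' f'.
Proof. by move=> *; rewrite /e5 !(leq_add, leq_mul). Qed.

(** * Concatenation of families *)

Definition fcat (n : nat) (f g : nat -> nat) (z : nat) : nat := ite (z < n) (f z) (g (z - n)).

Lemma bsum_fcat n1 n2 a b (p : nat -> bool) :
  bsum (n1 + n2) (fun z => p z * fcat n1 a b z) =
  bsum n1 (fun z => p z * a z) + bsum n2 (fun z => p (n1 + z) * b z).
Proof.
rewrite /bsum big_split_ord /=; congr addn; apply: eq_bigr => z _; rewrite /fcat /ite /=.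
  by rewrite ltn_ord.
by rewrite ltnNge leq_addr /= addKn.
Qed.

Lemma fcat_l n f g z : z < n -> fcat n f g z = f z.
Proof. by rewrite /fcat /ite => ->. Qed.

Lemma fcat_r n f g z : fcat n f g (n + z) = g z.
Proof. by rewrite /fcat /ite ltnNge leq_addr /= addKn. Qed.

Lemma fcat_lt n1 n2 f g C : (forall z, z < n1 -> f z < C) -> (forall z, z < n2 -> g z < C) ->
  forall z, z < n1 + n2 -> fcat n1 f g z < C.
Proof. by move=> H1 H2 z Hz; rewrite /fcat /ite; case: (ltnP z n1) => H; [exact: H1|apply: H2; lia]. Qed.

Lemma bsum_prod m n (F : nat -> nat) :
  bsum (m * n) F = \sum_(i < m) \sum_(e < n) F (i * n + e).
Proof.
rewrite /bsum; elim: m => [|m IH]; first by rewrite !big_ord0.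
by rewrite mulSn addnC big_split_ord /= IH big_ord_recr.
Qed.

(** Bin [j] takes a block of [c j] consecutive unit items. These blocks are legs, so [leg] is the
    assignment; the shift by one is due to the root being node 0. *)
Lemma distribute k (c : nat -> nat) :
  exists h : nat -> nat, (forall x, x < bsum k c -> h x < k) /\
    (forall j, j < k -> bsum (bsum k c) (fun x => h x == j) = c j).
Proof.
exists (fun x => leg c k x.+1); split=> [x Hx|j Hj].
  by have [] := @leg_bounds c k x.+1 Hx.
have := sum_legs c k (fun i => i == j); rewrite big_ord_recl /= add0n /bsum => E.
by rewrite -[RHS](@bsum_pick k j c) // -E; apply: eq_bigr.
Qed.

(** * From exact cover to exact packing *)

Definition exact_cover (m n : nat) (inc : nat -> nat -> bool) : Prop :=
  exists S : nat -> bool, forall e, e < n -> bsum m (fun i => S i && inc i e) = 1.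

(* Set [i] has a bin [A_i] and element [e] a bin [E_e], which has to receive exactly one
   item [L_{i,e}]. The bin [A_i] is filled by the single item [Q_i] if the set is chosen
   and by all items [L_{i,e}] otherwise. A size has five digits [v, u, sv, su, f] in base
   [big_base]: every bin contains one filler ([f = 1]), which determines whether it is
   [A_i] or [E_e]; the digit [u] encodes the weight of an item and the first two
   moments of its set index, and only matters in the bins [A_i]; the digit [v] encodes
   the element and only matters in the bins [E_e]. The digits [su] and [sv] control the
   use of the unit items that fill up [u] in the bins [E_e] and [v] in the bins [A_i]. *)
Section Cover.
Variables (m n : nat) (inc : nat -> nat -> bool).

Definition deg (i : nat) : nat := bsum n (fun e => inc i e).
(** In any bin the weights of the items add up to at most [2 * m * n], and a squared index is at
    most [m * m]. Hence the moments of order 2, 1 and 0 of the indices are separate digits of a sum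
    of values [gid] in this base. *)
Definition id_base : nat := (2 * m * n).+1 * (m * m).+1.
Definition gid (i : nat) : nat := i * i + id_base * (i + id_base).
Definition wG : nat := bsum m (fun i => deg i * gid i).
Definition wV : nat := bsum m (fun i => bsum n (fun e => inc i e * (n + e))).
Definition wN : nat := bsum n (fun e => n + e).
(** [cap_u] and [cap_v] exceed the total [u] and [v] of all items [L] and [Q], so that these
    overfill no bin in which the digit should not matter. *)
Definition cap_u : nat := 2 * wG + 1.
Definition cap_v : nat := wV + 2 * n.
(** Of the total [2 * wG] of the digit [u], the bins [A_i] take one half, so the bins [E_e] carry
    [wG] and lack [su1]. Likewise the bins [A_i] carry [wV - wN] in the digit [v]. Besides the units
    that fill these gaps there are [su0] and [sv0] units that only count in [su] and [sv]; with them
    every affected bin takes the same number of units. *)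
Definition su1 : nat := n * cap_u - wG.
Definition su0 : nat := wG.
Definition sv1 : nat := m * cap_v + wN - wV.
Definition sv0 : nat := wV - wN.
(** Larger than each of the first four digits summed over all items, so that loads add up without
    carries. *)
Definition big_base : nat :=
  1 + (m + n + 1) * (cap_u + cap_v) + (su1 + su0 + (sv1 + sv0)) + (m + n).

Definition fill_v (h : nat) : nat := ite (h < m) 0 (cap_v - (n + (h - m))).
Definition fill_u (h : nat) : nat := ite (h < m) (cap_u - deg h * gid h) 0.
Definition fill_sv (h : nat) : nat := ite (h < m) 0 cap_v.
Definition fill_su (h : nat) : nat := ite (h < m) cap_u 0.

Local Notation enc := (e5 big_base).

Definition size_F (h : nat) : nat := enc (fill_v h) (fill_u h) (fill_sv h) (fill_su h) 1.
Definition size_L (z : nat) : nat :=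
  enc (inc (z %/ n) (z %% n) * (n + z %% n)) (inc (z %/ n) (z %% n) * gid (z %/ n)) 0 0 0.
Definition size_Q (i : nat) : nat := enc 0 (deg i * gid i) 0 0 0.

Definition item_size : nat -> nat :=
  fcat (m + n) size_F (fcat (m * n) size_L (fcat m size_Q
    (fcat su1 (fun=> enc 0 1 0 1 0) (fcat su0 (fun=> enc 0 0 0 1 0)
      (fcat sv1 (fun=> enc 1 0 1 0 0) (fun=> enc 0 0 1 0 0)))))).

Definition nb_items : nat := (m + n) + (m * n + (m + (su1 + (su0 + (sv1 + sv0))))).

Definition bin_size : nat := enc cap_v cap_u cap_v cap_u 1.

Hypothesis m_gt0 : 0 < m.
Hypothesis n_gt0 : 0 < n.

Lemma bin_size_gt0 : 0 < bin_size.
Proof.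
rewrite /bin_size /e5 addn_gt0; apply/orP; left; rewrite /cap_v; lia.
Qed.

Lemma deg_gid_le i : i < m -> deg i * gid i <= wG.
Proof. by move=> Hi; rewrite /wG /bsum (bigD1 (Ordinal Hi)) //= leq_addr. Qed.

Lemma inc_v_le i e : i < m -> e < n -> inc i e * (n + e) <= wV.
Proof.
move=> Hi He; rewrite /wV /bsum (bigD1 (Ordinal Hi)) //= (bigD1 (Ordinal He)) //=; lia.
Qed.

Lemma inc_deg i e : e < n -> inc i e <= deg i.
Proof. by move=> He; rewrite /deg /bsum (bigD1 (Ordinal He)) //= leq_addr. Qed.

Lemma item_size_le z : z < nb_items -> item_size z <= bin_size.
Proof.
have Hu : 0 < cap_u by rewrite /cap_u; lia.
have Hv : 0 < cap_v by rewrite /cap_v; lia.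
suff H : forall z, z < nb_items -> item_size z < bin_size.+1 by move/H.
rewrite /nb_items /item_size; apply: fcat_lt => [{}z Hz|].
  rewrite ltnS e5_le // /fill_v /fill_u /fill_sv /fill_su /ite; case: ifP => _ //; lia.
apply: fcat_lt => [{}z Hz|].
  have Hz1 : z %/ n < m by rewrite ltn_divLR.
  have Hz2 : z %% n < n by rewrite ltn_mod.
  rewrite ltnS e5_le //.
    by apply: leq_trans (inc_v_le Hz1 Hz2) _; rewrite /cap_v; lia.
  apply: leq_trans (_ : deg (z %/ n) * gid (z %/ n) <= _); first by rewrite leq_mul2r inc_deg ?orbT.
  by apply: leq_trans (deg_gid_le Hz1) _; rewrite /cap_u; lia.
apply: fcat_lt => [{}z Hz|].
  by rewrite ltnS e5_le //; apply: leq_trans (deg_gid_le Hz) _; rewrite /cap_u; lia.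
apply: fcat_lt => [{}z Hz|]; first by rewrite ltnS e5_le.
apply: fcat_lt => [{}z Hz|]; first by rewrite ltnS e5_le.
by apply: fcat_lt => {}z Hz; rewrite ltnS e5_le.
Qed.

Lemma sum_fill (A E : nat -> nat) :
  \sum_(h < m + n) ite (h < m) (A h) (E (h - m)) = bsum m A + bsum n E.
Proof.
rewrite big_split_ord /=; congr addn; apply: eq_bigr => h _; rewrite /ite ?ltn_ord //.
by rewrite ltnNge leq_addr /= addKn.
Qed.

(** [p] is an arbitrary selection because the formula serves both for the contents of one bin and
    for all items together. *)
Lemma load_digits (p : nat -> bool) :
  let p1 i e := p (m + n + (i * n + e)) in
  let p2 i := p (m + n + (m * n + i)) in
  let k1 := bsum su1 (fun x => p (m + n + (m * n + (m + x)))) in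
  let k0 := bsum su0 (fun x => p (m + n + (m * n + (m + (su1 + x))))) in
  let l1 := bsum sv1 (fun x => p (m + n + (m * n + (m + (su1 + (su0 + x)))))) in
  let l0 := bsum sv0 (fun x => p (m + n + (m * n + (m + (su1 + (su0 + (sv1 + x))))))) in
  bsum nb_items (fun z => p z * item_size z) =
  enc (\sum_(h < m + n) p h * fill_v h +
         (\sum_(i < m) \sum_(e < n) p1 i e * (inc i e * (n + e)) + l1))
      (\sum_(h < m + n) p h * fill_u h +
         (\sum_(i < m) (\sum_(e < n) p1 i e * inc i e + p2 i * deg i) * gid i + k1))
      (\sum_(h < m + n) p h * fill_sv h + (l1 + l0))
      (\sum_(h < m + n) p h * fill_su h + (k1 + k0))
      (\sum_(h < m + n) p h).
Proof.
move=> p1 p2 k1 k0 l1 l0.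
rewrite /nb_items /item_size bsum_fcat bsum_fcat bsum_fcat bsum_fcat bsum_fcat bsum_fcat.
rewrite bsum_prod.
have Ed i (e : 'I_n) : (i * n + e) %/ n = i by rewrite divnMDl // divn_small ?addn0.
have Em i (e : 'I_n) : (i * n + e) %% n = e by rewrite modnMDl modn_small.
rewrite (eq_bigr (fun i : 'I_m => e5 big_base (\sum_(e < n) p1 i e * (inc i e * (n + e)))
  (\sum_(e < n) p1 i e * (inc i e * gid i)) 0 0 0)); last first.
  move=> i _; rewrite (eq_bigr (fun e : 'I_n => e5 big_base (p1 i e * (inc i e * (n + e)))
    (p1 i e * (inc i e * gid i)) 0 0 0)).
    by rewrite e5_sum !sum_nat_const !muln0.
  by move=> e _; rewrite /size_L Ed Em e5_mul !muln0.
rewrite e5_sum /= !sum_nat_const !muln0.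
have -> : bsum (m + n) (fun z => p z * size_F z) =
  enc (\sum_(h < m + n) p h * fill_v h) (\sum_(h < m + n) p h * fill_u h)
    (\sum_(h < m + n) p h * fill_sv h) (\sum_(h < m + n) p h * fill_su h) (\sum_(h < m + n) p h).
  by rewrite -e5_sum; apply: eq_bigr => h _; rewrite /size_F e5_mul muln1.
have -> : bsum m (fun z => p (m + n + (m * n + z)) * size_Q z) =
  enc 0 (\sum_(i < m) p2 i * (deg i * gid i)) 0 0 0.
  rewrite /bsum (eq_bigr (fun i : 'I_m => enc 0 (p2 i * (deg i * gid i)) 0 0 0)).
    by rewrite e5_sum !sum_nat_const !muln0.
  by move=> i _; rewrite /size_Q e5_mul !muln0.
have Ec s (q : nat -> bool) c : bsum s (fun z => q z * c) = bsum s (fun z => q z) * c.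
  by rewrite /bsum big_distrl.
rewrite !Ec -/k1 -/k0 -/l1 -/l0 !e5_mul !e5_add !muln0 !muln1 !addn0 !add0n.
congr (e5 _ _ (_ + _)); rewrite addnA; congr addn.
rewrite -big_split; apply: eq_bigr => i _ /=; rewrite mulnDl; congr addn; last by rewrite mulnA.
by rewrite big_distrl; apply: eq_bigr => e _ /=; rewrite mulnA.
Qed.

Let cap_v_ge e : e < n -> n + e <= cap_v.
Proof. by rewrite /cap_v; lia. Qed.

Let cap_u_ge i : i < m -> deg i * gid i <= cap_u.
Proof. by move=> Hi; have := deg_gid_le Hi; rewrite /cap_u; lia. Qed.

Lemma bsum_subn k (C : nat) (X : nat -> nat) : (forall i, i < k -> X i <= C) ->
  bsum k (fun i => C - X i) + bsum k X = k * C.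
Proof.
move=> H; rewrite /bsum -big_split /= (eq_bigr (fun=> C)).
  by rewrite sum_nat_const card_ord.
by move=> i _; rewrite subnK // H.
Qed.

Lemma total_fill :
  [/\ \sum_(h < m + n) fill_v h + wN = n * cap_v, \sum_(h < m + n) fill_u h + wG = m * cap_u,
      \sum_(h < m + n) fill_sv h = n * cap_v & \sum_(h < m + n) fill_su h = m * cap_u].
Proof.
split.
- rewrite (@sum_fill (fun=> 0) (fun e => cap_v - (n + e))) /bsum sum_nat_const muln0 add0n.
  exact: (@bsum_subn n cap_v (fun e => n + e)).
- rewrite (@sum_fill (fun h => cap_u - deg h * gid h) (fun=> 0)) /bsum [\sum_(i < n) 0]sum_nat_const muln0 addn0.
  exact: (@bsum_subn m cap_u (fun h => deg h * gid h)).
- by rewrite (@sum_fill (fun=> 0) (fun=> cap_v)) /bsum !sum_nat_const !card_ord muln0.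
- by rewrite (@sum_fill (fun=> cap_u) (fun=> 0)) /bsum !sum_nat_const !card_ord muln0 addn0.
Qed.

Lemma su_total : su1 + su0 = n * cap_u.
Proof.
rewrite /su1 /su0 subnK //; apply: leq_trans (leq_pmull _ n_gt0); rewrite /cap_u; lia.
Qed.

Lemma sv1_total : sv1 + wV = m * cap_v + wN.
Proof.
rewrite /sv1 subnK //; have := leq_pmull cap_v m_gt0; rewrite /cap_v; lia.
Qed.

(** Only an inequality: if [wV < wN], then [sv0] is truncated to 0 and the items are too large in
    total. In that case there is no exact cover, and no exact packing either. *)
Lemma total_size : (m + n) * bin_size <= pre item_size nb_items.
Proof.
have -> : pre item_size nb_items = bsum nb_items (fun z => true * item_size z).
  by apply: eq_bigr => z _; rewrite mul1n.
have [E1 E2 E3 E4] := total_fill; have E5 := su_total; have E6 := sv1_total.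
have b1 k : bsum k (fun=> true) = k by rewrite /bsum sum_nat_const card_ord muln1.
have e1 k (X : 'I_k -> nat) : \sum_(h < k) true * X h = \sum_(h < k) X h.
  by apply: eq_bigr => h _; rewrite mul1n.
rewrite (load_digits (fun=> true)) !b1 !e1 /bin_size e5_mul sum_nat_const card_ord.
have EV : \sum_(i < m) \sum_(e < n) true * (inc i e * (n + e)) = wV.
  by apply: eq_bigr => i _; rewrite e1.
have EG : \sum_(i < m) (\sum_(e < n) true * inc i e + true * deg i) * gid i = wG + wG.
  rewrite /wG /bsum -big_split; apply: eq_bigr => i _ /=.
  by rewrite e1 mul1n mulnDl.
rewrite EV EG; apply: e5_le => //.
- by rewrite mulnDl; lia.
- by move: E5; rewrite mulnDl /su0; lia.
- by move: E6; rewrite mulnDl E3 /sv0; lia.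
- by rewrite mulnDl E4 E5; lia.
Qed.

Lemma gid_mul d i : d * gid i = d * (i * i) + id_base * (d * i + id_base * d).
Proof. by rewrite /gid; move: id_base => b; nia. Qed.

Lemma bsum_bool_le k (q : nat -> bool) : bsum k (fun x => q x) <= k.
Proof.
rewrite -[X in _ <= X]muln1 -[X in X * 1](card_ord k) -sum_nat_const.
by apply: leq_sum => i _; case: (q i).
Qed.

Lemma big_base_gt :
  [/\ n * cap_v + wV + sv1 < big_base, m * cap_u + 2 * wG + su1 < big_base,
      n * cap_v + (sv1 + sv0) < big_base & m * cap_u + (su1 + su0) < big_base].
Proof.
have E : (m + n + 1) * (cap_u + cap_v) =
  m * cap_u + n * cap_u + cap_u + (m * cap_v + n * cap_v + cap_v) by lia.
have Hu : 2 * wG <= cap_u by rewrite /cap_u; lia.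
have Hv : wV <= cap_v by rewrite /cap_v; lia.
by rewrite /big_base E; split; lia.
Qed.

Lemma packing_digits f j : packing nb_items (m + n) bin_size item_size f -> j < m + n ->
  let f1 i e := f (m + n + (i * n + e)) in
  let f2 i := f (m + n + (m * n + i)) in
  [/\ \sum_(h < m + n) (f h == j) = 1,
      forall i0, i0 < m -> f i0 = j ->
        \sum_(i < m) (\sum_(e < n) (f1 i e == j) * inc i e + (f2 i == j) * deg i) * gid i =
        deg i0 * gid i0 &
      forall e0, e0 < n -> f (m + e0) = j ->
        \sum_(i < m) \sum_(e < n) (f1 i e == j) * (inc i e * (n + e)) = n + e0].
Proof.
case=> f_lt Hf Hj f1 f2; have := Hf j Hj.
rewrite (load_digits (fun z => f z == j)) /bin_size -/f1 -/f2.
have [L1 L2 L3 L4] := big_base_gt; have [T1 T2 T3 T4] := total_fill.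
set k1 := bsum su1 _; set k0 := bsum su0 _; set l1 := bsum sv1 _; set l0 := bsum sv0 _.
have Hk1 : k1 <= su1 by exact: bsum_bool_le.
have Hk0 : k0 <= su0 by exact: bsum_bool_le.
have Hl1 : l1 <= sv1 by exact: bsum_bool_le.
have Hl0 : l0 <= sv0 by exact: bsum_bool_le.
have Hn1 : cap_v <= n * cap_v by exact: leq_pmull.
have Hm1 : cap_u <= m * cap_u by exact: leq_pmull.
set lv := \sum_(i < m) \sum_(e < n) (f1 i e == j) * (inc i e * (n + e)).
set lu := \sum_(i < m) _ * gid i.
have Hlv : lv <= wV by apply: leq_sum => i _; apply: leq_sum_ind.
have Hlu : lu <= 2 * wG.
  rewrite mul2n -addnn /wG /bsum -big_split; apply: leq_sum => i _ /=.
  rewrite -mulnDl leq_mul2r; apply/orP; right; apply: leq_add.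
    exact: (@leq_sum_ind _ (fun e : 'I_n => f1 i e == j)).
  by case: (_ == _); rewrite ?mul1n ?mul0n.
have sle (X : nat -> nat) : \sum_(h < m + n) (f h == j) * X h <= \sum_(h < m + n) X h.
  exact: (@leq_sum_ind _ (fun h : 'I_(m + n) => f h == j)).
have S1 := sle fill_v; have S2 := sle fill_u; have S3 := sle fill_sv; have S4 := sle fill_su.
(* Without carries, load and capacity agree digit by digit; the last digit says that there is
   exactly one filler. *)
case/e5_inj; [by apply/and4P; split; lia|by apply/and4P; split; lia|].
move=> E1 E2 E3 E4 /eqP; rewrite eqn_pmul2l ?muln1; last by lia.
move/eqP=> E5.
have single (X : nat -> nat) h0 : h0 < m + n -> f h0 = j ->
    \sum_(h < m + n) (f h == j) * X h = X h0.
  move=> Hh Eh; apply: (@sum1_single _ (fun h : 'I_(m + n) => f h == j : nat) (fun h => X h) (Ordinal Hh)) => //=.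
  by rewrite Eh eqxx.
split=> // [i0 Hi0 Ei|e0 He0 Ee].
  (* The filler of a bin [A_i] exhausts the digit [su], so no unit item counting in [u] fits in, and
     [u] is exact for the items [L] and [Q]. The bins [E_e] below are symmetric, with [sv] and
     [v]. *)
  have Hh : i0 < m + n by lia.
  rewrite !(single _ _ Hh Ei) /fill_u /fill_su /ite Hi0 in E2 E4.
  by have := cap_u_ge Hi0; lia.
have Hh : m + e0 < m + n by lia.
rewrite !(single _ _ Hh Ee) /fill_v /fill_sv /ite ltnNge leq_addr /= addKn in E1 E3.
by have := cap_v_ge He0; lia.
Qed.

Lemma packing_cover f : packing nb_items (m + n) bin_size item_size f -> exact_cover m n inc.
Proof.
move=> Hf; have [f_lt _] := Hf.
pose f1 i e := f (m + n + (i * n + e)); pose f2 i := f (m + n + (m * n + i)).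
have D j Hj := @packing_digits f j Hf Hj; rewrite /= -/f1 -/f2 in D.
have Fl h : h < m + n -> f h < m + n by move=> Hh; apply: f_lt; rewrite /nb_items; lia.
have F1 i e : i < m -> e < n -> f1 i e < m + n.
  move=> Hi He; apply: f_lt; rewrite /nb_items.
  have : i.+1 * n <= m * n by rewrite leq_mul2r Hi orbT.
  by rewrite mulSn; lia.
have inj h h' : h < m + n -> h' < m + n -> f h = f h' -> h = h'.
  move=> Hh Hh' E; have [H1 _ _] := D _ (Fl _ Hh).
  have := @sum1_single _ (fun x : 'I_(m + n) => f x == f h : nat) (fun x => val x) (Ordinal Hh) H1.
  have := @sum1_single _ (fun x : 'I_(m + n) => f x == f h : nat) (fun x => val x) (Ordinal Hh') H1.
  by rewrite /= -E eqxx => /(_ erefl) -> /(_ erefl).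
pose om j i := \sum_(e < n) (f1 i e == j) * inc i e + (f2 i == j) * deg i.
have om_le j i : om j i <= 2 * n.
  have Hd : deg i <= n by exact: bsum_bool_le.
  rewrite mul2n -addnn; apply: leq_add.
    by apply: leq_trans Hd; apply: (@leq_sum_ind _ (fun e : 'I_n => f1 i e == j)).
  by apply: leq_trans Hd; case: (_ == _); rewrite ?mul1n ?mul0n.
(* In the bin of filler [i0] the three moments are those of [deg i0] copies of the index [i0], so no
   incident item of another set can be there. *)
have mom i0 : i0 < m ->
    \sum_(i < m) om (f i0) i = deg i0 /\ (forall i, i < m -> 0 < om (f i0) i -> i = i0).
  move=> Hi0; have Hh : i0 < m + n by lia.
  have [_ /(_ i0 Hi0 erefl) H _] := D _ (Fl _ Hh).
  set j := f i0 in H *.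
  have Hd : deg i0 <= n by exact: bsum_bool_le.
  have bnd (X : nat -> nat) c : (forall i, i < m -> X i <= c) -> \sum_(i < m) om j i * X i <= m * (2 * n * c).
    move=> HX; apply: (@leq_trans (\sum_(i < m) 2 * n * c)).
      by apply: leq_sum => i _; apply: leq_mul; [exact: om_le|exact: HX].
    by rewrite sum_nat_const card_ord.
  have E : \sum_(i < m) om j i * (i * i) + id_base * (\sum_(i < m) om j i * i + id_base * \sum_(i < m) om j i)
    = deg i0 * (i0 * i0) + id_base * (deg i0 * i0 + id_base * deg i0).
    transitivity (\sum_(i < m) om j i * gid i); last first.
      by rewrite H gid_mul.
    rewrite mulnDr !big_distrr /= -!big_split /=; apply: eq_bigr => i _.
    by rewrite gid_mul mulnDr.
  have mm i : i < m -> i * i <= m * m /\ i <= m * m by move=> Hi; split; nia.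
  have B2 : m * (2 * n * (m * m)) < id_base by rewrite /id_base; nia.
  have B0 : n * (m * m) < id_base by rewrite /id_base; nia.
  have {}E := digit_inj (leq_ltn_trans (bnd _ (m * m) (fun i Hi => (mm i Hi).1)) B2)
    (leq_ltn_trans (leq_mul Hd (mm i0 Hi0).1) B0) E.
  case: E => M2 E.
  have [M1 M0] := digit_inj (leq_ltn_trans (bnd id (m * m) (fun i Hi => (mm i Hi).2)) B2)
    (leq_ltn_trans (leq_mul Hd (mm i0 Hi0).2) B0) E.
  have {}M0 : \sum_(i < m) om j i = deg i0.
    by apply/eqP; rewrite -(@eqn_pmul2l id_base) ?M0 // /id_base.
  split=> //; exact: (moments_concentrated M0 M1 M2).
have inA i i0 e : i < m -> i0 < m -> e < n -> inc i e -> f1 i e = f i0 -> i = i0.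
  move=> Hi Hi0 He Hinc E; have [_ H] := mom i0 Hi0; apply: H => //.
  by rewrite /om (bigD1 (Ordinal He)) //= E eqxx Hinc.
have omE i : i < m -> om (f i) i = deg i.
  move=> Hi; have [H1 H2] := mom i Hi; rewrite -H1 (bigD1 (Ordinal Hi)) //= big1 ?addn0 // => k Hk.
  apply/eqP; rewrite -leqn0 leqNgt; apply/negP => /(H2 _ (ltn_ord k)) E.
  by case/eqP: Hk; apply: val_inj.
have inE i e e0 : i < m -> e < n -> e0 < n -> inc i e -> f1 i e = f (m + e0) -> e = e0.
  move=> Hi He He0 Hinc E; have Hh : m + e0 < m + n by lia.
  have [_ _ /(_ e0 He0 erefl)] := D _ (Fl _ Hh); set j := f (m + e0) in E *.
  pose t (q : 'I_m * 'I_n) : nat := (f1 q.1 q.2 == j) * inc q.1 q.2.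
  rewrite pair_big /= (eq_bigr (fun q => t q * (n + q.2))); last by move=> q _; rewrite /t mulnA.
  move=> S.
  have t0 : t (Ordinal Hi, Ordinal He) = 1 by rewrite /t /= E eqxx Hinc.
  (* Each counted item has weight at least [n], and the total [n + e0] is below [2 * n]: there is
     just one item, and its weight reveals its element. *)
  have St : \sum_q t q = 1.
    have : n * \sum_q t q <= n + e0.
      by rewrite -S big_distrr; apply: leq_sum => q _ /=; rewrite mulnC leq_mul2l leq_addr orbT.
    have : 1 <= \sum_q t q by rewrite (bigD1 (Ordinal Hi, Ordinal He)) //= t0.
    by case: (\sum_q t q) => [|[|k]] // _; rewrite !mulnS; lia.
  by have := sum1_single (fun q : 'I_m * 'I_n => n + q.2) St t0; rewrite S /=; lia.
exists (fun i => f2 i == f i) => e He.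
have Hh : m + e < m + n by lia.
have [_ _ /(_ e He erefl) Hv] := D _ (Fl _ Hh).
have key i : i < m -> (f2 i == f i) && inc i e = (f1 i e == f (m + e)) && inc i e.
  move=> Hi; case Hinc: (inc i e); rewrite ?andbF // !andbT.
  have Hih : i < m + n by lia.
  have [h Hhn Eh] : exists2 h, h < m + n & f1 i e = f h.
    have [H1 _ _] := D _ (F1 _ _ Hi He).
    case: (pickP (fun h : 'I_(m + n) => f h == f1 i e)) => [h /eqP Eh|H0].
      by exists h.
    by move: H1; rewrite big1 // => h _; rewrite H0.
  have om_i := omE i Hi; rewrite /om in om_i.
  (* If [Q_i] is in [A_i], its weight [deg i] leaves no room for an incident [L_{i,e}], which then
     lies in some [E] bin, necessarily [E_e]. If not, [A_i] needs all of the incident [L_{i,e}], so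
     none is in [E_e]. *)
  case: eqP => [Q|Q].
    rewrite Q eqxx mul1n in om_i.
    have om0 : \sum_(e0 < n) (f1 i e0 == f i) * inc i e0 = 0 by lia.
    have Ni : f1 i e <> f i.
      move=> E; move/eqP: om0; rewrite sum_nat_eq0 => /forall_inP /(_ (Ordinal He) isT).
      by rewrite /= E eqxx Hinc.
    case: (ltnP h m) => Hhm.
      by case: Ni; rewrite Eh -(inA i h e).
    have Ehm : h = m + (h - m) by lia.
    rewrite Eh Ehm -(inE i e (h - m)) ?eqxx // -?Ehm //; lia.
  move/eqP: Q => Q; rewrite (negPf Q) mul0n addn0 in om_i.
  have Hle (x : 'I_n) : (f1 i x == f i) * inc i x <= inc i x by case: (_ == _); rewrite ?mul1n.
  have := sum_weights_eq Hle om_i (Ordinal He); rewrite /= Hinc muln1 => E.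
  have {}E : f1 i e = f i by apply/eqP; case: (_ == _) E.
  by rewrite E; apply/esym/eqP => /inj; lia.
rewrite /bsum (eq_bigr (fun i : 'I_m => (f1 i e == f (m + e)) && inc i e : nat)); last by move=> i _; rewrite key.
have : (n + e) * \sum_(i < m) ((f1 i e == f (m + e)) && inc i e) = (n + e) * 1.
  rewrite muln1 -[RHS]Hv big_distrr; apply: eq_bigr => i _ /=.
  rewrite (bigD1 (Ordinal He)) //= big1 ?addn0.
    by case: (_ == _); case: (inc i e); rewrite /= ?muln0 ?muln1 ?mul1n.
  move=> e' Hne; case Hinc: (inc i e'); rewrite ?mul0n ?muln0 //.
  case: eqP => // E; case/eqP: Hne; apply: val_inj => /=.
  exact: (inE i e' e).
by move/eqP; rewrite eqn_pmul2l ?addn_gt0 ?n_gt0 // => /eqP.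
Qed.

Lemma sum_eq_ord k x : x < k -> \sum_(j < k) (x == j) = 1.
Proof.
move=> Hx; rewrite -[RHS](@bsum_pick k x (fun=> 1)) //.
by apply: eq_bigr => j _; rewrite muln1 eq_sym.
Qed.

Lemma cover_packing : exact_cover m n inc ->
  exists f, packing nb_items (m + n) bin_size item_size f.
Proof.
case=> S HS.
pose f1 i e := if S i then m + e else i.
(* The item [Q_i] of a set that is not chosen goes to the first bin [E], where the digit [u] does
   not matter. *)
pose f2 i := if S i then i else m.
pose om j i := \sum_(e < n) (f1 i e == j) * inc i e + (f2 i == j) * deg i.
pose lu j := \sum_(i < m) om j i * gid i.
pose lv j := \sum_(i < m) \sum_(e < n) (f1 i e == j) * (inc i e * (n + e)).
have F1 i e : i < m -> e < n -> f1 i e < m + n by rewrite /f1; case: (S i); lia.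
have F2 i : i < m -> f2 i < m + n by rewrite /f2; case: (S i); lia.
have luA i0 : i0 < m -> lu i0 = deg i0 * gid i0.
  move=> Hi0; rewrite -[RHS](@bsum_pick m i0 (fun i => deg i * gid i)) //.
  apply: eq_bigr => i _; rewrite mulnA; congr muln; rewrite /om /f1 /f2; case: (S i).
    rewrite big1 ?add0n // => e _; case: eqP => // E; lia.
  have -> : (m == i0) = false by apply/eqP; lia.
  by rewrite mul0n addn0 -big_distrr.
have lvE e0 : e0 < n -> lv (m + e0) = n + e0.
  move=> He0; rewrite -[RHS]mul1n -(HS e0 He0) /bsum big_distrl; apply: eq_bigr => i _ /=.
  rewrite /f1; case: (S i) => /=.
    rewrite -[RHS](@bsum_pick n e0 (fun e => inc i e * (n + e))) //.
    by apply: eq_bigr => e _; rewrite eqn_add2l.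
  by rewrite mul0n big1 // => e _; case: eqP => // E; have := ltn_ord i; lia.
have sum_lu : \sum_(j < m + n) lu j = wG + wG.
  rewrite /lu exchange_big /= /wG /bsum -big_split; apply: eq_bigr => i _ /=.
  rewrite -big_distrl /= -mulnDl; congr muln; rewrite /om big_split /=; congr addn.
    rewrite exchange_big /=; apply: eq_bigr => e _.
    by rewrite -big_distrl /= sum_eq_ord ?mul1n // F1.
  by rewrite -big_distrl /= sum_eq_ord ?mul1n // F2.
have sum_lv : \sum_(j < m + n) lv j = wV.
  rewrite /lv exchange_big /=; apply: eq_bigr => i _ /=.
  rewrite exchange_big /=; apply: eq_bigr => e _.
  by rewrite -big_distrl /= sum_eq_ord ?mul1n // F1.
have lu_le j : j < m + n -> lu j <= cap_u.
  move=> Hj; have := sum_lu; rewrite (bigD1 (Ordinal Hj)) //= /cap_u; lia.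
have lv_le j : j < m + n -> lv j <= cap_v.
  move=> Hj; have := sum_lv; rewrite (bigD1 (Ordinal Hj)) //= /cap_v; lia.
have sum_luE : bsum n (fun e => lu (m + e)) = su0.
  have := sum_lu; rewrite big_split_ord /=.
  have -> : \sum_(i < m) lu i = wG by apply: eq_bigr => i _; apply: luA.
  by move/addnI.
have sum_lvA : bsum m lv = sv0 /\ wN <= wV.
  have := sum_lv; rewrite big_split_ord /=.
  have -> : \sum_(e < n) lv (m + e) = wN by apply: eq_bigr => e _; apply: lvE.
  by rewrite /sv0 => <-; split; rewrite ?addnK ?leq_addl.
case: sum_lvA => sum_lvA HNV.
have sum_luE' : bsum n (fun e => cap_u - lu (m + e)) = su1.
  have H e : e < n -> lu (m + e) <= cap_u by move=> He; apply: lu_le; rewrite ltn_add2l.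
  by have := bsum_subn H; rewrite sum_luE -su_total => /addIn.
have sum_lvA' : bsum m (fun i => cap_v - lv i) = sv1.
  have H i : i < m -> lv i <= cap_v by move=> Hi; apply: lv_le; lia.
  have E : sv1 + sv0 = m * cap_v by have := sv1_total; rewrite /sv0; lia.
  by have := bsum_subn H; rewrite sum_lvA -E => /addIn.
have [h1 [h1_lt H1]] := distribute n (fun e => cap_u - lu (m + e)).
have [h0 [h0_lt H0]] := distribute n (fun e => lu (m + e)).
have [g1 [g1_lt G1]] := distribute m (fun i => cap_v - lv i).
have [g0 [g0_lt G0]] := distribute m lv.
rewrite sum_luE' in h1_lt H1; rewrite sum_luE in h0_lt H0.
rewrite sum_lvA' in g1_lt G1; rewrite sum_lvA in g0_lt G0.
pose f := fcat (m + n) id (fcat (m * n) (fun z => f1 (z %/ n) (z %% n)) (fcat m f2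
  (fcat su1 (fun x => m + h1 x) (fcat su0 (fun x => m + h0 x) (fcat sv1 g1 g0))))).
exists f; split.
  apply: fcat_lt => //; apply: fcat_lt => [z Hz|].
    by apply: F1; rewrite ?ltn_divLR // ltn_mod.
  apply: fcat_lt => //; apply: fcat_lt => [z /h1_lt|]; first by rewrite ltn_add2l.
  apply: fcat_lt => [z /h0_lt|]; first by rewrite ltn_add2l.
  by apply: fcat_lt => z; [move/g1_lt|move/g0_lt]; lia.
move=> j Hj; rewrite (load_digits (fun z => f z == j)) /bin_size.
have pick (X : nat -> nat) : \sum_(h < m + n) (f h == j) * X h = X j.
  rewrite -[RHS](@bsum_pick (m + n) j X) //; apply: eq_bigr => h _.
  by rewrite /f fcat_l.
have -> : \sum_(h < m + n) (f h == j) = 1.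
  by rewrite -[RHS](pick (fun=> 1)); apply: eq_bigr => h _; rewrite muln1.
have p1E (i : 'I_m) (e : 'I_n) : f (m + n + (i * n + e)) = f1 i e.
  have Hz : i * n + e < m * n.
    have : i.+1 * n <= m * n by rewrite leq_mul2r ltn_ord orbT.
    by rewrite mulSn; have := ltn_ord e; lia.
  rewrite /f fcat_r fcat_l // divnMDl // modnMDl divn_small ?ltn_ord // modn_small ?ltn_ord //.
  by rewrite addn0.
have p2E (i : 'I_m) : f (m + n + (m * n + i)) = f2 i by rewrite /f !fcat_r fcat_l.
rewrite !pick.
have -> : \sum_(i < m) \sum_(e < n) (f (m + n + (i * n + e)) == j) * (inc i e * (n + e)) = lv j.
  by apply: eq_bigr => i _; apply: eq_bigr => e _; rewrite p1E.
have -> : \sum_(i < m) (\sum_(e < n) (f (m + n + (i * n + e)) == j) * inc i e +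
    (f (m + n + (m * n + i)) == j) * deg i) * gid i = lu j.
  apply: eq_bigr => i _; congr (_ * _); rewrite /om p2E; congr addn.
  by apply: eq_bigr => e _; rewrite p1E.
have -> : bsum su1 (fun x => f (m + n + (m * n + (m + x))) == j) = bsum su1 (fun x => m + h1 x == j).
  by apply: eq_bigr => x _; rewrite /f !fcat_r fcat_l.
have -> : bsum su0 (fun x => f (m + n + (m * n + (m + (su1 + x)))) == j) = bsum su0 (fun x => m + h0 x == j).
  by apply: eq_bigr => x _; rewrite /f !fcat_r fcat_l.
have -> : bsum sv1 (fun x => f (m + n + (m * n + (m + (su1 + (su0 + x))))) == j) = bsum sv1 (fun x => g1 x == j).
  by apply: eq_bigr => x _; rewrite /f !fcat_r fcat_l.
have -> : bsum sv0 (fun x => f (m + n + (m * n + (m + (su1 + (su0 + (sv1 + x)))))) == j) = bsum sv0 (fun x => g0 x == j).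
  by apply: eq_bigr => x _; rewrite /f !fcat_r.
case: (ltnP j m) => Hjm.
  rewrite G1 // G0 // /fill_v /fill_u /fill_sv /fill_su /ite Hjm.
  have Z c (h : nat -> nat) : bsum c (fun x => m + h x == j) = 0.
    by rewrite /bsum big1 // => x _; case: eqP => //; lia.
  rewrite !Z luA //; have := cap_u_ge Hjm; have := lv_le _ Hj.
  by move=> *; congr e5; lia.
have Ej : j = m + (j - m) by lia.
have Hje : j - m < n by lia.
have A c (h : nat -> nat) : bsum c (fun x => m + h x == j) = bsum c (fun x => h x == j - m).
  by apply: eq_bigr => x _; rewrite {1}Ej eqn_add2l.
have Z c (g : nat -> nat) : (forall x, x < c -> g x < m) -> bsum c (fun x => g x == j) = 0.
  by move=> H; rewrite /bsum big1 // => x _; have := H x (ltn_ord x); case: eqP => //; lia.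
rewrite !A H1 // H0 // -Ej (Z _ _ g1_lt) (Z _ _ g0_lt).
rewrite /fill_v /fill_u /fill_sv /fill_su /ite ltnNge Hjm /=.
have -> : lv j = n + (j - m) by rewrite {1}Ej lvE.
have := cap_v_ge Hje; have := lu_le _ Hj.
by move=> *; congr e5; lia.
Qed.
End Cover.

(** * From labellings to exact cover *)

(* A label of a node determines a value [out] of the node and, for each [k < r], the value
   [pi k] that it expects at the node [src c k]. *)
Section Labelling.
Variables (N ell d r : nat) (src : nat -> nat -> nat) (pi : nat -> nat -> nat).
Variables (out : nat -> nat) (ok : nat -> nat -> bool).

Definition labelling (lab : nat -> nat) : Prop :=
  forall c, c < N -> [/\ lab c < ell, ok c (lab c) &
    forall k, k < r -> pi k (lab c) = out (lab (src c k))].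

(** The user covers the triple with the value it expects, and the used node those with all values
    but its own. Every triple is covered once if and only if the two values agree. *)
Definition edge_inc (c rho y b : nat) : bool :=
  (c == y %/ r) && (pi (y %% r) rho == b) || (src (y %/ r) (y %% r) == c) && (out rho != b).

(* The set [c * ell + rho] stands for giving the label [rho] to node [c]; the elements
   are the nodes and the triples (c, k, b), of index [N + (c * r + k) * d + b]. *)
Definition label_inc (i e : nat) : bool :=
  ok (i %/ ell) (i %% ell) &&
  ((e < N) && (i %/ ell == e) ||
   (N <= e) && edge_inc (i %/ ell) (i %% ell) ((e - N) %/ d) ((e - N) %% d)).

Hypothesis ell_gt0 : 0 < ell.
Hypothesis d_gt0 : 0 < d.
Hypothesis out_lt : forall rho, rho < ell -> out rho < d.
Hypothesis src_lt : forall c k, c < N -> k < r -> src c k < N.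

Lemma sum_label_inc S e :
  bsum (N * ell) (fun i => S i && label_inc i e) =
  \sum_(c < N) \sum_(rho < ell) (S (c * ell + rho) && ok c rho) *
    ((e < N) && (val c == e) || (N <= e) && edge_inc c rho ((e - N) %/ d) ((e - N) %% d)).
Proof.
rewrite bsum_prod; apply: eq_bigr => c _; apply: eq_bigr => rho _.
rewrite /label_inc divnMDl // divn_small // modnMDl modn_small // addn0.
by case: (S _) => //=; case: (ok _ _) => //=; rewrite mul1n.
Qed.

Lemma edge_index_lt c k b : c < N -> k < r -> b < d -> N + ((c * r + k) * d + b) < N + N * r * d.
Proof.
move=> Hc Hk Hb; rewrite ltn_add2l.
have H : (c * r + k).+1 <= N * r.
  have : c.+1 * r <= N * r by rewrite leq_mul2r Hc orbT.
  by rewrite mulSn; lia.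
have : (c * r + k).+1 * d <= N * r * d by rewrite leq_mul2r H orbT.
by rewrite mulSn; lia.
Qed.

Lemma cover_labelling : exact_cover (N * ell) (N + N * r * d) label_inc ->
  exists lab, labelling lab.
Proof.
case=> S HS.
pose t c rho := S (c * ell + rho) && ok c rho.
have Ht c : c < N -> \sum_(rho < ell) t c rho = 1.
  move=> Hc; have He : c < N + N * r * d by lia.
  have := HS c He; rewrite sum_label_inc Hc leqNgt Hc /= => E; rewrite -E.
  rewrite -[LHS](@bsum_pick N c (fun c => \sum_(rho < ell) t c rho)) //.
  apply: eq_bigr => c' _; rewrite big_distrr; apply: eq_bigr => rho _ /=.
  by rewrite orbF mulnC.
pose lab c := find (t c) (iota 0 ell).
have Hl c : c < N -> lab c < ell /\ t c (lab c).
  move=> Hc; have Hh : has (t c) (iota 0 ell).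
    apply/negPn/negP => /hasPn H0; have := Ht c Hc; rewrite big1 // => x _.
    by rewrite (negPf (H0 _ _)) // mem_iota /= ltn_ord.
  have H1 : lab c < ell by move: Hh; rewrite has_find size_iota.
  by have := nth_find 0 Hh; rewrite nth_iota.
have pickl c (X : nat -> bool) : c < N -> \sum_(rho < ell) t c rho * X rho = X (lab c).
  move=> Hc; have [H1 H2] := Hl c Hc.
  have := @sum1_single _ (fun rho : 'I_ell => t c rho : nat) (fun rho => X rho : nat) (Ordinal H1).
  by rewrite Ht //= H2; apply.
exists lab => c Hc; have [H1 /andP[_ H2]] := Hl c Hc; split=> // k Hk.
have Hs := src_lt Hc Hk; set s := src c k in Hs *.
have Hb : out (lab s) < d by apply: out_lt; case: (Hl s Hs).
have r_gt0 : 0 < r by lia.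
(* For [b = out (lab s)] the used node does not cover the triple, so the label of [c] must do so by
   its expectation. *)
have := HS _ (edge_index_lt Hc Hk Hb); rewrite sum_label_inc ltnNge leq_addr /= addKn.
rewrite divnMDl // divn_small // addn0 modnMDl (modn_small Hb).
rewrite (eq_bigr (fun c' : 'I_N => (val c' == c) * (pi k (lab c) == out (lab s)))).
  by rewrite (@bsum_pick N c (fun=> pi k (lab c) == out (lab s))) //; case: eqP.
move=> c' _; rewrite (@pickl c' (fun rho => edge_inc c' rho (c * r + k) (out (lab s)))) //.
rewrite /edge_inc divnMDl // divn_small // addn0 modnMDl modn_small // -/s.
case: (eqVneq (val c') c) => [->|Hne] /=; last by case: eqP => //= <-; rewrite eqxx.
by rewrite mul1n; case: (eqVneq s c) => [<-|_] /=; rewrite ?eqxx ?andbF orbF.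
Qed.

Lemma labelling_cover lab : labelling lab -> exact_cover (N * ell) (N + N * r * d) label_inc.
Proof.
move=> H; exists (fun i => i %% ell == lab (i %/ ell)) => e He.
rewrite sum_label_inc.
pose X c := (e < N) && (c == e) || (N <= e) && edge_inc c (lab c) ((e - N) %/ d) ((e - N) %% d).
rewrite (eq_bigr (fun c : 'I_N => X c : nat)); last first.
  move=> c _; have [H1 H2 _] := H c (ltn_ord c).
  rewrite -[RHS](@bsum_pick ell (lab c) (fun rho => (e < N) && (val c == e) ||
    (N <= e) && edge_inc c rho ((e - N) %/ d) ((e - N) %% d))) //.
  apply: eq_bigr => rho _; rewrite modnMDl modn_small // divnMDl // divn_small // addn0.
  by case: eqP => //= ->; rewrite H2.
suff [c0 Hc0 E] : exists2 c0, c0 < N & forall c, c < N -> X c = (c == c0).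
  rewrite (eq_bigr (fun c : 'I_N => (val c == c0) * 1)); first by rewrite (@bsum_pick N c0 (fun=> 1)).
  by move=> c _; rewrite E // muln1.
rewrite /X; case: (ltnP e N) => HeN /=.
  by exists e => // c _; rewrite orbF.
have Hz : e - N < N * r * d by lia.
set y := (e - N) %/ d; set b := (e - N) %% d.
have Hy : y < N * r by rewrite ltn_divLR.
have r_gt0 : 0 < r by case: (r) Hy => //; rewrite muln0.
have Hc : y %/ r < N by rewrite ltn_divLR.
have Hk : y %% r < r by rewrite ltn_mod.
have Hs := src_lt Hc Hk; have [_ _ /(_ _ Hk) Epi] := H _ Hc.
rewrite /edge_inc; set c := y %/ r in Hc Hs Epi *; set k := y %% r in Hk Hs Epi *.
set s := src c k in Hs Epi *.
case: (eqVneq (out (lab s)) b) => [Eb|Nb].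
  exists c => // c' _; case: (eqVneq c' c) => [->|Hne] /=; first by rewrite Epi Eb eqxx.
  by case: eqP => //= <-; rewrite Eb eqxx.
exists s => // c' _; rewrite [s == c']eq_sym; case: (eqVneq c' s) => [->|Hne] /=.
  by rewrite Nb orbT.
by rewrite orbF; case: eqP => //= ->; rewrite Epi; apply/negbTE.
Qed.
End Labelling.

(** * Local constraints *)

Section Constraints.
Variables (D : finType) (d0 : D) (r' nk : nat).
Local Notation r := r'.+1.
Variable rule : nat -> D -> {ffun 'I_r -> D} -> bool.

Definition consistent (N : nat) (kind : nat -> nat) (src : nat -> nat -> nat)
    (vl : nat -> D) : Prop :=
  forall c, c < N -> rule (kind c) (vl c) [ffun k : 'I_r => vl (src c k)].

(** A node guesses, besides its own value, the values that it reads. The rule thereby becomes a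
    property of a single label, and only equalities between nodes remain. *)
Definition label : finType := (D * {ffun 'I_r -> D})%type.

Definition nb_labels : nat := #|label|.
Definition lam (rho : nat) : label := nth (d0, [ffun => d0]) (enum label) rho.

(* The functions of a label are constant tables, hence expressible. *)
Definition out_table : seq nat := mkseq (fun rho => index (lam rho).1 (enum D)) nb_labels.
Definition pi_table : seq nat :=
  mkseq (fun z => index ((lam (z %% nb_labels)).2 (inord (z %/ nb_labels))) (enum D)) (r * nb_labels).
Definition rule_table : seq nat :=
  mkseq (fun z => let l := lam (z %% nb_labels) in rule (z %/ nb_labels) l.1 l.2 : nat)
    (nk * nb_labels).

Definition out_fun (rho : nat) : nat := nth 0 out_table rho.
Definition pi_fun (k rho : nat) : nat := nth 0 pi_table (k * nb_labels + rho).
Definition rule_fun (kd rho : nat) : bool := 0 < nth 0 rule_table (kd * nb_labels + rho).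

Lemma nb_labels_gt0 : 0 < nb_labels.
Proof. by apply/card_gt0P; exists (d0, [ffun => d0]). Qed.

Lemma index_lt a b c e : a < b -> c < e -> a * e + c < b * e.
Proof.
move=> H1 H2; have : a.+1 * e <= b * e by rewrite leq_mul2r H1 orbT.
by rewrite mulSn; lia.
Qed.

Lemma out_funE rho : rho < nb_labels -> out_fun rho = index (lam rho).1 (enum D).
Proof. by move=> H; rewrite /out_fun nth_mkseq. Qed.

Lemma pi_funE k rho : k < r -> rho < nb_labels ->
  pi_fun k rho = index ((lam rho).2 (inord k)) (enum D).
Proof.
move=> Hk H; rewrite /pi_fun nth_mkseq ?index_lt //.
by rewrite divnMDl ?nb_labels_gt0 // divn_small // addn0 modnMDl modn_small.
Qed.

Lemma rule_funE kd rho : kd < nk -> rho < nb_labels ->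
  rule_fun kd rho = rule kd (lam rho).1 (lam rho).2.
Proof.
move=> Hk H; rewrite /rule_fun nth_mkseq ?index_lt //.
rewrite divnMDl ?nb_labels_gt0 // divn_small // addn0 modnMDl modn_small //=.
by case: (rule _ _ _).
Qed.

Lemma index_enum_lt (T : finType) (x : T) : index x (enum T) < #|T|.
Proof. by rewrite cardE index_mem mem_enum. Qed.

Lemma index_enum_inj (T : finType) (x y : T) : index x (enum T) = index y (enum T) -> x = y.
Proof. by move=> E; rewrite -(nth_index x (mem_enum T x)) E nth_index // mem_enum. Qed.

Variables (N : nat) (kind : nat -> nat) (src : nat -> nat -> nat).
Hypothesis kind_lt : forall c, c < N -> kind c < nk.
Hypothesis src_lt : forall c k, c < N -> k < r -> src c k < N.

Definition cover_sets : nat := N * nb_labels.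
Definition cover_elements : nat := N + N * r * #|D|.
Definition cover_inc : nat -> nat -> bool :=
  label_inc N nb_labels #|D| r src pi_fun out_fun (fun c => rule_fun (kind c)).

Lemma consistent_cover :
  (exists vl, consistent N kind src vl) <-> exact_cover cover_sets cover_elements cover_inc.
Proof.
have D_gt0 : 0 < #|D| by apply/card_gt0P; exists d0.
have out_lt rho : rho < nb_labels -> out_fun rho < #|D|.
  by move=> H; rewrite out_funE // index_enum_lt.
split=> [[vl Hv]|].
  pose lb c : label := (vl c, [ffun k : 'I_r => vl (src c k)]).
  pose lab c := index (lb c) (enum label).
  have lab_lt c : lab c < nb_labels by exact: index_enum_lt.
  have lamE c : lam (lab c) = lb c by rewrite /lam nth_index // mem_enum.
  apply: (@labelling_cover _ _ _ _ _ _ _ _ nb_labels_gt0 D_gt0 src_lt lab) => c Hc; split=> //.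
    by rewrite rule_funE ?kind_lt // lamE; apply: Hv.
  move=> k Hk; rewrite pi_funE // out_funE // !lamE /= ffunE; congr (index (vl (src c _)) _).
  by rewrite inordK.
case/(cover_labelling nb_labels_gt0 D_gt0 out_lt src_lt) => lab Hl.
exists (fun c => (lam (lab c)).1) => c Hc.
have [H1 H2 H3] := Hl c Hc; move: H2; rewrite rule_funE ?kind_lt //.
congr (is_true (rule _ _ _)); apply/ffunP => k; rewrite ffunE; apply: index_enum_inj.
have [H4 _ _] := Hl _ (src_lt Hc (ltn_ord k)).
by have := H3 k (ltn_ord k); rewrite pi_funE // out_funE // inord_val.
Qed.
End Constraints.

(** * The computation tableau of a verifier *)

Section Tableau.
Variable M : TM.
Local Notation kt := (extra_tapes M).+1.
Local Notation cell := (option (bool + work_symbol M)).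

Definition value : finType := (state M + option (bool + work_symbol M))%type.
Local Notation r := (kt + 4).+1.

Definition st_of (a : value) : state M := if a is inl q then q else start M.
Definition sy_of (a : value) : cell := if a is inr s then s else None.

(* The content of a cell after one step, given the contents of the cell and of its two
   neighbours before; [pos] is 1, 2 or 3 if the right neighbour, the cell or the left
   neighbour is the scanned one. *)
Definition next_cell (pos : nat) (q : state M) (rd : {ffun 'I_kt -> cell}) (i : 'I_kt)
    (o0 o1 o2 : cell) : cell :=
  if halting q then o1 else
  let a := (trans q rd).2 i in
  match a.2 with
  | MoveL => if pos == 3 then a.1 else o0
  | Stay => if pos == 2 then a.1 else o1
  | MoveR => if pos == 1 then a.1 else o2
  end.

Definition next_state (q : state M) (rd : {ffun 'I_kt -> cell}) : state M :=
  if halting q then q else (trans q rd).1.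

(* [b] lists, at the previous time, the state, the scanned symbols and the three cells
   around the current one, and finally the cell to the left at the same time. *)
Definition rule (kd : nat) (a : value) (b : {ffun 'I_r -> value}) : bool :=
  let q := st_of (b (inord 0)) in
  let rd := [ffun i : 'I_kt => sy_of (b (inord i.+1))] in
  let o j := sy_of (b (inord (kt + 1 + j))) in
  match kd with
  | 0 => true
  | 1 => a == inl (start M)
  | 2 => a == inr None
  | 3 => a == inr (Some (inl false))
  | 4 => a == inr (Some (inl true))
  | 5 => [|| a == inr None, a == inr (Some (inl false)) | a == inr (Some (inl true))] &&
         ((sy_of (b (inord (kt + 4))) == None) ==> (a == inr None))
  | 6 => a == inl (next_state q rd)
  | 7 => sy_of (b (inord 1)) == Some (inl true)
  | _ => a == inr (next_cell ((kd - 8) %% 4) q rd (inord ((kd - 8) %/ 4)) (o 0) (o 1) (o 2))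
  end.

(* Cells are numbered relative to the head, which is at position [P]. *)
Definition tcell (P : nat) (t : tape (bool + work_symbol M)) (y : nat) : cell :=
  if y < P then nth None t.1 (P - y.+1) else nth None t.2 (y - P).

Definition pos_of (P y : nat) : nat :=
  ite (y.+1 == P) 1 (ite (y == P) 2 (ite (y == P.+1) 3 0)).

Lemma pos_ofE P y :
  [/\ (pos_of P y == 1) = (y.+1 == P), (pos_of P y == 2) = (y == P) &
      (pos_of P y == 3) = (y == P.+1)].
Proof.
rewrite /pos_of /ite; case: (eqVneq y.+1 P) => [H|H1]; first by split=> //; apply/esym/negbTE; lia.
case: (eqVneq y P) => [->|H2]; first by split=> //; apply/esym/negbTE; lia.
by case: (eqVneq y P.+1).
Qed.

(** Relative to the head, a move shifts the tape the other way: under [MoveL] a cell takes over from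
    its left neighbour, and the symbol just written arrives at [P.+1]. *)
Lemma tcell_step P (cfg : config M) i y : 0 < y -> 0 < P ->
  tcell P ((step cfg).2 i) y =
  next_cell (pos_of P y) cfg.1 [ffun i => read (cfg.2 i)] i
    (tcell P (cfg.2 i) y.-1) (tcell P (cfg.2 i) y) (tcell P (cfg.2 i) y.+1).
Proof.
move=> Hy HP; rewrite /step /next_cell; case: (halting _) => //.
case E: (trans _ _) => [q act] /=; rewrite ffunE; move: (act i) (cfg.2 i) => [s mv] t /=.
have [-> -> ->] := pos_ofE P y; rewrite /tcell nth_right_act nth_left_act.
case: mv => /=.
- case: (ltnP y P) => H1.
    have -> : y.-1 < P by lia.
    have -> : (P - y.+1).+1 = P - y.-1.+1 by lia.
    by case: eqP => ? //; try lia.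
  case Ez: (y - P) => [|[|z]].
  + have -> : y.-1 < P by lia.
    have -> : P - y.-1.+1 = 0 by lia.
    by case: eqP => ? //; try lia.
  + by case: eqP => ? //; try lia.
  + have -> : (y.-1 < P) = false by lia.
    have -> : y.-1 - P = z.+1 by lia.
    by case: eqP => ? //; try lia.
- case: (ltnP y P) => H1; first by case: eqP => ? //; try lia.
  by case Ez: (y - P) => [|z]; case: eqP => ? //; try lia.
- case: (ltnP y P) => H1.
    case Ez: (P - y.+1) => [|z].
      by case: eqP => ? //; try lia.
    have -> : y.+1 < P by lia.
    have -> : P - y.+2 = z by lia.
    by case: eqP => ? //; try lia.
  have -> : (y.+1 < P) = false by lia.
  have -> : (y - P).+1 = y.+1 - P by lia.
  by case: eqP => ? //; try lia.
Qed.

Section Layout.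
Variables (x : word) (Q P : nat).
Local Notation n := (size x).

(** [P] cells on either side of the head: the symbol scanned at time [P] depends on no others. *)
Definition tab_Y : nat := 2 * P + 1.
Definition tab_X : nat := 1 + kt * tab_Y.
Definition tab_N : nat := P.+1 * tab_X + 1.

(** The layout of [pair_word x u]: [true] at even positions, the bits of [x] at odd ones, the
    delimiter [false] at position [2 * n], and then [Q] free cells for [u]. *)
Definition init_kind (y : nat) : nat :=
  ite (y < P) 2 (ite (y - P < 2 * n) (ite (odd (y - P)) (3 + nth false x ((y - P) %/ 2)) 4)
    (ite (y - P == 2 * n) 3 (ite (y - P < 2 * n + 1 + Q) 5 2))).

(** The two border cells lack a neighbour and are left unconstrained after time 0. Wrong values
    spread from them by one cell per step, which is too slow to disturb the head. *)
Definition cell_kind (i y : nat) : nat :=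
  ite ((y == 0) || (y == 2 * P)) 0 (8 + (i * 4 + pos_of P y)).

Definition kind (c : nat) : nat :=
  ite (c %/ tab_X == 0)
    (ite (c %% tab_X == 0) 1 (ite ((c %% tab_X - 1) %/ tab_Y == 0)
       (init_kind ((c %% tab_X - 1) %% tab_Y)) 2))
    (ite (P < c %/ tab_X) 7
      (ite (c %% tab_X == 0) 6
         (cell_kind ((c %% tab_X - 1) %/ tab_Y) ((c %% tab_X - 1) %% tab_Y)))).

(** In row 0 the truncated subtractions still yield nodes of the tableau, as [src_lt] demands; the
    rules there look at most at the left neighbour. *)
Definition src (c k : nat) : nat :=
  ite (k <= kt) ((c %/ tab_X - 1) * tab_X + ite (k == 0) 0 (1 + ((k - 1) * tab_Y + P)))
    (ite (k < kt + 4) (c + (k - (kt + 1)) - (tab_X + 1)) (c - 1)).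

Local Notation cell_node t i y := (t * tab_X + (1 + (i * tab_Y + y))).

Lemma cell_node_lt i y : i < kt -> y < tab_Y -> 1 + (i * tab_Y + y) < tab_X.
Proof. by move=> Hi Hy; rewrite /tab_X ltn_add2l index_lt. Qed.

Lemma tab_X_gt0 : 0 < tab_X. Proof. by []. Qed.
Lemma tab_Y_gt0 : 0 < tab_Y. Proof. by rewrite /tab_Y addn1. Qed.

Lemma node_div t z : z < tab_X -> (t * tab_X + z) %/ tab_X = t.
Proof. by move=> H; rewrite divnMDl // divn_small // addn0. Qed.

Lemma node_mod t z : z < tab_X -> (t * tab_X + z) %% tab_X = z.
Proof. by move=> H; rewrite modnMDl modn_small. Qed.

Lemma cell_div i y : y < tab_Y -> (1 + (i * tab_Y + y) - 1) %/ tab_Y = i.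
Proof. by move=> H; rewrite addKn divnMDl ?tab_Y_gt0 // divn_small // addn0. Qed.

Lemma cell_mod i y : y < tab_Y -> (1 + (i * tab_Y + y) - 1) %% tab_Y = y.
Proof. by move=> H; rewrite addKn modnMDl modn_small. Qed.

Lemma nodeP c : c < tab_N -> [\/ c = P.+1 * tab_X,
  exists2 t, t <= P & c = t * tab_X + 0 |
  exists t i y, [/\ t <= P, i < kt, y < tab_Y & c = cell_node t i y]].
Proof.
move=> Hc; have Hm : c %% tab_X < tab_X by rewrite ltn_mod.
have Ec := divn_eq c tab_X.
case: (ltnP P (c %/ tab_X)) => Ht.
  constructor 1.
  have : P.+1 * tab_X <= c %/ tab_X * tab_X by rewrite leq_mul2r Ht orbT.
  by move: Hc; rewrite /tab_N; lia.
case: (posnP (c %% tab_X)) => Hz.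
  by constructor 2; exists (c %/ tab_X); rewrite // -Hz.
constructor 3; exists (c %/ tab_X), ((c %% tab_X - 1) %/ tab_Y), ((c %% tab_X - 1) %% tab_Y).
split=> //; first by rewrite ltn_divLR ?tab_Y_gt0 //; move: Hm; rewrite {2}/tab_X; lia.
  by rewrite ltn_mod tab_Y_gt0.
by rewrite -(divn_eq (c %% tab_X - 1)) subnKC.
Qed.

Lemma kind_start : kind (0 * tab_X + 0) = 1.
Proof. by rewrite /kind node_div // node_mod. Qed.

Lemma kind_init i y : i < kt -> y < tab_Y ->
  kind (cell_node 0 i y) = ite (i == 0) (init_kind y) 2.
Proof.
by move=> Hi Hy; rewrite /kind node_div ?node_mod ?cell_div ?cell_mod // cell_node_lt.
Qed.

Lemma kind_state t : t < P -> kind (t.+1 * tab_X + 0) = 6.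
Proof. by move=> Ht; rewrite /kind node_div // node_mod // /ite /= ltnNge Ht. Qed.

Lemma kind_cell t i y : t < P -> i < kt -> y < tab_Y -> kind (cell_node t.+1 i y) = cell_kind i y.
Proof.
move=> Ht Hi Hy; rewrite /kind node_div ?node_mod ?cell_div ?cell_mod ?cell_node_lt //.
by rewrite /ite /= ltnNge Ht.
Qed.

Lemma kind_accept : kind (P.+1 * tab_X) = 7.
Proof. by rewrite -[P.+1 * _]addn0 /kind node_div // /ite /= ltnSn. Qed.

Lemma src_state t z : z < tab_X -> src (t.+1 * tab_X + z) 0 = t * tab_X + 0.
Proof. by move=> Hz; rewrite /src node_div // subn1. Qed.

Lemma src_head t z i : z < tab_X -> i < kt -> src (t.+1 * tab_X + z) i.+1 = cell_node t i P.
Proof. by move=> Hz Hi; rewrite /src node_div // /ite Hi /= !subn1. Qed.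

Lemma src_near t i y j : 0 < y -> j < 3 ->
  src (cell_node t.+1 i y) (kt + 1 + j) = cell_node t i (y + j - 1).
Proof.
move=> Hy Hj; rewrite /src /ite.
have -> : (kt + 1 + j <= kt) = false by lia.
have -> : kt + 1 + j < kt + 4 by lia.
by rewrite addKn mulSn; lia.
Qed.

Lemma src_left c : src c (kt + 4) = c - 1.
Proof.
rewrite /src /ite ltnn; have -> : (kt + 4 <= kt) = false by lia.
by [].
Qed.

Lemma kind_lt c : c < tab_N -> kind c < 8 + 4 * kt.
Proof.
have Hp y : pos_of P y < 4 by rewrite /pos_of /ite; repeat (case: eqP => // _).
case/nodeP=> [->|[[|t] Ht ->]|[[|t] [i [y [Ht Hi Hy ->]]]]].
- by rewrite kind_accept.
- by rewrite kind_start.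
- by rewrite kind_state.
- rewrite kind_init // /init_kind /ite; repeat (case: ifP => // _).
  by case: (nth _ _ _).
- by rewrite kind_cell // /cell_kind /ite; case: ifP => // _; have := Hp y; lia.
Qed.

Lemma src_lt c k : c < tab_N -> k < r -> src c k < tab_N.
Proof.
move=> Hc Hk; rewrite /src /ite; case: ifP => Hk1; last by have := tab_X_gt0; case: ifP => Hk2; lia.
have H1 : c %/ tab_X - 1 <= P.
  have : c %/ tab_X <= P.+1; last by lia.
  by rewrite -ltnS ltn_divLR // mulSn; move: Hc; rewrite /tab_N; have := tab_X_gt0; lia.
have H2 : (if k == 0 then 0 else 1 + ((k - 1) * tab_Y + P)) < tab_X.
  case: eqP => // H; apply: cell_node_lt; last by rewrite /tab_Y; lia.
  by lia.
have := @index_lt _ P.+1 _ _ (H1 : _ < P.+1) H2.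
by rewrite /tab_N; lia.
Qed.

End Layout.
End Tableau.

(** * Consistent tableaux and accepting runs *)

Lemma horner_nat_mono (p : {poly nat}) a b : a <= b -> p.[a]%R <= p.[b]%R.
Proof.
move=> H; elim/poly_ind: p => [|p c IH]; first by rewrite !horner0.
rewrite !hornerMXaddC; change (p.[a]%R * a + c <= p.[b]%R * b + c).
by rewrite leq_add2r leq_mul.
Qed.

Lemma size_pair_word x y : size (pair_word x y) = 2 * size x + 1 + size y.
Proof. by elim: x => //= b x ->; lia. Qed.

Lemma nth_pair_word (S : Type) x y z :
  nth None [seq Some (inl b : bool + S) | b <- pair_word x y] z =
  if z < 2 * size x then Some (inl (if odd z then nth false x (z %/ 2) else true))
  else if z == 2 * size x then Some (inl false)
  else nth None [seq Some (inl b) | b <- y] (z - (2 * size x + 1)).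
Proof.
elim: x z => [|b x IH] z /=.
  by rewrite muln0; case: z => [|z] //=; rewrite subn1.
case: z => [|[|z]] //=; first by rewrite mulnS.
rewrite IH negbK; have -> : z.+2 %/ 2 = (z %/ 2).+1 by rewrite -addn2 divnDr // addn1.
have -> : (z.+2 < 2 * (size x).+1) = (z < 2 * size x) by lia.
have -> : (z.+2 == 2 * (size x).+1) = (z == 2 * size x) by lia.
by have -> : z.+2 - (2 * (size x).+1 + 1) = z - (2 * size x + 1) by lia.
Qed.

Section TableauRun.
Variable M : TM.
Local Notation kt := (extra_tapes M).+1.
Variables (x : word) (Q P : nat).
Hypothesis HP : 2 * size x + 1 + Q < P.
Local Notation n := (size x).
Local Notation X := (tab_X M P).
Local Notation Y := (tab_Y P).
Local Notation cell_node t i y := (t * X + (1 + (i * Y + y))).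

Definition conf (u : word) (t : nat) : config M := iter t (@step M) (init M (pair_word x u)).

Definition actual (u : word) (c : nat) : value M :=
  if c %% X == 0 then inl (conf u (c %/ X)).1
  else inr (tcell P ((conf u (c %/ X)).2 (inord ((c %% X - 1) %/ Y))) ((c %% X - 1) %% Y)).

Definition tab_consistent (vl : nat -> value M) : Prop :=
  consistent (r' := kt + 4) (@rule M) (tab_N M P) (kind M x Q P) (src M P) vl.

Lemma actual_state u t : actual u (t * X + 0) = inl (conf u t).1.
Proof. by rewrite /actual node_div // node_mod. Qed.

Lemma actual_cell u t i y : i < kt -> y < Y ->
  actual u (cell_node t i y) = inr (tcell P ((conf u t).2 (inord i)) y).
Proof.
move=> Hi Hy.
by rewrite /actual node_div ?node_mod ?cell_div ?cell_mod // cell_node_lt.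
Qed.

Let P_gt0 : 0 < P. Proof. by lia. Qed.
Let P_lt : P < Y. Proof. by rewrite /tab_Y; lia. Qed.

Lemma tcell_init u i y :
  tcell P ((conf u 0).2 i) y =
  if (i == ord0) && (P <= y) then nth None [seq Some (inl b) | b <- pair_word x u] (y - P) else None.
Proof.
rewrite /tcell ffunE /=; case: ltnP => H; first by rewrite andbF nth_nil.
by rewrite andbT; case: (i == ord0); rewrite ?nth_nil.
Qed.

Lemma rule_args u t z (vl : nat -> value M) : z < X ->
  vl (t * X + 0) = inl (conf u t).1 ->
  (forall i, i < kt -> vl (cell_node t i P) = inr (tcell P ((conf u t).2 (inord i)) P)) ->
  let b := [ffun k : 'I_(kt + 4).+1 => vl (src M P (t.+1 * X + z) k)] in
  st_of (b (inord 0)) = (conf u t).1 /\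
  [ffun i : 'I_kt => sy_of (b (inord i.+1))] = [ffun i => read ((conf u t).2 i)].
Proof.
move=> Hz H0 H1 b; split; first by rewrite ffunE inordK // src_state // H0.
apply/ffunP => i; rewrite !ffunE inordK; last by have := ltn_ord i; lia.
by rewrite src_head // H1 //= inord_val /tcell ltnn subnn -readE.
Qed.

Lemma run_consistent u : size u <= Q -> tcell P ((conf u P).2 ord0) P = Some (inl true) ->
  tab_consistent (actual u).
Proof.
move=> Hu Hacc c /nodeP [->|[[|t] Ht ->]|[[|t] [i [y [Ht Hi Hy ->]]]]].
- rewrite kind_accept /rule ffunE inordK; last by lia.
  rewrite -[P.+1 * X]addn0 src_head // actual_cell // /sy_of.
  by have -> : inord 0 = ord0 :> 'I_kt by [apply: val_inj; rewrite /= inordK]; rewrite Hacc.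
- by rewrite kind_start /rule actual_state.
- have [H1 H2] := @rule_args u t 0 (actual u) isT (actual_state u t) (fun i Hi => actual_cell u t Hi P_lt).
  rewrite kind_state // /rule H1 H2 actual_state; apply/eqP; congr inl.
  by rewrite /conf iterS /step /next_state; case: (halting _) => //; case: (trans _ _).
- rewrite kind_init // actual_cell // tcell_init.
  have -> : (inord i == ord0 :> 'I_kt) = (i == 0) by rewrite -val_eqE /= inordK.
  rewrite {1}/ite; case: (i =P 0) => [Ei|_] //=.
  rewrite /init_kind /ite ltnNge; case: (leqP P y) => HyP //=.
  rewrite nth_pair_word; case: (ltnP (y - P) (2 * n)) => H1.
    by case: (odd _) => //; case: (nth false x _).
  case: (eqVneq (y - P) (2 * n)) => [//|H2].
  case: ltnP => H3; last by rewrite nth_default ?size_map //; lia.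
  rewrite /rule ffunE inordK // src_left.
  have -> : cell_node 0 i y - 1 = cell_node 0 i y.-1 by lia.
  rewrite actual_cell //=; last by lia.
  rewrite tcell_init Ei.
  have -> : (inord 0 == ord0 :> 'I_kt) by rewrite -val_eqE /= inordK.
  have -> /= : P <= y.-1 by lia.
  rewrite nth_pair_word.
  have -> : (y.-1 - P < 2 * n) = false by lia.
  set k := y - P - (2 * n + 1).
  apply/andP; split.
    case: (ltnP k (size u)) => Hk; last by rewrite nth_default ?size_map.
    by rewrite (nth_map false) //; case: (nth false u k).
  apply/implyP => /eqP; case: eqP => // H4 H5; apply/eqP; congr inr.
  case: (ltnP k (size u)) => Hk; last by rewrite nth_default ?size_map.
  by move: H5; rewrite (nth_map false) //; rewrite /k in Hk *; lia.
- have Hz : 1 + (i * Y + y) < X by exact: cell_node_lt.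
  rewrite kind_cell // /cell_kind /ite; case: ifP => // /norP[y0 y2P].
  have Hy0 : 0 < y by lia.
  have Hy2 : y.+1 < Y by move: Hy; rewrite /tab_Y; lia.
  have [H1 H2] := @rule_args u t _ (actual u) Hz (actual_state u t) (fun i Hi => actual_cell u t Hi P_lt).
  have Hp : pos_of P y < 4 by rewrite /pos_of /ite; repeat (case: eqP => // _).
  rewrite /rule -[8]/(0.+4.+4) /= H1 H2.
  have -> : 8 + (i * 4 + pos_of P y) - 8 = i * 4 + pos_of P y by lia.
  rewrite modnMDl modn_small // divnMDl // divn_small // addn0.
  rewrite actual_cell //; apply/eqP; congr inr.
  rewrite {1}/conf iterS tcell_step //.
  rewrite !ffunE !inordK; try lia.
  rewrite !src_near // !actual_cell //=; try lia.
  by congr (next_cell _ _ _ _ (tcell _ _ _) (tcell _ _ _) (tcell _ _ _)); lia.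
Qed.

Lemma consistent_run vl : tab_consistent vl ->
  exists2 u, size u <= Q & tcell P ((conf u P).2 ord0) P = Some (inl true).
Proof.
move=> H.
have cell_lt t i y : t <= P -> i < kt -> y < Y -> cell_node t i y < tab_N M P.
  move=> Ht Hi Hy; have := @index_lt t P.+1 _ X Ht (cell_node_lt Hi Hy).
  by rewrite /tab_N; lia.
have state_lt t : t <= P -> t * X + 0 < tab_N M P.
  by move=> Ht; have := @index_lt t P.+1 0 X Ht isT; rewrite /tab_N; lia.
have fit j : j < Q -> P + (2 * n + 1 + j) < Y by move=> Hj; rewrite /tab_Y; lia.
pose wc j := sy_of (vl (cell_node 0 0 (P + (2 * n + 1 + j)))).
have Hw j : j < Q -> vl (cell_node 0 0 (P + (2 * n + 1 + j))) = inr (wc j) /\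
    [\/ wc j = None, wc j = Some (inl false) | wc j = Some (inl true)].
  move=> Hj; have := H _ (cell_lt 0 0 _ isT isT (fit j Hj)).
  rewrite kind_init ?fit //= /init_kind /ite ltnNge leq_addr /= addKn.
  have -> : (2 * n + 1 + j < 2 * n) = false by lia.
  have -> : (2 * n + 1 + j == 2 * n) = false by lia.
  have -> : 2 * n + 1 + j < 2 * n + 1 + Q by lia.
  rewrite /rule /wc; case/andP=> /or3P[] /eqP -> _; split=> //=.
  - exact: Or31.
  - exact: Or32.
  - exact: Or33.
(* Blanks persist to the right, so the free cells hold a word followed by blanks; its length is the
   position [k] of the first blank. *)
have Hnone j : j.+1 < Q -> wc j = None -> wc j.+1 = None.
  move=> Hj E; have := H _ (cell_lt 0 0 _ isT isT (fit j.+1 Hj)).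
  rewrite kind_init ?fit //= /init_kind /ite ltnNge leq_addr /= addKn.
  have -> : (2 * n + 1 + j.+1 < 2 * n) = false by lia.
  have -> : (2 * n + 1 + j.+1 == 2 * n) = false by lia.
  have -> : 2 * n + 1 + j.+1 < 2 * n + 1 + Q by lia.
  rewrite /rule ffunE inordK // src_left.
  have -> : cell_node 0 0 (P + (2 * n + 1 + j.+1)) - 1 = cell_node 0 0 (P + (2 * n + 1 + j)) by lia.
  by rewrite -/(wc j) E eqxx /wc /= => /andP[_ /eqP ->].
pose k := find (fun j => wc j == None) (iota 0 Q).
have Hk : k <= Q by rewrite -[X in _ <= X](size_iota 0 Q); apply: find_size.
pose u := mkseq (fun j => wc j == Some (inl true)) k.
have Hu j : j < Q -> wc j = nth None [seq Some (inl b) | b <- u] j.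
  move=> Hj; case: (ltnP j k) => Hjk.
    rewrite (nth_map false) ?size_mkseq // nth_mkseq //.
    have := before_find 0 Hjk; rewrite nth_iota // add0n.
    by have [_ Hc] := Hw j Hj; case: Hc => ->.
  rewrite nth_default; last by rewrite size_map size_mkseq.
  have HkQ : k < Q by lia.
  have Ek : wc k = None.
    have Hh : has (fun j => wc j == None) (iota 0 Q) by rewrite has_find size_iota.
    by have := nth_find 0 Hh; rewrite nth_iota // add0n => /eqP.
  elim: j Hj Hjk => [|j IH] Hj Hjk; first by have <- : k = 0 by lia.
  case: (ltnP j k) => H1; first by have <- : k = j.+1 by lia.
  by apply: Hnone => //; apply: IH; lia.
exists u; first by rewrite size_mkseq.
have init_ok i y : i < kt -> y < Y ->
    vl (cell_node 0 i y) = inr (tcell P ((conf u 0).2 (inord i)) y).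
  move=> Hi Hy; have := H _ (cell_lt 0 i y isT Hi Hy); rewrite kind_init //.
  rewrite tcell_init; have -> : (inord i == ord0 :> 'I_kt) = (i == 0) by rewrite -val_eqE /= inordK.
  rewrite {1}/ite; case: (i =P 0) => [Ei|_] /=; last by rewrite /rule => /eqP.
  rewrite /init_kind /ite ltnNge; case: (leqP P y) => HyP /=; last by rewrite /rule => /eqP.
  rewrite nth_pair_word; case: (ltnP (y - P) (2 * n)) => H1.
    by case: (odd _); [case: (nth false x _)|]; rewrite /rule /= => /eqP.
  case: (eqVneq (y - P) (2 * n)) => [_|H2]; first by rewrite /rule /= => /eqP.
  case: ltnP => H3; last first.
    by rewrite /rule nth_default => [/eqP //|]; rewrite size_map size_mkseq; lia.
  move=> _; have Hj : y - P - (2 * n + 1) < Q by lia.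
  have [Ev _] := Hw _ Hj; move: Ev; rewrite Hu //.
  by have -> : P + (2 * n + 1 + (y - P - (2 * n + 1))) = y by [lia]; rewrite Ei.
(* Because of the unconstrained borders, correctness is claimed on a window that shrinks by one cell
   on each side per step; at time [P] it is just the scanned cell. *)
have inv t : t <= P -> vl (t * X + 0) = inl (conf u t).1 /\
    forall i y, i < kt -> t <= y -> y + t <= 2 * P ->
      vl (cell_node t i y) = inr (tcell P ((conf u t).2 (inord i)) y).
  elim: t => [|t IH] Ht.
    split=> [|i y Hi _ Hy]; last by apply: init_ok => //; rewrite /tab_Y; lia.
    by have := H _ (state_lt 0 isT); rewrite kind_start /rule => /eqP.
  have [IH1 IH2] := IH (ltnW Ht).
  have IHP i (Hi : i < kt) : vl (cell_node t i P) = inr (tcell P ((conf u t).2 (inord i)) P).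
    by apply: IH2 => //; lia.
  split=> [|i y Hi Hy1 Hy2].
    have [E1 E2] := @rule_args u t 0 vl isT IH1 IHP.
    have := H _ (state_lt _ Ht); rewrite kind_state // /rule E1 E2 => /eqP ->; congr inl.
    by rewrite /conf iterS /step /next_state; case: (halting _) => //; case: (trans _ _).
  have Hy : y < Y by rewrite /tab_Y; lia.
  have Hz : 1 + (i * Y + y) < X by exact: cell_node_lt.
  have [E1 E2] := @rule_args u t _ vl Hz IH1 IHP.
  have := H _ (cell_lt t.+1 i y Ht Hi Hy); rewrite kind_cell // /cell_kind /ite.
  have -> : (y == 0) || (y == 2 * P) = false by lia.
  have Hp : pos_of P y < 4 by rewrite /pos_of /ite; repeat (case: eqP => // _).
  rewrite /rule -[8]/(0.+4.+4) /= E1 E2.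
  have -> : 8 + (i * 4 + pos_of P y) - 8 = i * 4 + pos_of P y by lia.
  rewrite modnMDl modn_small // divnMDl // divn_small // addn0 => /eqP ->; congr inr.
  rewrite tcell_step //; last by lia.
  rewrite !ffunE !inordK; try lia.
  rewrite !src_near //; try lia.
  rewrite !IH2 //=; try lia.
  by congr (next_cell _ _ _ _ (tcell _ _ _) (tcell _ _ _) (tcell _ _ _)); lia.
have [_ inv2] := inv P (leqnn _).
have Hacc : P.+1 * X < tab_N M P by rewrite /tab_N addn1.
have := H _ Hacc; rewrite kind_accept /rule ffunE inordK; last by lia.
rewrite -[P.+1 * X]addn0 src_head // inv2 //; last by lia.
have -> : inord 0 = ord0 :> 'I_kt by apply: val_inj; rewrite /= inordK.
by move/eqP.
Qed.
End TableauRun.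

(** * Verifiers as local constraints *)

(** A halted machine stays put, so the run may be extended to [P] steps, and a one-bit output is
    read off the scanned cell. *)
Lemma accept_cell M (p : {poly nat}) V w P : p.[size w]%R <= P ->
  outputs_within M p.[size w]%R w [:: V] ->
  V <-> tcell P ((iter P (@step M) (init M w)).2 ord0) P = Some (inl true).
Proof.
move=> HP [H1 H2].
have -> : iter P (@step M) (init M w) = iter p.[size w]%R (@step M) (init M w).
  rewrite -{1}(subnK HP) iterD iter_fix // {1}/step.
  by rewrite H1.
rewrite /tcell ltnn subnn; move: ((_ : config M).2 ord0).2 H2 => [|[[b|s]|] rr] //= [<- _].
by split=> [->|[]].
Qed.

(** [P] exceeds the length of every admissible pair, which hence fits into the right half of a row,
    and the running time on it. The bound for the longest witness serves for shorter ones, since [p]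
    is monotone. *)
Lemma NP_consistent L : in_NP L -> exists (M : TM) (p q : {poly nat}),
  forall x, let Q := q.[size x]%R in
    let P := (2 * size x + 1 + Q + p.[(2 * size x + 1 + Q)%N]%R).+1 in
    L x <-> exists vl, @tab_consistent M x Q P vl.
Proof.
case=> q [V [[M [p Hp]] HL]]; exists M, p, q => x Q P.
have HP : 2 * size x + 1 + Q < P by rewrite /P; lia.
have acc u : size u <= Q -> V (pair_word x u) <-> tcell P ((conf M x u P).2 ord0) P = Some (inl true).
  move=> Hu; apply: (accept_cell (p := p)); last exact: Hp.
  rewrite size_pair_word; apply: leq_trans (horner_nat_mono p (_ : _ <= 2 * size x + 1 + Q)) _.
    by rewrite leq_add2l.
  exact: leq_trans (leq_addl _ _) (leqnSn _).
rewrite HL; split=> [[u [Hu /acc]]|[vl /(consistent_run HP)[u Hu]]].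
  by move/(_ Hu)/(run_consistent HP Hu) => H; exists (actual M x P u).
by move/(acc u Hu) => H; exists u.
Qed.

(** * Expressibility of the reduction *)

Section PexpTree.
Variables (a : word -> nat -> nat) (nI : word -> nat).
Hypothesis Ha : pexp (fun w s => a w (nth 0 s 0)).
Hypothesis HnI : pexp (fun w _ => nI w).

Lemma pexp_pre : pexp (fun w s => pre (a w) (nth 0 s 0)).
Proof. by apply: (@pexp_bsum (fun _ s => nth 0 s 0) (fun w _ => a w)) => //; exact: pexp_var. Qed.

Ltac pexp_hook ::= lazymatch goal with
  | |- pexp (fun w s => pre _ (@?i w s)) =>
      refine (@pexp_app1 (fun w => pre (a w)) i _ _); [exact: pexp_pre | pexp_tac]
  end.

Lemma pexp_leg : pexp (fun w s => leg (a w) (nI w) (nth 0 s 0)).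
Proof. by rewrite /leg; pexp_tac. Qed.

Ltac pexp_hook ::= lazymatch goal with
  | |- pexp (fun w s => pre _ (@?i w s)) =>
      refine (@pexp_app1 (fun w => pre (a w)) i _ _); [exact: pexp_pre | pexp_tac]
  | |- pexp (fun w s => leg _ _ (@?i w s)) =>
      refine (@pexp_app1 (fun w => leg (a w) (nI w)) i _ _); [exact: pexp_leg | pexp_tac]
  end.

Lemma pexp_par_path : pexp (fun w s => par_path (a w) (nI w) (nth 0 s 0)).
Proof. by rewrite /par_path /leg_start; pexp_tac. Qed.

Lemma pexp_par_star : pexp (fun w s => par_star (a w) (nI w) (nth 0 s 0)).
Proof. by rewrite /par_star /leg_start; pexp_tac. Qed.
End PexpTree.

Ltac pexp_hook ::= fail.

Section PexpCover.
Variables (m n : word -> nat) (inc : word -> nat -> nat -> bool).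
Hypothesis Hm : pexp (fun w _ => m w).
Hypothesis Hn : pexp (fun w _ => n w).
Hypothesis Hinc : pexp (fun w s => inc w (nth 0 s 0) (nth 0 s 1)).

Ltac pexp_hook ::= lazymatch goal with
  | |- pexp (fun w s => nat_of_bool (inc w (@?i w s) (@?e w s))) =>
      refine (@pexp_app2 (fun w x y => nat_of_bool (inc w x y)) i e _ _ _); [assumption | pexp_tac | pexp_tac]
  | |- pexp (fun w s => deg _ _ (@?i w s)) =>
      refine (@pexp_app1 (fun w => deg (n w) (inc w)) i _ _); [assumption | pexp_tac]
  | |- pexp (fun w s => gid _ _ (@?i w s)) =>
      refine (@pexp_app1 (fun w => gid (m w) (n w)) i _ _); [assumption | pexp_tac]
  | |- pexp (fun w s => size_F _ _ _ (@?i w s)) =>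
      refine (@pexp_app1 (fun w => size_F (m w) (n w) (inc w)) i _ _); [assumption | pexp_tac]
  | |- pexp (fun w s => size_L _ _ _ (@?i w s)) =>
      refine (@pexp_app1 (fun w => size_L (m w) (n w) (inc w)) i _ _); [assumption | pexp_tac]
  | |- pexp (fun w s => size_Q _ _ _ (@?i w s)) =>
      refine (@pexp_app1 (fun w => size_Q (m w) (n w) (inc w)) i _ _); [assumption | pexp_tac]
  end.

Lemma pexp_cover_items :
  [/\ pexp (fun w s => item_size (m w) (n w) (inc w) (nth 0 s 0)),
      pexp (fun w _ => nb_items (m w) (n w) (inc w)) &
      pexp (fun w _ => bin_size (m w) (n w) (inc w))].
Proof.
have H1 : pexp (fun w s => deg (n w) (inc w) (nth 0 s 0)) by rewrite /deg; pexp_tac.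
have H2 : pexp (fun w _ => id_base (m w) (n w)) by rewrite /id_base; pexp_tac.
have H3 : pexp (fun w s => gid (m w) (n w) (nth 0 s 0)) by rewrite /gid; pexp_tac.
have H4 : pexp (fun w _ => wG (m w) (n w) (inc w)) by rewrite /wG; pexp_tac.
have H5 : pexp (fun w _ => wV (m w) (n w) (inc w)) by rewrite /wV; pexp_tac.
have H6 : pexp (fun w _ => wN (n w)) by rewrite /wN; pexp_tac.
have H7 : pexp (fun w _ => cap_u (m w) (n w) (inc w)) by rewrite /cap_u; pexp_tac.
have H8 : pexp (fun w _ => cap_v (m w) (n w) (inc w)) by rewrite /cap_v; pexp_tac.
have H9 : pexp (fun w _ => su1 (m w) (n w) (inc w)) by rewrite /su1; pexp_tac.
have H10 : pexp (fun w _ => su0 (m w) (n w) (inc w)) by rewrite /su0; pexp_tac.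
have H11 : pexp (fun w _ => sv1 (m w) (n w) (inc w)) by rewrite /sv1; pexp_tac.
have H12 : pexp (fun w _ => sv0 (m w) (n w) (inc w)) by rewrite /sv0; pexp_tac.
have H13 : pexp (fun w _ => big_base (m w) (n w) (inc w)) by rewrite /big_base; pexp_tac.
have H14 : pexp (fun w s => size_F (m w) (n w) (inc w) (nth 0 s 0)).
  by rewrite /size_F /e5 /fill_v /fill_u /fill_sv /fill_su; pexp_tac.
have H15 : pexp (fun w s => size_L (m w) (n w) (inc w) (nth 0 s 0)) by rewrite /size_L /e5; pexp_tac.
have H16 : pexp (fun w s => size_Q (m w) (n w) (inc w) (nth 0 s 0)) by rewrite /size_Q /e5; pexp_tac.
split.
- by rewrite /item_size /fcat /e5; pexp_tac.
- by rewrite /nb_items; pexp_tac.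
- by rewrite /bin_size /e5; pexp_tac.
Qed.
End PexpCover.

Section PexpTableau.
Variables (M : TM) (p q : {poly nat}).
Local Notation kt := (extra_tapes M).+1.

Definition wit_bound (w : word) : nat := q.[size w]%R.
Definition clock (w : word) : nat :=
  (2 * size w + 1 + wit_bound w + p.[(2 * size w + 1 + wit_bound w)%N]%R).+1.
Definition node_kind (w : word) : nat -> nat := kind M w (wit_bound w) (clock w).
Definition node_src (w : word) : nat -> nat -> nat := src M (clock w).
Definition nb_sets (w : word) : nat := cover_sets (value M) (kt + 4) (tab_N M (clock w)).
Definition nb_elements (w : word) : nat := cover_elements (value M) (kt + 4) (tab_N M (clock w)).
Definition set_inc (w : word) : nat -> nat -> bool :=
  cover_inc (inl (start M) : value M) (8 + 4 * kt) (@rule M) (tab_N M (clock w))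
    (node_kind w) (node_src w).

Ltac pexp_hook ::= lazymatch goal with
  | |- pexp (fun w s => nth 0 ?t (@?k w s)) => refine (@pexp_table t k _); pexp_tac
  | |- pexp (fun w s => horner ?f (@?k w s)) => refine (@pexp_horner f k _); pexp_tac
  | |- pexp (fun w s => node_kind w (@?c w s)) =>
      refine (@pexp_app1 node_kind c _ _); [assumption | pexp_tac]
  | |- pexp (fun w s => node_src w (@?c w s) (@?k w s)) =>
      refine (@pexp_app2 node_src c k _ _ _); [assumption | pexp_tac | pexp_tac]
  end.

Lemma pexp_set_inc :
  [/\ pexp (fun w _ => nb_sets w), pexp (fun w _ => nb_elements w) &
      pexp (fun w s => set_inc w (nth 0 s 0) (nth 0 s 1))].
Proof.
have H1 : pexp (fun w _ => wit_bound w) by rewrite /wit_bound; pexp_tac.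
have H2 : pexp (fun w _ => clock w) by rewrite /clock; pexp_tac.
have H3 : pexp (fun w _ => tab_Y (clock w)) by rewrite /tab_Y; pexp_tac.
have H4 : pexp (fun w _ => tab_X M (clock w)) by rewrite /tab_X; pexp_tac.
have H5 : pexp (fun w _ => tab_N M (clock w)) by rewrite /tab_N; pexp_tac.
have H6 : pexp (fun w s => node_kind w (nth 0 s 0)).
  by rewrite /node_kind /kind /init_kind /cell_kind /pos_of; pexp_tac.
have H7 : pexp (fun w s => node_src w (nth 0 s 0) (nth 0 s 1)).
  by rewrite /node_src /src; pexp_tac.
split.
- by rewrite /nb_sets /cover_sets; pexp_tac.
- by rewrite /nb_elements /cover_elements; pexp_tac.
- by rewrite /set_inc /cover_inc /label_inc /edge_inc /rule_fun /pi_fun /out_fun; pexp_tac.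
Qed.
End PexpTableau.

Ltac pexp_hook ::= fail.

(** * Encodings *)

(* A power of two is a number whose only odd divisor is 1. *)
Definition is_pow2 (y : nat) : bool := bsum y.+1 (fun d => odd d && (d %| y)) == 1.

Lemma is_pow2P y : reflect (exists i, y = 2 ^ i) (is_pow2 y).
Proof.
apply: (iffP eqP) => [H|[i ->]].
  have y_gt0 : 0 < y by case: y H => //; rewrite /bsum big_ord1.
  pose t (d : 'I_y.+1) : nat := odd d && (d %| y).
  (* The odd part of [y] is an odd divisor, and so is 1; as there is only one, they coincide, and
     [y] equals its 2-part. *)
  have Ho : y`_2^' < y.+1 by rewrite ltnS dvdn_leq // dvdn_part.
  have H1 : t (Ordinal (y_gt0 : 1 < y.+1)) = 1 by rewrite /t /= dvd1n.
  have H2 : t (Ordinal Ho) = 1 by rewrite /t /= dvdn_part odd_2'nat part_pnat.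
  have E1 := sum1_single (fun d : 'I_y.+1 => val d) H H1.
  have E2 := sum1_single (fun d : 'I_y.+1 => val d) H H2.
  exists (logn 2 y); rewrite -[LHS](@partnC 2 y) // p_part.
  by rewrite -[y`_2^']/(val (Ordinal Ho)) -E2 E1 muln1.
rewrite /bsum (eq_bigr (fun d : 'I_(2 ^ i).+1 => (val d == 1) * 1)).
  by rewrite (@bsum_pick _ 1 (fun=> 1)) // ltnS expn_gt0.
move=> d _; rewrite muln1; congr nat_of_bool; apply/idP/eqP => [/andP[Hd Hdvd]|->].
  have : coprime d (2 ^ i) by rewrite coprimeXr // coprimen2.
  by rewrite /coprime (gcdn_idPl Hdvd) => /eqP.
by rewrite dvd1n.
Qed.

(** Instead of computing powers of two, a loop can run over all [y <= k] and test them; this is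
    affordable because the numbers to be encoded are polynomially bounded. *)
Lemma binary_filter k : 0 < k -> binary k = [seq odd (k %/ y) | y <- iota 0 k.+1 & is_pow2 y].
Proof.
move=> Hk; rewrite /binary /mkseq; set K := trunc_log 2 k.
suff -> : [seq y <- iota 0 k.+1 | is_pow2 y] = [seq 2 ^ i | i <- iota 0 K.+1] by rewrite -map_comp.
apply: (irr_sorted_eq ltn_trans ltnn).
- by apply: sorted_filter; [exact: ltn_trans|exact: iota_ltn_sorted].
- rewrite sorted_map; apply: sub_sorted (iota_ltn_sorted 0 K.+1) => i j /=.
  by rewrite ltn_exp2l.
move=> y; rewrite mem_filter mem_iota add0n ltnS; apply/andP/mapP => [[/is_pow2P[i ->] Hi]|[i]].
  by exists i => //; rewrite mem_iota add0n ltnS; apply: trunc_log_max.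
rewrite mem_iota add0n ltnS => /= Hi ->; split; first by apply/is_pow2P; exists i.
by apply: (leq_trans _ (trunc_logP (isT : 1 < 2) Hk)); rewrite leq_exp2l.
Qed.

(** A [wexpr] has no conditional: a filter is expressed by a loop that runs once or not at all. *)
Lemma flatten_filter (T : Type) (F : nat -> seq T) (p : pred nat) s :
  flatten [seq F y | y <- s & p y] = flatten [seq flatten [seq F y | _ <- iota 0 (p y)] | y <- s].
Proof. by elim: s => //= y s IH; case: (p y); rewrite /= IH ?cats0. Qed.

Lemma pair_binary k v : 0 < k -> pair_word (binary k) v =
  flatten [seq flatten [seq [:: true] ++ [:: odd (k %/ y)] | _ <- iota 0 (is_pow2 y)]
          | y <- iota 0 k.+1] ++ ([:: false] ++ v).
Proof.
move=> Hk; rewrite -(flatten_filter (fun y => [:: true] ++ [:: odd (k %/ y)])).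
rewrite binary_filter //; elim: (filter _ _) => //= y s ->.
by [].
Qed.

Definition nat_adj (par : nat -> nat) (x y : nat) : bool :=
  (x != y) && ((0 < x) && (par x == y) || (0 < y) && (par y == x)).

Lemma adjacency_ptree n par : adjacency_matrix (ptree n par) =
  flatten [seq flatten [seq [:: nat_adj par x y] | y <- iota 0 n] | x <- iota 0 n].
Proof.
rewrite /adjacency_matrix -val_enum_ord -[in RHS]map_comp; congr flatten.
by apply: eq_map => x /=; rewrite flatten_map1 -map_comp.
Qed.

Lemma wpexp_encode (m T n : word -> nat) (par : word -> nat -> nat) k :
  pexp (fun w _ => m w) -> pexp (fun w _ => T w) -> pexp (fun w _ => n w) ->
  pexp (fun w s => par w (nth 0 s 0)) ->
  wpexp k (fun w s =>
    flatten [seq flatten [seq [:: true] ++ [:: odd (m w %/ y)] | _ <- iota 0 (is_pow2 y)]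
          | y <- iota 0 (m w).+1] ++ ([:: false] ++
    (flatten [seq flatten [seq [:: true] ++ [:: odd (T w %/ y)] | _ <- iota 0 (is_pow2 y)]
          | y <- iota 0 (T w).+1] ++ ([:: false] ++
     flatten [seq flatten [seq [:: nat_adj (par w) x y] | y <- iota 0 (n w)] | x <- iota 0 (n w)])))).
Proof.
move=> Hm HT Hn Hpar.
have H2 : pexp (fun w s => is_pow2 (nth 0 s 0)) by rewrite /is_pow2; pexp_tac.
have Hbits c K : pexp (fun w _ => c w) ->
  wpexp K (fun w s => flatten [seq flatten [seq [:: true] ++ [:: odd (c w %/ y)] | _ <- iota 0 (is_pow2 y)]
          | y <- iota 0 (c w).+1]).
  move=> Hc; apply: (@wpexp_for K (fun w _ => (c w).+1) (fun w _ y =>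
    flatten [seq [:: true] ++ [:: odd (c w %/ y)] | _ <- iota 0 (is_pow2 y)])); first by pexp_tac.
  apply: (@wpexp_for K.+1 (fun w s => is_pow2 (nth 0 s 0)) (fun w s _ =>
    [:: true] ++ [:: odd (c w %/ nth 0 s 0)])) => //.
  by apply: wpexp_cat; apply: wpexp_bit; pexp_tac.
apply: wpexp_cat; first exact: Hbits.
apply: wpexp_cat; first by apply: (@wpexp_bit _ (fun _ _ => false)); exact: pexp_const.
apply: wpexp_cat; first exact: Hbits.
apply: wpexp_cat; first by apply: (@wpexp_bit _ (fun _ _ => false)); exact: pexp_const.
apply: (@wpexp_for k (fun w _ => n w) (fun w _ x =>
  flatten [seq [:: nat_adj (par w) x y] | y <- iota 0 (n w)])) => //.
apply: (@wpexp_for k.+1 (fun w _ => n w) (fun w s y => [:: nat_adj (par w) (nth 0 s 0) y])) => //.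
apply: wpexp_bit; rewrite /nat_adj.
have P1 : pexp (fun w s => par w (nth 0 (behead s) 0)) by exact: pexp_behead Hpar.
by pexp_tac.
Qed.

(** * NP-hardness *)

(** One reduction for all classes: [par] only fixes the shape of the legs. Paths yield spiders,
    stars yield trees of diameter at most 4. *)
Lemma NP_hard_legs (C : sgraph -> Prop) (par : (nat -> nat) -> nat -> nat -> nat) :
  (forall a nI, leg_parent a nI (par a nI)) ->
  (forall a nI, pexp (fun w s => a w (nth 0 s 0)) -> pexp (fun w _ => nI w) ->
     pexp (fun w s => par (a w) (nI w) (nth 0 s 0))) ->
  (forall a nI, C (ptree (pre a nI).+1 (par a nI))) ->
  NP_hard (FireFightingInTime C).
Proof.
move=> Hpar Hexp HC L /NP_consistent [M [p [q HL]]].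
pose m := @nb_sets M p q; pose n := @nb_elements M p q; pose inc := @set_inc M p q.
pose a w := item_size (m w) (n w) (inc w); pose nI w := nb_items (m w) (n w) (inc w).
pose B w := bin_size (m w) (n w) (inc w); pose T w := m w + n w.
have N_gt0 w : 0 < tab_N M (clock p q w) by rewrite /tab_N addn1.
have m_gt0 w : 0 < m w.
  by rewrite muln_gt0 N_gt0; apply: (nb_labels_gt0 (inl (start M) : value M)).
have n_gt0 w : 0 < n w by rewrite addn_gt0 N_gt0.
have T_gt0 w : 0 < T w by rewrite addn_gt0 m_gt0.
exists (fun w => @FFInstance (ptree (pre (a w) (nI w)).+1 (par (a w) (nI w))) (B w).+1 (T w)
  isT (T_gt0 w)); split.
  have [Hm Hn Hinc] := pexp_set_inc M p q.
  have [Ha HnI HB] := pexp_cover_items Hm Hn Hinc.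
  have Hn1 : pexp (fun w _ => (pre (a w) (nI w)).+1).
    apply: pexp_succ; exact: (@pexp_app1 (fun w => pre (a w)) (fun w _ => nI w) (pexp_pre Ha) HnI).
  have We := @wpexp_encode (fun w => (B w).+1) T (fun w => (pre (a w) (nI w)).+1)
    (fun w => par (a w) (nI w)) 0 (pexp_succ HB) (pexp_add Hm Hn) Hn1 (Hexp a nI Ha HnI).
  apply: polytime_wpexp We _.
  move=> w s; rewrite -[RHS]/(pair_word (binary (B w).+1) (pair_word (binary (T w))
    (adjacency_matrix (ptree (pre (a w) (nI w)).+1 (par (a w) (nI w)))))).
  by rewrite !pair_binary // adjacency_ptree.
move=> w; split=> /=; first exact: HC.
have Hcov : L w <-> exact_cover (m w) (n w) (inc w).
  rewrite HL; apply: consistent_cover => [c Hc|c k Hc Hk].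
    exact: kind_lt.
  exact: src_lt.
have B_gt0 : 0 < B w by apply: bin_size_gt0.
have tot : T w * B w <= pre (a w) (nI w) by apply: total_size.
have a_le i : i < nI w -> a w i <= B w by apply: item_size_le.
rewrite Hcov; split=> [H|[F [HS HW]]].
  have [f Hf] := cover_packing (m_gt0 w) (n_gt0 w) H.
  exact: packing_winning B_gt0 (T_gt0 w) tot (Hpar _ _) _ Hf.
have [f Hf] : exists f, packing (nI w) (T w) (B w) (a w) f.
  exact: (@winning_packing (a w) (nI w) (T w) (B w) _ B_gt0 (T_gt0 w) a_le tot (Hpar _ _) F HS HW).
by apply: packing_cover Hf.
Qed.

Theorem theorem3 :
  NP_hard (FireFightingInTime tree) /\
  NP_hard (FireFightingInTime (fun G => tree G /\ diameter G <= 4)) /\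
  NP_hard (FireFightingInTime spider).
Proof.
split; [|split].
- apply: NP_hard_legs leg_parent_path pexp_par_path _ => a nI.
  by have [] := path_spider a nI.
- apply: NP_hard_legs leg_parent_star pexp_par_star _ => a nI.
  by split; [exact: star_tree|exact: star_diameter].
- exact: NP_hard_legs leg_parent_path pexp_par_path path_spider.
Qed.
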